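(* Let $\{(M_i,\tau_i)\}_{i=1}^d$ be a family of tracial von Neumann algebras. For any finitely generated unital $*$-subalgebras $A_i\subset M_i$, $i=1,\ldots,d$, and any scalars $\alpha_1,\ldots,\alpha_d>0$ satisfying $\sum_{i=1}^d\alpha_i=1$, one has \[ \sigma\left(\bigoplus_{i=1}^d A_i,\ \sum_{i=1}^d\alpha_i\tau_i\right)=\sum_{i=1}^d\left(\alpha_i^2\,\sigma(A_i,\tau_i)+\alpha_i(1-\alpha_i)\right). \]
   Context: A tracial von Neumann algebra $(M,\tau)$ is a finite von Neumann algebra $M$ with a faithful normal tracial state $\tau$. $M^\circ$ is the opposite algebra with trace $\tau^\circ$, and $M\bar\otimes M^\circ$ carries the trace $\tau\otimes\tau^\circ$. For a unital $*$-subalgebra $A\subset M$, $L^2(A\otimes A^\circ,\tau\otimes\tau^\circ)$ is the closure of $A\otimes A^\circ$ in $L^2(M\bar\otimes M^\circ,\tau\otimes\tau^\circ)$ and $(A\otimes A^\circ)''$ is the von Neumann algebra generated by $A\otimes A^\circ$. This Hilbert space is an $A$-$A$ bimodule via $x\cdot\xi\cdot y=(x\otimes y^\circ)\xi$, and has the commuting right action of $(A\otimes A^\circ)''$ by right multiplication. A derivation is a linear map $\delta\colon A\to L^2(A\otimes A^\circ,\tau\otimes\tau^\circ)$ with $\delta(xy)=x\cdot\delta(y)+\delta(x)\cdot y$. Finitely generated means generated as a unital $*$-algebra by a finite set; more generally, for a unital $*$-subalgebra $B\subset A$, $A$ is finitely generated over $B$ if $A=B\langle X\rangle$ (the unital $*$-algebra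 generated by $B\cup X$) for some finite $X=X^*\subset A$. $\mathrm{Der}_{1\otimes1}(B\subset A,\tau)$ is the space of derivations $\delta$ vanishing on $B$ such that $1\otimes1\in\mathrm{dom}(\delta^* )$, where $\delta$ is viewed as a densely defined operator $L^2(A,\tau)\to L^2(A\otimes A^\circ,\tau\otimes\tau^\circ)$. If $X=X^*$ is finite and $A=B\langle X\rangle$, then $\phi_X(\delta)=(\delta(x))_{x\in X}$ is an injective right $(A\otimes A^\circ)''$-linear map with closed range from the space of all derivations vanishing on $B$ into $L^2(A\otimes A^\circ,\tau\otimes\tau^\circ)^X$, giving the norm $\|\delta\|_X=(\sum_{x\in X}\|\delta(x)\|^2)^{1/2}$; the topology is independent of $X$, and closures are taken in it. The free Stein dimension is \[\sigma(B\subset A,\tau)=\dim\overline{\mathrm{Der}_{1\otimes1}(B\subset A,\tau)}_{(A\otimes A^\circ)''},\] the von Neumann dimension (with respect to $\tau\otimes\tau^\circ$) of the right Hilbert $(A\otimes A^\circ)''$-module $\phi_X\big(\overline{\mathrm{Der}_{1\otimes1}(B\subset A,\tau)}\big)\subset L^2(A\otimes A^\circ,\tau\otimes\tau^\circ)^X$; it does not depend on $X$. One writes $\sigma(A,\tau)=\sigma(\mathbb{C}\subset A,\tau)$. *)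

(* Defs.v *)
From HB Require Import structures.
From mathcomp Require Import all_boot all_order all_algebra finmap complex.
From mathcomp Require Import all_classical reals ring lra.
Set Implicit Arguments.
Unset Strict Implicit.
Unset Printing Implicit Defensive.
Import Order.TTheory GRing.Theory Num.Theory.
Local Open Scope classical_set_scope.
Local Open Scope ring_scope.

(** * Hilbert spaces *)

Section dot_norm.
Context (R : realType) (V : lmodType R[i]).

Definition dot_norm (f : {dot V for Num.conj}) (x : V) : R :=
  Num.sqrt (complex.Re (f x x)).

Definition dot_complete (f : {dot V for Num.conj}) :=
  forall u : nat -> V,
    (forall e : R, 0 < e -> exists N, forall m n, (N <= m)%N -> (N <= n)%N ->
       dot_norm f (u m - u n) < e) ->
    exists l, forall e : R, 0 < e -> exists N, forall n, (N <= n)%N ->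
       dot_norm f (u n - l) < e.

End dot_norm.

(* Inner products are linear in the first variable. *)
Record hilbert (R : realType) := Hilbert {
  hilbert_car :> lmodType R[i];
  inner : {dot hilbert_car for Num.conj};
  inner_complete : dot_complete inner }.

Notation "''[' u , v ]" := (inner _ u v) (format "''[' u ,  v ]") : ring_scope.

Definition hnorm (R : realType) (H : hilbert R) (x : H) : R :=
  dot_norm (inner H) x.

Section inner_theory.
Context (R : realType).

Fact dot_ge0 (V : lmodType R[i]) (f : {dot V for Num.conj}) (x : V) :
  0 <= f x x.
Proof.
have [->|/(@neq0_dnorm_gt0 _ _ _ f)/ltW//] := eqVneq x 0.
by rewrite linear0l.
Qed.

Fact dot_norm_lt (V : lmodType R[i]) (f : {dot V for Num.conj}) (x : V) (e : R) :
  0 < e -> (dot_norm f x < e) = (complex.Re (f x x) < e ^+ 2).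
Proof.
move=> e0; rewrite -ltr_sqrt ?exprn_gt0// sqrtr_sqr gtr0_norm//.
Qed.

Fact complexRe_sum (I : Type) (r : seq I) (F : I -> R[i]) :
  complex.Re (\sum_(i <- r) F i) = \sum_(i <- r) complex.Re (F i).
Proof. exact: raddf_sum. Qed.

Fact complexRe_ge0 (z : R[i]) : 0 <= z -> 0 <= complex.Re z.
Proof. by case: z => a b; rewrite lecE/= => /andP[]. Qed.

End inner_theory.

Section hilbert_sum.
Context (R : realType) (I : finType) (H : I -> hilbert R).

Definition hsum_car : Type := forall i, H i.

HB.instance Definition _ := gen_eqMixin hsum_car.
HB.instance Definition _ := gen_choiceMixin hsum_car.

Let add (x y : hsum_car) : hsum_car := fun i => x i + y i.
Let opp (x : hsum_car) : hsum_car := fun i => - x i.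
Let zero : hsum_car := fun=> 0.
Let scale (c : R[i]) (x : hsum_car) : hsum_car := fun i => c *: x i.

Fact hsum_addA : associative add.
Proof. by move=> x y z; apply: functional_extensionality_dep => i; apply: addrA. Qed.
Fact hsum_addC : commutative add.
Proof. by move=> x y; apply: functional_extensionality_dep => i; apply: addrC. Qed.
Fact hsum_add0 : left_id zero add.
Proof. by move=> x; apply: functional_extensionality_dep => i; apply: add0r. Qed.
Fact hsum_addN : left_inverse zero opp add.
Proof. by move=> x; apply: functional_extensionality_dep => i; apply: addNr. Qed.
HB.instance Definition _ :=
  GRing.isZmodule.Build hsum_car hsum_addA hsum_addC hsum_add0 hsum_addN.

Fact hsum_scaleA a b v : scale a (scale b v) = scale (a * b) v.
Proof. by apply: functional_extensionality_dep => i; apply: scalerA. Qed.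
Fact hsum_scale1 : left_id 1 scale.
Proof. by move=> v; apply: functional_extensionality_dep => i; apply: scale1r. Qed.
Fact hsum_scaleDr : right_distributive scale +%R.
Proof. by move=> a u v; apply: functional_extensionality_dep => i; apply: scalerDr. Qed.
Fact hsum_scaleDl v : {morph scale^~ v : a b / a + b}.
Proof. by move=> a b; apply: functional_extensionality_dep => i; apply: scalerDl. Qed.
HB.instance Definition _ := GRing.Zmodule_isLmodule.Build R[i] hsum_car
  hsum_scaleA hsum_scale1 hsum_scaleDr hsum_scaleDl.

Definition hsum_inner (x y : hsum_car) : R[i] := \sum_i '[x i, y i].

Fact hsum_innerP :
  bilinear_for *%R (Num.conj \; *%R : R[i] -> R[i] -> R[i]) hsum_inner.
Proof.
split=> u a x y; rewrite /hsum_inner /= mulr_sumr -big_split; apply: eq_bigr => i _.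
  by rewrite [LHS]linearPl.
by rewrite [LHS]linearPr.
Qed.
HB.instance Definition _ := bilinear_isBilinear.Build R[i] hsum_car hsum_car
  R[i] *%R (Num.conj \; *%R) hsum_inner hsum_innerP.

Fact hsum_inner_herm x y :
  hsum_inner x y = (-1) ^+ false * Num.conj (hsum_inner y x).
Proof.
rewrite expr0 mul1r rmorph_sum; apply: eq_bigr => i _.
by rewrite [LHS]hermC expr0 mul1r.
Qed.
HB.instance Definition _ := isHermitianSesquilinear.Build R[i] hsum_car false
  Num.conj hsum_inner hsum_inner_herm.

Fact hsum_inner_gt0 x : x != 0 -> 0 < hsum_inner x x.
Proof.
move=> x0; rewrite lt_neqAle; apply/andP; split; last first.
  by apply: sumr_ge0 => i _; exact: dot_ge0.
apply: contraNneq x0 => /esym x0; apply/eqP.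
apply: functional_extensionality_dep => i; apply/eqP.
move: x0; apply: contra_eqT => xi; rewrite gt_eqF// /hsum_inner (bigD1 i)//=.
rewrite ltr_pwDl//; first exact: (@neq0_dnorm_gt0 _ _ _ (inner (H i)) _ xi).
by apply: sumr_ge0 => j _; exact: dot_ge0.
Qed.
HB.instance Definition _ := isDotProduct.Build R[i] hsum_car hsum_inner
  hsum_inner_gt0.

Fact hsum_complete : dot_complete (hsum_inner : {dot hsum_car for Num.conj}).
Proof.
move=> u cu.
have cl : forall i, exists l : H i, forall e : R, 0 < e ->
    exists N, forall n, (N <= n)%N -> dot_norm (inner (H i)) (u n i - l) < e.
  move=> i; apply: inner_complete => e e0; have [N hN] := cu e e0.
  exists N => m n Nm Nn; have := hN m n Nm Nn.
  rewrite !dot_norm_lt//; apply: le_lt_trans.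
  rewrite /= /hsum_inner complexRe_sum (bigD1 i)//= lerDl sumr_ge0// => j _.
  exact/complexRe_ge0/dot_ge0.
pose l : hsum_car := fun i => sval (cid (cl i)).
have hl i : forall e : R, 0 < e ->
    exists N, forall n, (N <= n)%N -> dot_norm (inner (H i)) (u n i - l i) < e.
  exact: (svalP (cid (cl i))).
exists l => e e0.
pose e1 : R := Num.sqrt (e ^+ 2 / #|I|.+1%:R).
have e2 : 0 < e ^+ 2 / #|I|.+1%:R by rewrite divr_gt0 ?exprn_gt0.
have e10 : 0 < e1 by rewrite sqrtr_gt0.
have /choice[N hN] := fun i => hl i e1 e10.
exists (\max_i N i) => n Nn; rewrite dot_norm_lt//= /hsum_inner complexRe_sum.
apply: (@le_lt_trans _ _ (\sum_(i : I) (e ^+ 2 / #|I|.+1%:R))).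
  apply: ler_sum => i _; apply/ltW.
  have /hN : (N i <= n)%N by apply: leq_trans Nn; exact: leq_bigmax.
  by rewrite dot_norm_lt// sqr_sqrtr// ltW.
rewrite sumr_const cardT -cardE -[ltLHS]mulr_natr mulrAC ltr_pdivrMr//.
by rewrite ltr_pM2l ?exprn_gt0// ltr_nat.
Qed.

Definition hilbert_sum : hilbert R := Hilbert hsum_complete.

Definition hsum_inj (i : I) (x : H i) : hilbert_sum :=
  @dfwith I H (fun=> 0) i x.

End hilbert_sum.

(** * Von Neumann algebras *)

Definition op (R : realType) (H : hilbert R) : Type := H -> H.

HB.instance Definition _ (R : realType) (H : hilbert R) :=
  GRing.Lmodule.copy (op H) (H -> H).

Section operators.
Context (R : realType) (H : hilbert R).
Implicit Types (S T : op H) (A : set (op H)).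

Definition bounded_operator T :=
  (forall (c : R[i]) x y, T (c *: x + y) = c *: T x + T y) /\
  exists c : R, forall x, hnorm (T x) <= c * hnorm x.

Definition is_adjoint T S := forall x y, '[T x, y] = '[x, S y].

(* Bounded operators have a unique adjoint; the default is never used. *)
Definition adj T : op H := xget 0 [set S | is_adjoint T S].

Definition star_closed A := forall T, A T -> exists2 S, A S & is_adjoint T S.

Record unital_star_algebra A : Prop := UnitalStarAlgebra {
  usa_bounded : A `<=` bounded_operator;
  usa_id : A idfun;
  usa_comb : forall c S T, A S -> A T -> A (c *: S + T);
  usa_comp : forall S T, A S -> A T -> A (S \o T);
  usa_star : star_closed A }.

Definition commutant A : set (op H) :=
  [set T | bounded_operator T /\ forall S, A S -> S \o T = T \o S].

Definition von_neumann_algebra A :=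
  unital_star_algebra A /\ commutant (commutant A) = A.

Definition op_le S T := forall x, '[S x, x] <= '[T x, x].

Definition op_pos T := forall x, 0 <= '[T x, x].

(* least upper bound, within [A], of a set [D] of operators *)
Definition op_lub A (D : set (op H)) T :=
  [/\ A T, forall S, D S -> op_le S T &
      forall U, A U -> (forall S, D S -> op_le S U) -> op_le T U].

Definition op_directed (D : set (op H)) :=
  D !=set0 /\
  forall S T, D S -> D T -> exists U, [/\ D U, op_le S U & op_le T U].

Definition normal_functional A (tr : op H -> R[i]) :=
  forall D T, D `<=` A -> D `<=` op_pos -> op_directed D -> op_lub A D T ->
    forall c, (forall S, D S -> tr S <= c) -> tr T <= c.

Record faithful_normal_tracial_state A (tr : op H -> R[i]) : Prop :=
  FaithfulNormalTracialState {
  tr_linear : forall c S T, A S -> A T ->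
    tr (c *: S + T) = c * tr S + tr T;
  tr_id : tr idfun = 1;
  tr_pos : forall T, A T -> op_pos T -> 0 <= tr T;
  tr_tracial : forall S T, A S -> A T -> tr (S \o T) = tr (T \o S);
  tr_faithful : forall T, A T -> tr (adj T \o T) = 0 -> T = 0;
  tr_normal : normal_functional A tr }.

End operators.

(* The functional [tvn_tr] is only meaningful on [tvn_alg]. *)
Record tracial_von_neumann (R : realType) := TracialVonNeumann {
  tvn_space : hilbert R;
  tvn_alg : set (op tvn_space);
  tvn_tr : op tvn_space -> R[i];
  tvn_von_neumann : von_neumann_algebra tvn_alg;
  tvn_trP : faithful_normal_tracial_state tvn_alg tvn_tr }.

Arguments tvn_alg {R} t _.
Arguments tvn_tr {R} t _.

(** * Direct sums *)

Section direct_sum.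
Context (R : realType) (d : nat) (H : 'I_d -> hilbert R).

Definition op_sum (T : forall i, op (H i)) : op (hilbert_sum H) :=
  fun x i => T i (x i).

Definition direct_sum (A : forall i, set (op (H i))) :
    set (op (hilbert_sum H)) :=
  [set op_sum T | T in [set T | forall i, A i (T i)]].

(* the i-th component of op_sum S is x |-> op_sum S (hsum_inj x) i *)
Definition weighted_trace (alpha : 'I_d -> R) (tr : forall i, op (H i) -> R[i])
    (T : op (hilbert_sum H)) : R[i] :=
  \sum_i (alpha i)%:C%C * tr i (fun x => T (hsum_inj x) i).

End direct_sum.

(** * Existence of completions *)

(* Completion of a pre-Hilbert space given by a positive semidefinite form on a
   type of formal sums (no module laws are required of [P]). *)
Section completion.
Context (R : realType) (P : Type).
Variables (padd : P -> P -> P) (pscale : R[i] -> P -> P) (fm : P -> P -> R[i]).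
Hypothesis fmD : forall s t w, fm (padd s t) w = fm s w + fm t w.
Hypothesis fmZ : forall c s w, fm (pscale c s) w = c * fm s w.
Hypothesis fmH : forall s t, fm t s = Num.conj (fm s t).
Hypothesis fm0 : forall s, 0 <= fm s s.

Let N s : R := complex.Re (fm s s).
Let sqn (z : R[i]) : R := complex.Re z ^+ 2 + complex.Im z ^+ 2.
Let psub s t := padd s (pscale (-1) t).

Local Lemma fmDr s t w : fm w (padd s t) = fm w s + fm w t.
Proof. by rewrite fmH fmD rmorphD /= -!fmH. Qed.
Local Lemma fmZr c s w : fm w (pscale c s) = Num.conj c * fm w s.
Proof. by rewrite fmH fmZ rmorphM /= -fmH. Qed.
Local Lemma fmB s t w : fm (psub s t) w = fm s w - fm t w.
Proof. by rewrite fmD fmZ mulN1r. Qed.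
Local Lemma fmBr s t w : fm w (psub s t) = fm w s - fm w t.
Proof. by rewrite fmDr fmZr rmorphN1 mulN1r. Qed.

Local Lemma N0 s : 0 <= N s. Proof. exact: complexRe_ge0. Qed.
Local Lemma ImN s : complex.Im (fm s s) = 0.
Proof. by have := fm0 s; case: (fm s s) => a b; rewrite lecE/= => /andP[/eqP]. Qed.

Local Lemma sqn0 z : 0 <= sqn z.
Proof. by rewrite addr_ge0 ?sqr_ge0. Qed.
Local Lemma sqn_eq0 z : sqn z = 0 -> z = 0.
Proof.
case: z => a b /eqP; rewrite /sqn/= paddr_eq0 ?sqr_ge0// !sqrf_eq0.
by case/andP => /eqP -> /eqP ->.
Qed.
Local Lemma sqnD z w : sqn (z + w) <= 2 * sqn z + 2 * sqn w.
Proof.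
case: z w => a b [c d]; rewrite /sqn/=.
have := sqr_ge0 (a - c); have := sqr_ge0 (b - d); lra.
Qed.
Local Lemma sqnM z w : sqn (z * w) = sqn z * sqn w.
Proof. case: z w => a b [c d]; rewrite /sqn/=; ring. Qed.
Local Lemma sqnN z : sqn (- z) = sqn z.
Proof. case: z => a b; rewrite /sqn/=; ring. Qed.
Local Lemma sqnJ z : sqn (Num.conj z) = sqn z.
Proof. case: z => a b; rewrite /sqn/=; ring. Qed.
Local Lemma sqn_0 : sqn 0 = 0.
Proof. rewrite /sqn/=; ring. Qed.

Local Lemma CS_aux (a q b : R) : 0 <= q -> 0 <= b ->
  (forall r, 0 <= a - 2 * r * q + r ^+ 2 * q * b) -> q <= a * b.
Proof.
move=> q0 b0 h; have [b_0|bn0] := eqVneq b 0.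
  rewrite b_0 mulr0 leNgt; apply/negP => qp.
  have := h ((a + 1) / (2 * q)); rewrite b_0 mulr0 addr0.
  have -> : a - 2 * ((a + 1) / (2 * q)) * q = - 1 by field; lra.
  lra.
have bp : 0 < b by rewrite lt_neqAle eq_sym bn0.
have := h b^-1.
have -> : a - 2 * b^-1 * q + b^-1 ^+ 2 * q * b = a - q / b by field; lra.
by rewrite subr_ge0 ler_pdivrMr.
Qed.

Local Lemma CS s t : sqn (fm s t) <= N s * N t.
Proof.
apply: CS_aux; [exact: sqn0|exact: N0|] => r.
have := N0 (psub s (pscale (r%:C%C * fm s t) t)).
rewrite {1}/N !(fmB, fmBr, fmZ, fmZr) (fmH s t) rmorphM /=.
have := ImN s; have := ImN t; rewrite /N /sqn.
case: (fm s t) => x y; case: (fm s s) => a a'; case: (fm t t) => b b' /= b0 a0.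
rewrite ?b0 ?a0 => h; nra.
Qed.

Local Lemma NZ c s : N (pscale c s) = sqn c * N s.
Proof.
rewrite /N fmZ fmZr; have := ImN s.
case: (fm _ _) => x y /= ->; case: c => a b; rewrite /sqn/=; ring.
Qed.
Local Lemma NB s t : N (psub s t) = N (psub t s).
Proof. by rewrite /N !(fmB, fmBr); congr complex.Re; ring. Qed.
Local Lemma ND s t : N (padd s t) <= 2 * N s + 2 * N t.
Proof.
have := N0 (psub s t); rewrite /N !(fmB, fmBr, fmD, fmDr).
case: (fm s s) (fm s t) (fm t s) (fm t t) => [a a'] [b b'] [c c'] [e e'] /=.
lra.
Qed.
Local Lemma Ntri s t w : N (psub s w) <= 2 * N (psub s t) + 2 * N (psub t w).
Proof.
apply: le_trans (ND _ _); rewrite /N !(fmB, fmBr, fmD, fmDr).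
case: (fm s s) (fm s t) (fm t s) (fm t t) => [a a'] [b b'] [c c'] [e e'] /=.
case: (fm s w) (fm w s) (fm t w) (fm w t) (fm w w) =>
  [? ?] [? ?] [? ?] [? ?] [? ?] /=; lra.
Qed.

Let ev (Q : nat -> Prop) := exists n0, forall n, (n0 <= n)%N -> Q n.
Let cauchyP (S : nat -> P) := forall e : R, 0 < e ->
  exists n0, forall m n, (n0 <= m)%N -> (n0 <= n)%N -> N (psub (S m) (S n)) < e.
Let cvC (z : nat -> R[i]) l := forall e : R, 0 < e -> ev (fun n => sqn (z n - l) < e).

Local Lemma ev2 (Q1 Q2 Q : nat -> Prop) :
  (forall n, Q1 n -> Q2 n -> Q n) -> ev Q1 -> ev Q2 -> ev Q.
Proof.
move=> h [n1 h1] [n2 h2]; exists (maxn n1 n2) => n.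
by rewrite geq_max => /andP[l1 l2]; exact: h (h1 _ l1) (h2 _ l2).
Qed.
Local Lemma ev_ex (Q : nat -> Prop) : ev Q -> exists n, Q n.
Proof. by move=> [n h]; exists n; exact: h. Qed.
Local Lemma evT (Q : nat -> Prop) : (forall n, Q n) -> ev Q.
Proof. by exists 0%N. Qed.

Local Lemma small (x : R) : 0 <= x -> (forall e, 0 < e -> x <= e) -> x = 0.
Proof.
move=> x0 h; apply/eqP; rewrite eq_le x0 andbT leNgt; apply/negP => xp.
have := h (x / 2) (divr_gt0 xp (ltr0Sn _ _)); lra.
Qed.

Local Lemma cvC_uniq z l l' : cvC z l -> cvC z l' -> l = l'.
Proof.
move=> h h'; apply/eqP; rewrite -subr_eq0; apply/eqP/sqn_eq0/small => [|e e0].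
  exact: sqn0.
have e4 : 0 < e / 4 by lra.
have [n [h1 h2]] := ev_ex (ev2 (fun n a b => conj a b) (h _ e4) (h' _ e4)).
have -> : l - l' = - (z n - l) + (z n - l') by ring.
apply: le_trans (sqnD _ _) _; rewrite sqnN; lra.
Qed.
Local Lemma cvCD z z' l l' : cvC z l -> cvC z' l' ->
  cvC (fun n => z n + z' n) (l + l').
Proof.
move=> h h' e e0; have e4 : 0 < e / 4 by lra.
apply: ev2 (h _ e4) (h' _ e4) => n h1 h2.
have -> : z n + z' n - (l + l') = (z n - l) + (z' n - l') by ring.
apply: le_lt_trans (sqnD _ _) _; lra.
Qed.
Local Lemma cvCZ z l c : cvC z l -> cvC (fun n => c * z n) (c * l).
Proof.
move=> h e e0; have c1 : 0 < sqn c + 1 by have := sqn0 c; lra.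
have [n0 hn] := h _ (divr_gt0 e0 c1); exists n0 => n /hn.
rewrite -mulrBr sqnM ltr_pdivlMr//; have := sqn0 c; have := sqn0 (z n - l); nra.
Qed.
Local Lemma cvCJ z l : cvC z l -> cvC (fun n => Num.conj (z n)) (Num.conj l).
Proof.
move=> h e /h[n0 hn]; exists n0 => n /hn; by rewrite -rmorphB sqnJ.
Qed.
Local Lemma cvC_cst l : cvC (fun=> l) l.
Proof. by move=> e e0; apply: evT => n; rewrite subrr sqn_0. Qed.
Local Lemma cvC_ext z z' l : (forall n, z n = z' n) -> cvC z l -> cvC z' l.
Proof. by move=> h hz e /hz[n0 hn]; exists n0 => n /hn; rewrite h. Qed.

Local Lemma real_complete (u : nat -> R) :
  (forall e : R, 0 < e -> exists n0, forall m n, (n0 <= m)%N -> (n0 <= n)%N ->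
    (u m - u n) ^+ 2 < e) ->
  exists l, forall e : R, 0 < e -> ev (fun n => (u n - l) ^+ 2 < e).
Proof.
move=> cu; have cu1 (e : R) : 0 < e -> exists n0, forall m n, (n0 <= m)%N ->
    (n0 <= n)%N -> u m < u n + e.
  move=> e0; have [n0 h] := cu (e ^+ 2) (exprn_gt0 2 e0).
  exists n0 => m n nm nn; have := h m n nm nn; nra.
pose W := [set x : R | ev (fun n => x <= u n)].
have hW (e : R) : 0 < e -> exists n0, forall n, (n0 <= n)%N ->
    W (u n - e) /\ forall x, W x -> x <= u n + e.
  move=> e0; have [n0 h] := cu1 e e0; exists n0 => n nn; split.
    by exists n0 => m nm; rewrite lerBlDr; exact/ltW/h.
  move=> x [n1 hn1]; have := hn1 (maxn n0 n1) (leq_maxr _ _).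
  have := h (maxn n0 n1) n (leq_maxl _ _) nn; lra.
have supW : has_sup W.
  have [n0 h] := hW 1 ltr01; have [h1 h2] := h n0 (leqnn _).
  by split; [exists (u n0 - 1)|exists (u n0 + 1) => x /h2].
exists (sup W) => e e0.
pose e1 := Num.min 1 (e / 2).
have e10 : 0 < e1 by rewrite lt_min ltr01/=; lra.
have [n0 h] := hW e1 e10; exists n0 => n /h[h1 h2].
have l1 : u n - e1 <= sup W by apply: ub_le_sup => //; exact: (proj2 supW).
have l2 : sup W <= u n + e1 by apply: ge_sup => //; exact: (proj1 supW).
have l3 : e1 <= 1 by rewrite /e1 ge_min lexx.
have l4 : e1 <= e / 2 by rewrite /e1 ge_min lexx orbT.
nra.
Qed.

Local Lemma C_complete (z : nat -> R[i]) :
  (forall e : R, 0 < e -> exists n0, forall m n, (n0 <= m)%N -> (n0 <= n)%N ->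
    sqn (z m - z n) < e) -> exists l, cvC z l.
Proof.
move=> cz.
have [a ha] : exists l, forall e : R, 0 < e ->
    ev (fun n => (complex.Re (z n) - l) ^+ 2 < e).
  apply: real_complete => e /cz[n0 h]; exists n0 => m n nm nn.
  apply: le_lt_trans (h m n nm nn); case: (z m) (z n) => ? ? [? ?].
  by rewrite /sqn/= lerDl sqr_ge0.
have [b hb] : exists l, forall e : R, 0 < e ->
    ev (fun n => (complex.Im (z n) - l) ^+ 2 < e).
  apply: real_complete => e /cz[n0 h]; exists n0 => m n nm nn.
  apply: le_lt_trans (h m n nm nn); case: (z m) (z n) => ? ? [? ?].
  by rewrite /sqn/= lerDr sqr_ge0.
exists (Complex a b) => e e0; have e2 : 0 < e / 2 by lra.
apply: ev2 (ha _ e2) (hb _ e2) => n; case: (z n) => ? ?; rewrite /sqn/=; lra.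
Qed.

Local Lemma cauchy_bnd S : cauchyP S -> exists2 B : R, 0 < B & ev (fun n => N (S n) <= B).
Proof.
move=> cS; have [n0 h] := cS 1 ltr01.
exists (2 + 2 * N (S n0)); first by have := N0 (S n0); lra.
exists n0 => n nn; have := h n n0 nn (leqnn _).
have : N (S n) <= 2 * N (psub (S n) (S n0)) + 2 * N (S n0).
  apply: le_trans (ND _ _); rewrite /N !(fmB, fmBr, fmD, fmDr).
  case: (fm (S n) (S n)) (fm (S n) (S n0)) (fm (S n0) (S n)) (fm (S n0) (S n0))
    => [? ?] [? ?] [? ?] [? ?] /=; lra.
lra.
Qed.

Local Lemma sqn_fmB s s' t t' B : N s' <= B -> N t <= B ->
  sqn (fm s t - fm s' t') <= 2 * B * N (psub s s') + 2 * B * N (psub t t').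
Proof.
move=> hs ht.
have -> : fm s t - fm s' t' = fm (psub s s') t + fm s' (psub t t').
  rewrite fmB fmBr; ring.
apply: le_trans (sqnD _ _) _.
have := CS (psub s s') t; have := CS s' (psub t t').
have := N0 (psub s s'); have := N0 (psub t t'); nra.
Qed.

Local Lemma fm_cvg S T : cauchyP S -> cauchyP T ->
  exists l, cvC (fun n => fm (S n) (T n)) l.
Proof.
move=> cS cT; have [B B0 [n1 h1]] := cauchy_bnd cS.
have [B' B'0 [n2 h2]] := cauchy_bnd cT.
apply: C_complete => e e0; pose B1 := B + B'.
have B10 : 0 < B1 by rewrite /B1; lra.
have e4 : 0 < e / (4 * B1) by rewrite divr_gt0 ?mulr_gt0.
have [n3 h3] := cS _ e4; have [n4 h4] := cT _ e4.
exists (maxn (maxn n1 n2) (maxn n3 n4)) => m n.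
rewrite !geq_max => /andP[/andP[m1 m2] /andP[m3 m4]] /andP[/andP[l1 l2] /andP[l3 l4]].
have b1 : N (S n) <= B1 by have := h1 n l1; rewrite /B1; lra.
have b2 : N (T m) <= B1 by have := h2 m m2; rewrite /B1; lra.
apply: le_lt_trans (sqn_fmB _ _ b1 b2) _.
have := h3 m n m3 l3; have := h4 m n m4 l4; rewrite !ltr_pdivlMr ?mulr_gt0//; lra.
Qed.

Local Lemma cauchy_add S T c : cauchyP S -> cauchyP T ->
  cauchyP (fun n => padd (pscale c (S n)) (T n)).
Proof.
move=> cS cT e e0; have c1 : 0 < sqn c + 1 by have := sqn0 c; lra.
have e4 : 0 < e / 4 by lra.
have [n1 h1] := cS _ (divr_gt0 e4 c1); have [n2 h2] := cT _ e4.
exists (maxn n1 n2) => m n; rewrite !geq_max => /andP[m1 m2] /andP[l1 l2].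
have {h2} := h2 m n m2 l2; have {h1} := h1 m n m1 l1.
rewrite (ltr_pdivlMr _ _ c1) => k1 k2.
have : N (psub (padd (pscale c (S m)) (T m)) (padd (pscale c (S n)) (T n))) <=
   2 * (sqn c * N (psub (S m) (S n))) + 2 * N (psub (T m) (T n)).
  have -> : sqn c * N (psub (S m) (S n)) = N (pscale c (psub (S m) (S n))).
    by rewrite NZ.
  apply: le_trans (ND _ _); rewrite /N le_eqVlt; apply/orP; left; apply/eqP.
  congr complex.Re; rewrite !(fmB, fmBr, fmD, fmDr, fmZ, fmZr, rmorphN1); ring.
have := N0 (psub (S m) (S n)); nra.
Qed.

Local Lemma cauchy_cst s : cauchyP (fun=> s).
Proof.
move=> e e0; exists 0%N => _ _ _ _; rewrite /N !(fmB, fmBr) !subrr //.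
Qed.

Local Lemma cauchy_null D : cauchyP D -> (forall t, cvC (fun n => fm (D n) t) 0) ->
  forall e, 0 < e -> ev (fun n => N (D n) < e).
Proof.
move=> cD D0 e e0; have [B B0 [n1 h1]] := cauchy_bnd cD.
have e8 : 0 < e ^+ 2 / 8 by have := exprn_gt0 2 e0; lra.
have e8B : 0 < e ^+ 2 / 8 / B by exact: divr_gt0.
have [n2 h2] := cD _ e8B; pose m := maxn n1 n2.
have [n3 h3] := D0 (D m) _ e8.
exists (maxn m n3) => n; rewrite !geq_max => /andP[/andP[l1 l2] l3].
have := h3 n l3; rewrite subr0 => k3.
have := h2 n m l2 (leq_maxr _ _); rewrite ltr_pdivlMr// => k2.
have kB := h1 n l1.
have : sqn (fm (D n) (D n)) < e ^+ 2.
  have -> : fm (D n) (D n) = fm (D n) (D m) + fm (D n) (psub (D n) (D m)).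
    rewrite fmBr; ring.
  apply: le_lt_trans (sqnD _ _) _.
  have := CS (D n) (psub (D n) (D m)); have := N0 (psub (D n) (D m)); nra.
have := N0 (D n); rewrite /N /sqn ImN; nra.
Qed.

Let repr (f : P -> R[i]) S := cauchyP S /\ forall t, cvC (fun n => fm (S n) t) (f t).
Definition ksp : {pred P -> R[i]} := [pred f | `[< exists S, repr f S >]].

Local Lemma repr_comb c f g S T : repr f S -> repr g T ->
  repr (c *: f + g) (fun n => padd (pscale c (S n)) (T n)).
Proof.
move=> [cS hS] [cT hT]; split=> [|t]; first exact: cauchy_add.
apply: cvC_ext (cvCD (cvCZ c (hS t)) (hT t)) => n; by rewrite fmD fmZ.
Qed.

Local Lemma repr_fm s : repr (fm s) (fun=> s).
Proof. by split=> [|t]; [exact: cauchy_cst|exact: cvC_cst]. Qed.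

Local Lemma ksp_closed (s0 : P) : submod_closed ksp.
Proof.
split=> [|c f g].
  apply/asboolP; exists (fun=> pscale 0 s0); split=> [|t]; first exact: cauchy_cst.
  by apply: cvC_ext (cvC_cst _) => n; rewrite fmZ mul0r.
move=> /asboolP[S hS] /asboolP[T hT]; apply/asboolP; eexists; exact: (repr_comb c hS hT).
Qed.

Local Lemma repr_ip f g S T S' T' l : repr f S -> repr g T -> repr f S' -> repr g T' ->
  cvC (fun n => fm (S n) (T n)) l -> cvC (fun n => fm (S' n) (T' n)) l.
Proof.
have null h S1 S2 : repr h S1 -> repr h S2 -> forall e, 0 < e ->
    ev (fun n => N (psub (S1 n) (S2 n)) < e).
  move=> h1 h2; apply: cauchy_null.
    move=> e /(cauchy_add (-1) h2.1 h1.1)[n0 hn]; exists n0 => m n nm nn.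
    apply: le_lt_trans (hn m n nm nn); rewrite /N le_eqVlt; apply/orP; left.
    apply/eqP; congr complex.Re.
    rewrite !(fmB, fmBr, fmD, fmDr, fmZ, fmZr, rmorphN1); ring.
  move=> t; have := cvCD (h1.2 t) (cvCZ (-1) (h2.2 t)).
  rewrite mulN1r subrr; apply: cvC_ext => n; rewrite fmB; ring.
move=> hS hT hS' hT' hl e e0.
have [B B0 hB] := cauchy_bnd hS.1; have [B' B'0 hB'] := cauchy_bnd hT'.1.
pose B1 := B + B'; have B10 : 0 < B1 by rewrite /B1; lra.
have e4 : 0 < e / 4 by lra.
have B40 : 0 < 4 * B1 by lra.
have e8 : 0 < e / 4 / (4 * B1) by exact: divr_gt0.
apply: ev2 (ev2 (fun n a b => conj a b) hB hB')
  (ev2 (fun n a b => conj a b) (hl _ e4)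
  (ev2 (fun n a b => conj a b) (null _ _ _ hS' hS _ e8) (null _ _ _ hT' hT _ e8))).
move=> n [b b'] [k1 []]; rewrite !(ltr_pdivlMr _ _ B40) => k2 k3.
have -> : fm (S' n) (T' n) - l = (fm (S' n) (T' n) - fm (S n) (T n)) + (fm (S n) (T n) - l).
  ring.
apply: le_lt_trans (sqnD _ _) _.
have b1 : N (S n) <= B1 by rewrite /B1; lra.
have b2 : N (T' n) <= B1 by rewrite /B1; lra.
have := sqn_fmB (S' n) (T n) b1 b2; lra.
Qed.

Variable s0 : P.

HB.instance Definition _ :=
  GRing.isSubmodClosed.Build R[i] (P -> R[i]) ksp (ksp_closed s0).

Record kcar := KCar { kval : P -> R[i]; _ : kval \in ksp }.
HB.instance Definition _ := [isSub for kval].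
HB.instance Definition _ := [Choice of kcar by <:].
HB.instance Definition _ := [SubChoice_isSubLmodule of kcar by <:].

Let rep (f : kcar) := sval (cid (asboolW (valP f))).
Local Lemma repP (f : kcar) : repr (kval f) (rep f).
Proof. exact: (svalP (cid (asboolW (valP f)))). Qed.

Definition kip (f g : kcar) : R[i] := sval (cid (fm_cvg (repP f).1 (repP g).1)).

Local Lemma kipP f g S T : repr (kval f) S -> repr (kval g) T ->
  cvC (fun n => fm (S n) (T n)) (kip f g).
Proof.
move=> hS hT; apply: repr_ip (repP f) (repP g) hS hT _.
exact: (svalP (cid (fm_cvg (repP f).1 (repP g).1))).
Qed.

Local Lemma kcomb_repr c (f g : kcar) S T : repr (kval f) S -> repr (kval g) T ->
  repr (kval (c *: f + g)) (fun n => padd (pscale c (S n)) (T n)).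
Proof. exact: repr_comb. Qed.

Local Lemma kip_herm f g : kip f g = (-1) ^+ false * Num.conj (kip g f).
Proof.
rewrite expr0 mul1r; apply: (cvC_uniq (kipP (repP f) (repP g))).
by apply: cvC_ext (cvCJ (kipP (repP g) (repP f))) => n; rewrite [RHS]fmH.
Qed.

Local Lemma kip_linl c f g h : kip (c *: f + g) h = c * kip f h + kip g h.
Proof.
apply: (cvC_uniq (kipP (kcomb_repr c (repP f) (repP g)) (repP h))).
apply: cvC_ext (cvCD (cvCZ c (kipP (repP f) (repP h))) (kipP (repP g) (repP h))).
by move=> n; rewrite fmD fmZ.
Qed.

Local Lemma kip_bilinear :
  bilinear_for *%R (Num.conj \; *%R : R[i] -> R[i] -> R[i]) kip.
Proof.
split=> u a x y; first exact: kip_linl.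
by rewrite kip_herm kip_linl rmorphD rmorphM mulrDr (kip_herm u x) (kip_herm u y)
  !expr0 !mul1r.
Qed.
HB.instance Definition _ := bilinear_isBilinear.Build R[i] kcar kcar
  R[i] *%R (Num.conj \; *%R) kip kip_bilinear.
HB.instance Definition _ := isHermitianSesquilinear.Build R[i] kcar false
  Num.conj kip kip_herm.

Local Lemma kip_le f S B : repr (kval f) S -> ev (fun n => N (S n) <= B) ->
  complex.Re (kip f f) <= B.
Proof.
move=> hS hB; rewrite leNgt; apply/negP => h.
have e0 : 0 < (complex.Re (kip f f) - B) ^+ 2 by rewrite exprn_gt0// subr_gt0.
have [n []] := ev_ex (ev2 (fun n a b => conj a b) hB (kipP hS hS e0)).
rewrite /N; case: (fm _ _) => x x'; move: h; case: (kip f f) => a b.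
rewrite /sqn /= => h1 h2; have := sqr_ge0 (x' - b); nra.
Qed.

Local Lemma kip_ge0 f : 0 <= kip f f.
Proof.
have h := kipP (repP f) (repP f).
have hb : complex.Im (kip f f) ^+ 2 = 0.
  apply: small => [|e e0]; first exact: sqr_ge0.
  have [n] := ev_ex (h e e0); have := ImN (rep f n).
  case: (fm _ _) => x x' /= ->; case: (kip f f) => a b; rewrite /sqn/=.
  have := sqr_ge0 (x - a); nra.
have ha : 0 <= complex.Re (kip f f).
  rewrite leNgt; apply/negP => ha.
  have e0 : 0 < complex.Re (kip f f) ^+ 2 by nra.
  have [n] := ev_ex (h _ e0); have := N0 (rep f n); rewrite /N.
  case: (fm _ _) => x x' /=; move: ha; case: (kip f f) => a b; rewrite /sqn/=.
  have := sqr_ge0 (x' - b); nra.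
move: hb ha; case: (kip f f) => a b /= /eqP; rewrite sqrf_eq0 => /eqP -> a0.
by rewrite lecE/= eqxx.
Qed.

Local Lemma kip_gt0 f : f != 0 -> 0 < kip f f.
Proof.
move=> f0; rewrite lt_neqAle kip_ge0 andbT; apply: contraNneq f0 => /esym ff0.
apply/eqP/val_inj/funext => t /=; apply/sqn_eq0/small => [|e e0]; first exact: sqn0.
have e4 : 0 < e / 4 by lra.
have t1 : 0 < N t + 1 by have := N0 t; lra.
have e5 : 0 < (e / 4 / (N t + 1)) ^+ 2 by rewrite exprn_gt0// divr_gt0.
have [n []] := ev_ex (ev2 (fun n a b => conj a b) ((repP f).2 t _ e4)
   (kipP (repP f) (repP f) e5)).
rewrite ff0 subr0 {2}/sqn ImN expr0n addr0 -/(N _) => h1 h2.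
have {h2} : N (rep f n) < e / 4 / (N t + 1).
  by move: h2; rewrite ltr_pXn2r// ?nnegrE ?N0 ?ltW ?divr_gt0.
rewrite (ltr_pdivlMr _ _ t1) => h2.
have -> : kval f t = - (fm (rep f n) t - kval f t) + fm (rep f n) t by ring.
apply: le_trans (sqnD _ _) _; rewrite sqnN.
have := CS (rep f n) t; have := N0 (rep f n); nra.
Qed.
HB.instance Definition _ := isDotProduct.Build R[i] kcar kip kip_gt0.

Local Lemma kfm_subproof s : fm s \in ksp.
Proof. by apply/asboolP; exists (fun=> s); exact: repr_fm. Qed.
Definition kfm s : kcar := KCar (kfm_subproof s).

Local Lemma kfm_repr s : repr (kval (kfm s)) (fun=> s).
Proof. exact: repr_fm. Qed.

Local Lemma kip_fm s t : kip (kfm s) (kfm t) = fm s t.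
Proof. exact: (cvC_uniq (kipP (kfm_repr s) (kfm_repr t)) (cvC_cst _)). Qed.

Let Nk (f : kcar) := complex.Re (kip f f).

Local Lemma Nk_le f S s B : repr (kval f) S -> ev (fun n => N (psub (S n) s) <= B) ->
  Nk (f - kfm s) <= B.
Proof.
move=> hS [n0 h]; rewrite addrC -scaleN1r.
apply: kip_le (kcomb_repr _ (kfm_repr s) hS) _; exists n0 => n /h.
congr (_ <= _); rewrite /N; congr complex.Re.
rewrite !(fmB, fmBr, fmD, fmDr, fmZ, fmZr, rmorphN1); ring.
Qed.

Local Lemma kdense f e : 0 < e -> exists s, Nk (f - kfm s) < e.
Proof.
move=> e0; have e2 : 0 < e / 2 by lra.
have [n0 h] := (repP f).1 _ e2; exists (rep f n0).
suff : Nk (f - kfm (rep f n0)) <= e / 2 by lra.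
by apply: Nk_le (repP f) _; exists n0 => n nn; exact/ltW/h.
Qed.

Local Lemma Nktri x y z : Nk (x - z) <= 2 * Nk (x - y) + 2 * Nk (y - z).
Proof.
have -> : x - z = (x - y) + (y - z) by rewrite addrA subrK.
move: (x - y) (y - z) => {x y z}u v.
have : 0 <= Nk (u - v) by exact/complexRe_ge0/kip_ge0.
have -> : Nk (u - v) =
    complex.Re (kip u u + kip v v - (kip u v + Num.conj (kip u v))).
  by rewrite /Nk [kip _ _](@hnormB _ _ _ _ kip u v) expr0 mul1r.
have -> : Nk (u + v) =
    complex.Re (kip u u + kip v v + (kip u v + Num.conj (kip u v))).
  by rewrite /Nk [kip _ _](@hnormD _ _ _ _ kip u v) expr0 mul1r.
rewrite /Nk.
case: (kip u u) (kip v v) (kip u v) => [? ?] [? ?] [? ?] /=; lra.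
Qed.

Local Lemma NkC x y : Nk (x - y) = Nk (y - x).
Proof. by rewrite -opprB /Nk (@hnormN _ _ _ _ kip). Qed.

Local Lemma tri3 (x y a b c e : R) : 0 < e -> x <= 2 * a + 2 * y -> y <= 2 * b + 2 * c ->
  a < e / 12 -> b < e / 12 -> c < e / 12 -> x < e.
Proof. lra. Qed.
Local Lemma tri2 (x a b e : R) : 0 < e -> x <= 2 * a + 2 * b ->
  a < e / 8 -> b <= e / 8 -> x < e.
Proof. lra. Qed.

Local Lemma kip_complete : dot_complete (kip : {dot kcar for Num.conj}).
Proof.
move=> u cu.
have {}cu (e : R) : 0 < e -> exists n0, forall m n, (n0 <= m)%N -> (n0 <= n)%N ->
    Nk (u m - u n) < e.
  move=> e0; have s0' : 0 < Num.sqrt e by rewrite sqrtr_gt0.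
  have [n0 h] := cu _ s0'; exists n0 => m n nm nn.
  by have := h m n nm nn; rewrite dot_norm_lt// sqr_sqrtr// ltW.
have inv0 n : 0 < n.+1%:R^-1 :> R by rewrite invr_gt0.
have inv_ev (e : R) : 0 < e -> ev (fun n => n.+1%:R^-1 < e).
  move=> e0; exists (Num.truncn e^-1) => n nn; rewrite invf_plt ?posrE//.
  apply: lt_le_trans (truncnS_gt _) _; by rewrite ler_nat ltnS.
have /choice[t ht] := fun n => kdense (u n) (inv0 n).
have ct : cauchyP t.
  move=> e e0; have e8 : 0 < e / 12 by lra.
  have [n1 h1] := inv_ev _ e8; have [n2 h2] := cu _ e8.
  exists (maxn n1 n2) => m n; rewrite !geq_max => /andP[m1 m2] /andP[l1 l2].
  have -> : N (psub (t m) (t n)) = Nk (kfm (t m) - kfm (t n)).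
    rewrite /Nk /= linearBl /= !linearBr /= !kip_fm /N !(fmB, fmBr); congr complex.Re.
  apply: (tri3 e0 (Nktri (kfm (t m)) (u m) _) (Nktri (u m) (u n) _)).
  - by rewrite NkC; exact: lt_trans (ht m) (h1 m m1).
  - exact: h2.
  - exact: lt_trans (ht n) (h1 n l1).
pose f0 x := sval (cid (fm_cvg ct (cauchy_cst x))).
have hf0 : repr f0 t.
  by split=> // x; exact: (svalP (cid (fm_cvg ct (cauchy_cst x)))).
have f0k : f0 \in ksp by apply/asboolP; exists t.
exists (KCar f0k) => e e0; have e2 : 0 < e ^+ 2 / 8 by rewrite divr_gt0 ?exprn_gt0.
have [n1 h1] := inv_ev _ e2; have [n2 h2] := ct _ e2.
exists (maxn n1 n2) => n; rewrite geq_max => /andP[l1 l2].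
rewrite dot_norm_lt// -/(Nk _).
apply: (tri2 (exprn_gt0 2 e0) (Nktri (u n) (kfm (t n)) (KCar f0k))).
  exact: lt_trans (ht n) (h1 n l1).
rewrite NkC.
by apply: Nk_le (hf0 : repr (kval (KCar f0k)) t) _; exists n2 => m mm; exact/ltW/h2.
Qed.

Lemma completion_exists : exists (K : hilbert R) (ka : P -> K),
  (forall s t, '[ka s, ka t] = fm s t) /\
  forall (x : K) (e : R), 0 < e -> exists s, hnorm (x - ka s) < e.
Proof.
exists (Hilbert kip_complete), kfm; split; first exact: kip_fm.
move=> x e e0; have [s hs] := kdense x (exprn_gt0 2 e0); exists s.
by rewrite /hnorm dot_norm_lt.
Qed.

End completion.

Lemma schur_psd (C : numClosedFieldType) n (al be : 'M[C]_n) :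
  (forall i j, al j i = (al i j)^*) ->
  (forall x : 'I_n -> C, 0 <= \sum_i \sum_j x i * (x j)^* * al i j) ->
  (forall x : 'I_n -> C, 0 <= \sum_i \sum_j x i * (x j)^* * be i j) ->
  0 <= \sum_i \sum_j al i j * be i j.
Proof.
move=> aH a0 b0; have al_herm : al \is hermsymmx.
  apply/is_hermitianmxP; rewrite expr0 scale1r; apply/matrixP => i j.
  by rewrite !mxE aH.
have /hermitian_normalmx/orthomx_spectralP := al_herm.
set P := spectralmx al; set D := spectral_diag al => alE.
have Pu : P \is unitarymx by exact: spectral_unitarymx.
rewrite invmx_unitary// in alE.
have PP : P *m (P ^t* )%sesqui = 1%:M by exact/unitarymxP.
have alij i j : al i j = \sum_m (P m i)^* * D 0 m * P m j.
  rewrite {1}alE mxE; apply: eq_bigr => m _; congr (_ * _).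
  by rewrite mul_mx_diag !mxE.
have D0 m : 0 <= D 0 m.
  have := a0 (P m); congr (0 <= _).
  have -> : D 0 m = (P *m al *m (P ^t* )%sesqui) m m.
    by rewrite alE !mulmxA PP mul1mx -mulmxA PP mulmx1 mxE eqxx mulr1n.
  rewrite !mxE exchange_big; apply: eq_bigr => j _.
  rewrite !mxE mulr_suml; apply: eq_bigr => i _; ring.
have -> : \sum_i \sum_j al i j * be i j =
    \sum_m D 0 m * \sum_i \sum_j (P m i)^* * ((P m j)^*)^* * be i j.
  under eq_bigr do under eq_bigr do rewrite alij mulr_suml.
  under eq_bigr do rewrite exchange_big/=.
  rewrite exchange_big/=; apply: eq_bigr => m _.
  rewrite mulr_sumr; apply: eq_bigr => i _; rewrite mulr_sumr; apply: eq_bigr => j _.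
  rewrite conjCK; ring.
by apply: sumr_ge0 => m _; apply: mulr_ge0 => //; exact: (b0 (fun i => (P m i)^*)).
Qed.

(** * The Hilbert space of the tensor square and derivations *)

Section tensor.
Context (R : realType) (H : hilbert R).

Record tensor_model := TensorModel {
  tm_space : hilbert R;
  tm_tens : op H -> op H -> tm_space }.

(* [tm_tens a b] stands for a (x) b^o; since (d^o)^* b^o = (b d^* )^o, the
   inner product given by the trace tau (x) tau^o is
   <a (x) b^o, c (x) d^o> = tau (c^* a) tau (b d^* ). Together with totality
   this determines L^2(A (x) A^o) up to a unique unitary. *)
Definition is_L2_tensor (A : set (op H)) (tr : op H -> R[i])
    (K : tensor_model) :=
  (forall a b c d, A a -> A b -> A c -> A d ->
     '[tm_tens K a b, tm_tens K c d] = tr (adj c \o a) * tr (b \o adj d)) /\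
  (forall (xi : tm_space K) (e : R), 0 < e ->
     exists2 s : seq (op H * op H),
       (forall p, p \in s -> A p.1 /\ A p.2) &
       hnorm (xi - \sum_(p <- s) tm_tens K p.1 p.2) < e).

Section existence.
Variables (A : set (op H)) (tr : op H -> R[i]).
Hypothesis hA : unital_star_algebra A.
Hypothesis tr_lin :
  forall c S T, A S -> A T -> tr (c *: S + T) = c * tr S + tr T.
Hypothesis tr_ge0 : forall T, A T -> op_pos T -> 0 <= tr T.

Local Lemma adjP T : A T -> A (adj T) /\ is_adjoint T (adj T).
Proof.
move=> /(usa_star hA)[S AS hS].
have hT : is_adjoint T (adj T).
  exact: (@xgetPex _ (0 : op H) [set S | is_adjoint T S]) (ex_intro _ S hS).
split=> //; suff -> : adj T = S by [].
apply/funext => y; apply/eqP; rewrite -subr_eq0; apply: contraT => d0.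
have := @neq0_dnorm_gt0 _ _ _ (inner H) _ d0.
by rewrite [X in 0 < X]linearBr /= -hT -hS subrr ltxx.
Qed.

Local Lemma adj_uniq T S : A T -> is_adjoint T S -> adj T = S.
Proof.
move=> /adjP[_ hT] hS; apply/funext => y; apply/eqP; rewrite -subr_eq0.
apply: contraT => d0; have := @neq0_dnorm_gt0 _ _ _ (inner H) _ d0.
by rewrite [X in 0 < X]linearBr /= -hT -hS subrr ltxx.
Qed.

Local Lemma innerC (x y : H) : '[x, y] = ('[y, x])^*.
Proof. by rewrite [LHS]hermC expr0 mul1r. Qed.

Local Lemma is_adjointC (T S : op H) : is_adjoint T S -> is_adjoint S T.
Proof. by move=> h x y; rewrite innerC -h -innerC. Qed.

Local Lemma adjK T : A T -> adj (adj T) = T.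
Proof. by move=> AT; have [AS hS] := adjP AT; apply/adj_uniq/is_adjointC. Qed.

Local Lemma adj_comp S T : A S -> A T -> adj (S \o T) = adj T \o adj S.
Proof.
move=> AS AT; apply: adj_uniq; first exact: (usa_comp hA).
by move=> x y /=; rewrite (adjP AS).2 (adjP AT).2.
Qed.

Local Lemma A_0 : A 0.
Proof.
by rewrite -(addNr (idfun : op H)) -scaleN1r; apply: (usa_comb hA); apply: usa_id.
Qed.
Local Lemma A_Z c S : A S -> A (c *: S).
Proof. by move=> AS; rewrite -[_ *: _]addr0; apply: (usa_comb hA) => //; exact: A_0. Qed.
Local Lemma A_D S T : A S -> A T -> A (S + T).
Proof. by move=> AS AT; rewrite -[S]scale1r; apply: (usa_comb hA). Qed.
Local Lemma tr_0 : tr 0 = 0.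
Proof.
have := tr_lin (-1) A_0 A_0; rewrite scaler0 addr0 mulN1r addNr => h; exact: h.
Qed.

Local Lemma lin_comp U c S T : A U ->
  (U \o (c *: S + T) : op H) = c *: (U \o S : op H) + (U \o T : op H).
Proof. by move=> /(usa_bounded hA)[h _]; apply/funext => x; exact: h. Qed.

Let g a a' := tr (adj a' \o a).
Let h b b' := tr (b \o adj b').

Local Lemma pos_adj T : A T -> op_pos (adj T \o T) /\ op_pos (T \o adj T).
Proof.
move=> AT; have [_ hT] := adjP AT; split=> x.
  change (0 <= '[adj T (T x), x]).
  by rewrite (is_adjointC hT); exact: dot_ge0.
by change (0 <= '[T (adj T x), x]); rewrite hT; exact: dot_ge0.
Qed.

Local Lemma tr_adj (T : op H) : A T -> tr (adj T) = (tr T)^*.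
Proof.
move=> AT; have [AS hS] := adjP AT; have A1 := usa_id hA.
have key c : tr ((adj (c *: T + idfun)) \o (c *: T + idfun)) =
    c * c^* * tr (adj T \o T) + c^* * tr (adj T) + c * tr T + tr idfun.
  have -> : adj (c *: T + idfun) = c^* *: adj T + idfun.
    apply: adj_uniq; first exact: (usa_comb hA).
    move=> x y; rewrite /= [(c *: T + idfun) x]/(c *: T x + x).
    rewrite [(_ + idfun) y]/(c^* *: adj T y + y).
    by rewrite [LHS]linearPl [RHS]linearPr /= conjCK hS.
  have -> : ((c^* *: adj T + idfun) \o (c *: T + idfun) : op H) =
      (c * c^* ) *: (adj T \o T : op H) + (c^* *: adj T + (c *: T + idfun)).
    have /(usa_bounded hA)[l _] := AS.
    apply/funext => x; rewrite /= -[LHS]/(c^* *: adj T (c *: T x + x) + (c *: T x + x)).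
    rewrite -[RHS]/((c * c^* ) *: adj T (T x) + (c^* *: adj T x + (c *: T x + x))).
    by rewrite l scalerDr scalerA [c^* * c]mulrC -addrA.
  have A2 : A (c *: T + idfun) by exact: (usa_comb hA).
  have A3 : A (c^* *: adj T + (c *: T + idfun)) by exact: (usa_comb hA).
  have A4 : A (adj T \o T : op H) by exact: (usa_comp hA).
  rewrite (tr_lin _ A4 A3) (tr_lin _ AS A2) (tr_lin _ AT A1) !addrA//.
have pos c : 0 <= c * c^* * tr (adj T \o T) + c^* * tr (adj T) + c * tr T + tr idfun.
  rewrite -key; have AcT : A (c *: T + idfun) by exact: (usa_comb hA).
  apply: tr_ge0; last exact: (pos_adj AcT).1.
  by apply: (usa_comp hA) => //; exact: (adjP AcT).1.
have r1 : 0 <= tr idfun.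
  by apply: tr_ge0 => // x; exact: dot_ge0.
have r2 : 0 <= tr (adj T \o T).
  by apply: tr_ge0; [exact: (usa_comp hA)|exact: (pos_adj AT).1].
move: (pos 1) (pos (Complex 0 1)) r1 r2.
case: (tr idfun) (tr T) (tr (adj T)) (tr (adj T \o T))
  => [a1 a2] [b1 b2] [c1 c2] [d1 d2].
rewrite !lecE /= => /andP[/eqP e1 _] /andP[/eqP e2 _] /andP[/eqP e3 _] /andP[/eqP e4 _].
congr Complex; move: e1 e2; rewrite ?e3 ?e4; lra.
Qed.

Local Lemma gH a b : A a -> A b -> g b a = (g a b)^*.
Proof.
move=> Aa Ab; have [Ab' _] := adjP Ab.
rewrite /g -tr_adj; last exact: (usa_comp hA).
by rewrite (adj_comp Ab' Aa) (adjK Ab).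
Qed.
Local Lemma hH a b : A a -> A b -> h b a = (h a b)^*.
Proof.
move=> Aa Ab; have [Ab' _] := adjP Ab.
rewrite /h -tr_adj; last exact: (usa_comp hA).
by rewrite (adj_comp Aa Ab') (adjK Ab).
Qed.
Local Lemma g_lin c a b w : A a -> A b -> A w ->
  g (c *: a + b) w = c * g a w + g b w.
Proof.
move=> Aa Ab /adjP[Aw _]; rewrite /g lin_comp// tr_lin//; exact: (usa_comp hA).
Qed.
Local Lemma h_lin c a b w : A a -> A b -> A w ->
  h (c *: a + b) w = c * h a w + h b w.
Proof.
move=> Aa Ab /adjP[Aw _]; rewrite /h -tr_lin//; exact: (usa_comp hA).
Qed.
Local Lemma g_ge0 a : A a -> 0 <= g a a.
Proof.
move=> Aa; apply: tr_ge0; last exact: (pos_adj Aa).1.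
by apply: (usa_comp hA) => //; exact: (adjP Aa).1.
Qed.
Local Lemma h_ge0 a : A a -> 0 <= h a a.
Proof.
move=> Aa; apply: tr_ge0; last exact: (pos_adj Aa).2.
by apply: (usa_comp hA) => //; exact: (adjP Aa).1.
Qed.

Local Lemma gram_psd (f : op H -> op H -> R[i]) n (a : 'I_n -> op H) (x : 'I_n -> R[i]) :
  (forall c a b w, A a -> A b -> A w -> f (c *: a + b) w = c * f a w + f b w) ->
  (forall a b, A a -> A b -> f b a = (f a b)^*) ->
  (forall a, A a -> 0 <= f a a) ->
  (forall i, A (a i)) ->
  0 <= \sum_i \sum_j x i * (x j)^* * f (a i) (a j).
Proof.
move=> fl fH f0 Aa; pose z := \sum_i x i *: a i.
have Az : A z by apply: big_ind => [|? ? ? ?|i _]; [exact: A_0|exact: A_D|exact: A_Z].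
have fs w : A w -> f z w = \sum_i x i * f (a i) w.
  move=> Aw; suff [] : A z /\ f z w = \sum_i x i * f (a i) w by [].
  apply: (big_rec2 (fun u v => A u /\ f u w = v)).
    split; first exact: A_0.
    have := fl (-1) 0 0 w A_0 A_0 Aw; rewrite scaler0 addr0 mulN1r addNr; exact.
  by move=> i u v _ [Au <-]; split; [exact: (usa_comb hA)|exact: fl].
have := f0 z Az; congr (0 <= _); rewrite fs//; apply: eq_bigr => i _.
rewrite fH// fs// rmorph_sum mulr_sumr; apply: eq_bigr => j _.
by rewrite rmorphM /= -fH// mulrA.
Qed.

Let E := {p : op H * op H | A p.1 /\ A p.2}.
Let Ea (p : E) : A (sval p).1 := (svalP p).1.
Let Eb (p : E) : A (sval p).2 := (svalP p).2.
Let k (p q : E) := g (sval p).1 (sval q).1 * h (sval p).2 (sval q).2.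
Let fm (s t : seq E) := \sum_(p <- s) \sum_(q <- t) k p q.
Let mkE a b (Aa : A a) (Ab : A b) : E := exist _ (a, b) (conj Aa Ab).
Let pscale (c : R[i]) (s : seq E) :=
  [seq mkE (A_Z c (Ea p)) (Eb p) | p <- s].

Local Lemma fmD s t w : fm (s ++ t) w = fm s w + fm t w.
Proof. by rewrite /fm big_cat. Qed.
Local Lemma fmZ c s w : fm (pscale c s) w = c * fm s w.
Proof.
rewrite /fm big_map mulr_sumr; apply: eq_bigr => p _; rewrite mulr_sumr.
apply: eq_bigr => q _; rewrite /k /= mulrA; congr (_ * _).
rewrite -[c *: _]addr0 (g_lin c (Ea p) A_0 (Ea q)).
have := g_lin (-1) A_0 A_0 (Ea q); rewrite scaler0 addr0 mulN1r addNr => ->.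
by rewrite addr0.
Qed.
Local Lemma fmH s t : fm t s = (fm s t)^*.
Proof.
rewrite /fm exchange_big rmorph_sum; apply: eq_bigr => p _.
by rewrite rmorph_sum; apply: eq_bigr => q _; rewrite /k rmorphM /= (gH (Ea p) (Ea q)) (hH (Eb p) (Eb q)).
Qed.
Local Lemma fm0 s : 0 <= fm s s.
Proof.
pose al := \matrix_(i < size s, j < size s)
  g (sval (tnth (in_tuple s) i)).1 (sval (tnth (in_tuple s) j)).1.
pose be := \matrix_(i < size s, j < size s)
  h (sval (tnth (in_tuple s) i)).2 (sval (tnth (in_tuple s) j)).2.
have -> : fm s s = \sum_i \sum_j al i j * be i j.
  rewrite /fm big_tnth; apply: eq_bigr => i _; rewrite big_tnth.
  by apply: eq_bigr => j _; rewrite !mxE.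
apply: schur_psd => [i j|x|x]; first by rewrite !mxE (gH (Ea _) (Ea _)).
  under eq_bigr do under eq_bigr do rewrite mxE.
  apply: (@gram_psd g _ (fun i => (sval (tnth (in_tuple s) i)).1));
  [exact: g_lin|exact: gH|exact: g_ge0|move=> i; exact: Ea].
under eq_bigr do under eq_bigr do rewrite mxE.
apply: (@gram_psd h _ (fun i => (sval (tnth (in_tuple s) i)).2));
[exact: h_lin|exact: hH|exact: h_ge0|move=> i; exact: Eb].
Qed.

Lemma L2_tensor_exists : exists K, is_L2_tensor A tr K.
Proof.
have [K [ka [kaE kad]]] := completion_exists fmD fmZ fmH fm0 [::].
pose tens a b : K :=
  if pselect (A a /\ A b) is left p then ka [:: exist _ (a, b) p] else 0.
have tensE (p : E) : tens (sval p).1 (sval p).2 = ka [:: p].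
  rewrite /tens; case: pselect => [p'|[]]; last exact: (svalP p).
  case: p p' => [[a b] p] /= p'; congr (ka [:: exist _ _ _]); exact: Prop_irrelevance.
exists (TensorModel tens); split=> [a b c d Aa Ab Ac Ad /=|xi e e0 /=].
  rewrite (tensE (mkE Aa Ab)) (tensE (mkE Ac Ad)) kaE.
  by rewrite /fm !big_seq1.
have [s hs] := kad xi e e0; exists [seq sval p | p <- s].
  elim: s {hs} => [//|p s IH] q; rewrite inE => /orP[/eqP ->|/IH//].
  exact: (svalP p).
rewrite big_map; under eq_bigr do rewrite tensE.
suff <- : ka s = \sum_(p <- s) ka [:: p] by [].
apply/eqP; rewrite -subr_eq0; apply: contraT => d0.
have := @neq0_dnorm_gt0 _ _ _ (inner K) _ d0; set v := ka s - _.
have vt t : '[v, ka t] = 0.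
  rewrite /v [LHS]linearBl /= kaE linear_sumlz /= /fm.
  apply/eqP; rewrite subr_eq0; apply/eqP/eq_bigr => p _.
  by rewrite kaE /fm big_seq1.
rewrite {2}/v [X in 0 < X]linearBr /= vt linear_sumr /= big1 ?subr0 ?ltxx//.
Qed.

End existence.

(* The default is never used for the pairs (A, tau) of interest, by
   [L2_tensor_exists]. *)
Definition L2_tensor (A : set (op H)) (tr : op H -> R[i]) : tensor_model :=
  if pselect (exists K, is_L2_tensor A tr K) is left ex then sval (cid ex)
  else TensorModel (fun=> fun=> 0 : H).

Lemma L2_tensorP (A : set (op H)) (tr : op H -> R[i]) :
  unital_star_algebra A ->
  (forall c S T, A S -> A T -> tr (c *: S + T) = c * tr S + tr T) ->
  (forall T, A T -> op_pos T -> 0 <= tr T) ->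
  is_L2_tensor A tr (L2_tensor A tr).
Proof.
move=> hA h1 h2; rewrite /L2_tensor; case: pselect => [ex|[]].
  exact: (svalP (cid ex)).
exact: L2_tensor_exists hA h1 h2.
Qed.

End tensor.

(** * Von Neumann dimension *)

Section dimension.
Context (R : realType) (K : hilbert R) (I : finType).

Definition orth_proj (W : set (hilbert_sum (fun _ : I => K))) :
    op (hilbert_sum (fun _ : I => K)) :=
  fun v => xget 0 [set w | W w /\ forall u, W u -> '[v - w, u] = 0].

(* Let N be a finite von Neumann algebra with a faithful normal tracial state t,
   K = L^2(N, t), and e the image of 1 in K.  The dimension of a closed right
   N-submodule W of K^I is (Tr (x) t)(P), where P in M_I(N) is the orthogonal
   projection onto W, and t(T) = <T e, e> for T in N acting on K from the left. *)
Definition vn_dim (e : K) (W : set (hilbert_sum (fun _ : I => K))) : R :=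
  complex.Re (\sum_(i : I) '[orth_proj W (hsum_inj (i := i) e) i, e]).

End dimension.

Section derivations.
Context (R : realType) (H : hilbert R).
Variables (B A : set (op H)) (tr : op H -> R[i]).

Local Notation L2 := (tm_space (L2_tensor A tr)).
Local Notation "a (x) b" := (tm_tens (L2_tensor A tr) a b)
  (at level 40, left associativity).

(* x . xi . y = (x (x) y^o) xi, where (x (x) y^o)(a (x) b^o) = xa (x) (by)^o *)
Definition tens_mul (x y : op H) : op L2 :=
  xget 0 [set T | bounded_operator T /\
    forall a b, A a -> A b -> T (a (x) b) = (x \o a) (x) (b \o y)].

Definition derivation (delta : op H -> L2) :=
  [/\ forall c x y, A x -> A y -> delta (c *: x + y) = c *: delta x + delta y,
      forall x y, A x -> A y ->
        delta (x \o y) = tens_mul x idfun (delta y) + tens_mul idfun y (delta x)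
    & forall x, B x -> delta x = 0].

(* Membership in the domain of the adjoint of [delta], as an operator from
   L^2(A, tau) with domain A *)
Definition dom_adjoint (delta : op H -> L2) (eta : L2) :=
  exists c : R, forall a, A a ->
    `|'[delta a, eta]| <= (c * Num.sqrt (complex.Re (tr (adj a \o a))))%:C%C.

Definition Der11 : set (op H -> L2) :=
  [set delta | derivation delta /\ dom_adjoint delta (idfun (x) idfun)].

Definition generates (X : {fset op H}) :=
  star_closed [set` X] /\
  A = smallest (@unital_star_algebra R H) (B `|` [set` X]).

Definition finitely_generated_over := exists X, generates X.

Definition phi (X : {fset op H}) (delta : op H -> L2) :
    hilbert_sum (fun _ : X => L2) := fun x => delta (val x).
Arguments phi : clear implicits.

Definition closure_Der11 (X : {fset op H}) : set (op H -> L2) :=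
  [set delta | derivation delta /\ forall e : R, 0 < e ->
    exists2 delta', Der11 delta' & hnorm (phi X delta - phi X delta') < e].

(* The value does not depend on the choice of the generating set. *)
Definition free_stein_dim_over : R :=
  let X := xget fset0 [set X | generates X] in
  vn_dim (idfun (x) idfun) (phi X @` closure_Der11 X).

End derivations.

Definition scalars (R : realType) (H : hilbert R) : set (op H) :=
  [set c *: (idfun : op H) | c in [set: R[i]]].

Definition finitely_generated (R : realType) (H : hilbert R)
    (A : set (op H)) := finitely_generated_over (@scalars R H) A.

Definition free_stein_dim (R : realType) (H : hilbert R) (A : set (op H))
    (tr : op H -> R[i]) : R := free_stein_dim_over (@scalars R H) A tr.

(* Main.v *)
(* Let p_i be the central projections of the direct sum A.  A derivation of A splits
   into blocks: its compressions to the corners p_i . p_i are derivations of the A_i,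
   and its off-diagonal part is the inner derivation [., z], where the component of z
   in p_i L2 p_j (i <> j) is p_i . delta(p_i) . p_j.  Every inner derivation with
   z in L2 lies in Der11, since |<[a, z], 1 (x) 1>| <= 2 ||z|| ||a||_2; so the closure
   of Der11 for A is the direct sum of the closures for the A_i and of all the
   p_i L2 p_j with i <> j.  The corner p_i L2 p_i is L2(A_i (x) A_i^o) with the inner
   product multiplied by alpha_i^2, and p_i L2 p_j has dimension
   (tau (x) tau^o)(p_i (x) p_j^o) = alpha_i alpha_j; the latter sum over j <> i to
   alpha_i (1 - alpha_i).  Passing from generators to blocks is a bounded bijection of
   right modules, which preserves the von Neumann dimension. *)
Require Import Defs.
From mathcomp Require Import all_boot all_order all_algebra finmap complex.
From mathcomp Require Import all_classical reals.
From mathcomp Require Import ring lra.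
Set Implicit Arguments.
Unset Strict Implicit.
Unset Printing Implicit Defensive.
Import Order.TTheory GRing.Theory Num.Theory.
Import Normc.
Local Open Scope classical_set_scope.
Local Open Scope ring_scope.

(** * Hilbert spaces *)

(** The dimension is defined through a generating set picked by [xget], so nothing relates the set
    picked for the direct sum to those picked for the summands. No independence of the dimension
    from generators is proved for this: the values of a derivation on the picked generators are
    compared directly with its blocks, and both norm estimates rest on one principle, that a bound
    on the values at generators propagates to every element of the algebra. The von Neumann algebra
    (A (x) A^o)'' is never formed either. It suffices to commute with the right multiplications by u
    (x) v^o for u, v in A: that T |-> <T e, e> is a trace on such bounded maps follows by
    approximating T e by finite sums of tensors. On the block side the orthogonal projection is
    explicit: a projection for each summand on the diagonal, and the compression by p_i and p_j off
    it. It yields at once that the space of blocks is closed and what its dimension is; the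
    coefficient alpha_i^2 enters through <iota y, z> = alpha_i^2 <y, kappa z>. *)

Section modulus.
Context (R : realType).
Implicit Types (z w : R[i]).

Lemma norm_normc z : `|z| = (normc z)%:C%C.
Proof. by rewrite normc_def; case: z. Qed.

Lemma normc_ge0 z : 0 <= normc z.
Proof. by case: z => a b; exact: sqrtr_ge0. Qed.

Lemma normc_sqr z : normc z ^+ 2 = complex.Re z ^+ 2 + complex.Im z ^+ 2.
Proof. by case: z => a b; rewrite /normc sqr_sqrtr// addr_ge0 ?sqr_ge0. Qed.

Lemma normc_conj z : normc z^* = normc z.
Proof. by case: z => a b; rewrite /= sqrrN. Qed.

Lemma normc_Re z : `|complex.Re z| <= normc z.
Proof.
rewrite -sqrtr_sqr -[leRHS]ger0_norm ?normc_ge0// -sqrtr_sqr ler_wsqrtr//.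
by rewrite normc_sqr lerDl sqr_ge0.
Qed.

Lemma normc_real (x : R) : normc x%:C%C = `|x|.
Proof. by rewrite /= expr0n addr0 sqrtr_sqr. Qed.

End modulus.

Section hilbert_theory.
Context (R : realType) (H : hilbert R).
Implicit Types (x y z : H) (c : R[i]) (e : R).

Lemma inner_conj x y : '[x, y] = ('[y, x])^*.
Proof. by rewrite [LHS]hermC expr0 mul1r. Qed.
Lemma innerDl x y z : '[x + y, z] = '[x, z] + '[y, z].
Proof. by rewrite [LHS]linearDl. Qed.
Lemma innerZl c x z : '[c *: x, z] = c * '[x, z].
Proof. by rewrite [LHS]linearZl_LR. Qed.
Lemma innerNl x z : '[- x, z] = - '[x, z].
Proof. by rewrite -scaleN1r innerZl mulN1r. Qed.
Lemma innerBl x y z : '[x - y, z] = '[x, z] - '[y, z].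
Proof. by rewrite innerDl innerNl. Qed.
Lemma inner0l z : '[0, z] = 0.
Proof. by rewrite -(scale0r 0) innerZl mul0r. Qed.
Lemma innerDr x y z : '[z, x + y] = '[z, x] + '[z, y].
Proof. by rewrite inner_conj innerDl rmorphD /= -!inner_conj. Qed.
Lemma innerZr c x z : '[z, c *: x] = c^* * '[z, x].
Proof. by rewrite inner_conj innerZl rmorphM /= -inner_conj. Qed.
Lemma innerNr x z : '[z, - x] = - '[z, x].
Proof. by rewrite inner_conj innerNl rmorphN /= -inner_conj. Qed.
Lemma innerBr x y z : '[z, x - y] = '[z, x] - '[z, y].
Proof. by rewrite innerDr innerNr. Qed.
Lemma inner0r z : '[z, 0] = 0.
Proof. by rewrite inner_conj inner0l conjC0. Qed.
Lemma inner_suml (I : Type) (r : seq I) (P : pred I) (F : I -> H) z :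
  '[\sum_(i <- r | P i) F i, z] = \sum_(i <- r | P i) '[F i, z].
Proof. exact: (big_morph (fun x => '[x, z]) (fun x y => innerDl x y z) (inner0l z)). Qed.
Lemma inner_sumr (I : Type) (r : seq I) (P : pred I) (F : I -> H) z :
  '[z, \sum_(i <- r | P i) F i] = \sum_(i <- r | P i) '[z, F i].
Proof. exact: (big_morph (fun x => '[z, x]) (fun x y => innerDr x y z) (inner0r z)). Qed.

Lemma inner_ge0 x : 0 <= '[x, x].
Proof. exact: dot_ge0. Qed.

Lemma inner_hnorm x : '[x, x] = (hnorm x ^+ 2)%:C%C.
Proof.
rewrite /hnorm /dot_norm sqr_sqrtr; last exact/complexRe_ge0/inner_ge0.
by have := inner_ge0 x; rewrite lecE; case: ('[x, x]) => a b /= /andP[/eqP ->].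
Qed.

Lemma hnorm_ge0 x : 0 <= hnorm x.
Proof. exact: sqrtr_ge0. Qed.

Lemma hnorm_sqr x : hnorm x ^+ 2 = complex.Re '[x, x].
Proof. by rewrite inner_hnorm. Qed.

Lemma inner_eq0 x : '[x, x] = 0 -> x = 0.
Proof.
move=> h; apply/eqP; apply: contraT => /(@neq0_dnorm_gt0 _ _ _ (inner H)).
by rewrite [X in 0 < X]h ltxx.
Qed.

Lemma hnorm_eq0 x : hnorm x = 0 -> x = 0.
Proof. by move=> h; apply: inner_eq0; rewrite inner_hnorm h expr0n. Qed.

Lemma hnorm0 : hnorm (0 : H) = 0.
Proof. by rewrite /hnorm /dot_norm [X in complex.Re X]inner0l sqrtr0. Qed.

Lemma hnormZ c x : hnorm (c *: x) = normc c * hnorm x.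
Proof.
apply/(@pexpIrn _ 2) => //; rewrite ?nnegrE ?hnorm_ge0 ?mulr_ge0 ?normc_ge0 ?hnorm_ge0//.
rewrite exprMn hnorm_sqr innerZl innerZr inner_hnorm normc_sqr.
by case: c => a b /=; ring.
Qed.

Lemma hnormN x : hnorm (- x) = hnorm x.
Proof. by rewrite -scaleN1r hnormZ normcN normc1 mul1r. Qed.

Lemma hnormBC x y : hnorm (x - y) = hnorm (y - x).
Proof. by rewrite -opprB hnormN. Qed.

Lemma cauchy_schwarz x y : normc '[x, y] <= hnorm x * hnorm y.
Proof.
rewrite -ler_sqr ?nnegrE ?mulr_ge0 ?normc_ge0 ?hnorm_ge0//.
rewrite exprMn normc_sqr !hnorm_sqr.
apply: (@Defs.CS R H +%R *:%R (fun x y => '[x, y])).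
- by move=> *; exact: innerDl.
- by move=> *; exact: innerZl.
- by move=> s t; exact: inner_conj.
- exact: inner_ge0.
Qed.

Lemma hnormD x y : hnorm (x + y) <= hnorm x + hnorm y.
Proof.
rewrite -ler_sqr ?nnegrE ?addr_ge0 ?hnorm_ge0// sqrrD !hnorm_sqr innerDl !innerDr.
rewrite (inner_conj y x); have := cauchy_schwarz x y.
have := normc_Re '[x, y]; rewrite !inner_hnorm.
case: ('[x, y]) => a b /= h1 h2; have := ler_norm a; lra.
Qed.

Lemma hnorm_tri x y z : hnorm (x - z) <= hnorm (x - y) + hnorm (y - z).
Proof. by apply: le_trans (hnormD _ _); rewrite addrA subrK. Qed.

Lemma hnorm_sum (I : Type) (r : seq I) (P : pred I) (F : I -> H) :
  hnorm (\sum_(i <- r | P i) F i) <= \sum_(i <- r | P i) hnorm (F i).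
Proof.
apply: (big_ind2 (fun x (y : R) => hnorm x <= y)) => [|x a y b h1 h2|//].
  by rewrite hnorm0.
by apply: le_trans (hnormD _ _) _; apply: lerD.
Qed.

Lemma hnorm_small x : (forall e, 0 < e -> hnorm x <= e) -> x = 0.
Proof.
move=> h; apply/hnorm_eq0/eqP; rewrite eq_le hnorm_ge0 andbT leNgt.
apply/negP => x0; have := h (hnorm x / 2) (divr_gt0 x0 (ltr0Sn _ _)); lra.
Qed.

Lemma inner_ext x y : (forall z, '[x, z] = '[y, z]) -> x = y.
Proof.
by move=> h; apply/subr0_eq/inner_eq0; rewrite innerBl h subrr.
Qed.

Definition cvg_seq (u : nat -> H) x :=
  forall e, 0 < e -> exists N, forall n, (N <= n)%N -> hnorm (u n - x) < e.

Lemma cvg_seq_cauchy (u : nat -> H) :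
  (forall e, 0 < e -> exists N, forall m n, (N <= m)%N -> (N <= n)%N ->
    hnorm (u m - u n) < e) -> exists x, cvg_seq u x.
Proof. exact: inner_complete. Qed.

Lemma cvg_seq_uniq u x y : cvg_seq u x -> cvg_seq u y -> x = y.
Proof.
move=> hx hy; apply/subr0_eq/hnorm_small => e e0.
have e2 : 0 < e / 2 by lra.
have [n1 h1] := hx _ e2; have [n2 h2] := hy _ e2.
have := h1 _ (leq_maxl n1 n2); have := h2 _ (leq_maxr n1 n2).
have := hnorm_tri x (u (maxn n1 n2)) y.
rewrite (hnormBC x (u _)); lra.
Qed.

Lemma inv_nat_small e : 0 < e -> exists N, forall n, (N <= n)%N -> n.+1%:R^-1 < e.
Proof.
move=> e0; exists (Num.truncn e^-1) => n nn; rewrite invf_plt ?posrE//.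
by apply: lt_le_trans (truncnS_gt _) _; rewrite ler_nat ltnS.
Qed.

Lemma inv_nat_gt0 n : 0 < n.+1%:R^-1 :> R.
Proof. by rewrite invr_gt0. Qed.

Lemma cvg_seq_inv u x : (forall n, hnorm (u n - x) < n.+1%:R^-1) -> cvg_seq u x.
Proof.
move=> h e /inv_nat_small[N hN]; exists N => n /hN; exact: lt_trans.
Qed.

Lemma cvg_seq_comb c u v x y :
  cvg_seq u x -> cvg_seq v y -> cvg_seq (fun n => c *: u n + v n) (c *: x + y).
Proof.
move=> hu hv e e0; have c0 : 0 < normc c + 1 by have := normc_ge0 c; lra.
have e2 : 0 < e / 2 by lra.
have [n1 h1] := hu _ (divr_gt0 e2 c0); have [n2 h2] := hv _ e2.
exists (maxn n1 n2) => n; rewrite geq_max => /andP[/h1 {}h1 /h2 {}h2].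
have -> : c *: u n + v n - (c *: x + y) = c *: (u n - x) + (v n - y).
  by rewrite opprD addrACA scalerBr.
apply: le_lt_trans (hnormD _ _) _; rewrite hnormZ.
move: h1; rewrite ltr_pdivlMr//; have := hnorm_ge0 (u n - x); have := normc_ge0 c.
nra.
Qed.

Definition closed_subspace (W : set H) :=
  [/\ W 0, forall c x y, W x -> W y -> W (c *: x + y) &
    forall x, (forall e, 0 < e -> exists2 y, W y & hnorm (x - y) < e) -> W x].

End hilbert_theory.

(** * Existence of the orthogonal projection onto a closed subspace *)

Section projection.
Context (R : realType) (H : hilbert R) (W : set H).
Hypothesis hW : closed_subspace W.
Implicit Types (x y z : H).

Lemma subspaceB x y : W x -> W y -> W (x - y).
Proof. by move=> Wx Wy; rewrite addrC -scaleN1r; case: hW => _ h _; apply: h. Qed.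
Lemma subspaceZ c x : W x -> W (c *: x).
Proof. by move=> Wx; rewrite -[_ *: _]addr0; case: hW => h0 h _; apply: h. Qed.

Lemma parallelogram x y :
  hnorm (x + y) ^+ 2 + hnorm (x - y) ^+ 2 = 2 * hnorm x ^+ 2 + 2 * hnorm y ^+ 2.
Proof.
rewrite !hnorm_sqr innerDl innerBl !innerDr !innerNr.
case: ('[x, x]) ('[x, y]) ('[y, x]) ('[y, y]) => [? ?] [? ?] [? ?] [? ?] /=; ring.
Qed.

Lemma minimal_orth y u :
  (forall c, hnorm y ^+ 2 <= hnorm (y - c *: u) ^+ 2) -> '[y, u] = 0.
Proof.
(* The optimal multiple of [u] has coefficient <y, u> / ||u||^2. The [+ 1] in [b] avoids the case u
   = 0 and still leaves a strict decrease unless <y, u> = 0. *)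
move=> h; pose b := hnorm u ^+ 2 + 1; have b0 : 0 < b by rewrite ltr_wpDl ?sqr_ge0.
have := h (b^-1%:C%C * '[y, u]).
rewrite !hnorm_sqr innerBl !innerBr !innerZl !innerZr (inner_conj u y).
rewrite (inner_hnorm u) (_ : hnorm u ^+ 2 = b - 1); last by rewrite addrK.
have bi : b^-1 * b = 1 by rewrite mulVf// gt_eqF.
have : 0 < b^-1 by rewrite invr_gt0.
case: ('[y, y]) ('[y, u]) => n n' [p q] /=; move: (b^-1) bi => r rb r0 h2.
have h3 : 0 <= - (2 * r * (p ^+ 2 + q ^+ 2)) + r * (r * b - r) * (p ^+ 2 + q ^+ 2).
  by move: h2; rewrite -subr_ge0; congr (0 <= _); ring.
have h4 : r * (p ^+ 2 + q ^+ 2) <= 0.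
  rewrite rb in h3; have := sqr_ge0 p; have := sqr_ge0 q; nra.
have h5 : p ^+ 2 + q ^+ 2 <= 0 by move: h4; rewrite pmulr_rle0.
have p0 : p ^+ 2 = 0 by have := sqr_ge0 p; have := sqr_ge0 q; lra.
have q0 : q ^+ 2 = 0 by have := sqr_ge0 p; have := sqr_ge0 q; lra.
by move/eqP: p0; move/eqP: q0; rewrite !sqrf_eq0 => /eqP -> /eqP ->.
Qed.

Lemma projection_exists v : exists w, W w /\ forall u, W u -> '[v - w, u] = 0.
Proof.
have [W0 WD Wc] := hW.
pose D := [set hnorm (v - w) ^+ 2 | w in W].
have D_inf : has_inf D.
  split; first by exists (hnorm (v - 0) ^+ 2), 0.
  by exists 0 => _ [w _ <-]; rewrite sqr_ge0.
pose m := inf D.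
have mD w : W w -> m <= hnorm (v - w) ^+ 2.
  by move=> Ww; apply: ge_inf; [case: D_inf|exists w].
have near e : 0 < e -> exists2 w, W w & hnorm (v - w) ^+ 2 < m + e.
  by move=> e0; have [_ [w Ww <-] h] := inf_adherent e0 D_inf; exists w.
have key w w' : W w -> W w' ->
    hnorm (w - w') ^+ 2 <= 2 * hnorm (v - w) ^+ 2 + 2 * hnorm (v - w') ^+ 2 - 4 * m.
  move=> Ww Ww'; have := parallelogram (v - w) (v - w').
  have -> : v - w - (v - w') = w' - w by rewrite opprB addrC addrA subrK.
  have -> : v - w + (v - w') = 2%:R *: (v - 2^-1 *: (w + w')).
    rewrite scalerBr scalerA divff// ?pnatr_eq0// scale1r scaler_nat mulr2n.
    by rewrite addrACA -opprD.
  have /mD : W (2^-1 *: (w + w')).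
    by rewrite scalerDr; apply: WD => //; exact: subspaceZ.
  rewrite hnormZ exprMn (hnormBC w w').
  have -> : normc (2%:R : R[i]) = 2.
    by have := normc_real (2 : R); rewrite rmorph_nat ger0_norm.
  lra.
have /choice[w hw] : forall n : nat, exists w, W w /\ hnorm (v - w) ^+ 2 < m + n.+1%:R^-1.
  by move=> n; have [w] := near _ (inv_nat_gt0 R n); exists w.
have [x hx] : exists x, cvg_seq w x.
  apply: cvg_seq_cauchy => e e0; have e4 : 0 < e ^+ 2 / 4 by rewrite divr_gt0 ?exprn_gt0.
  have [N hN] := inv_nat_small e4; exists N => i j /hN hi /hN hj.
  rewrite -ltr_sqr ?nnegrE ?hnorm_ge0//; last exact: ltW.
  have [Wi h1] := hw i; have [Wj h2] := hw j.
  have := key _ _ Wi Wj; move: (i.+1%:R^-1) (j.+1%:R^-1) hi hj h1 h2 => ? ? *; lra.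
have Wx : W x.
  apply: Wc => e /hx[N hN]; exists (w N); first by case: (hw N).
  by rewrite hnormBC; exact: hN.
have xm : hnorm (v - x) ^+ 2 <= m.
  rewrite leNgt; apply/negP => lt.
  pose c := hnorm (v - x) + 1.
  have c0 : 0 < c by have := hnorm_ge0 (v - x); rewrite /c; lra.
  (* If ||v - y||^2 < m + e and ||y - x|| < e with e <= 1, then ||v - x||^2 - m is smaller than
     [8 * c * e]; this choice of [e] makes that a contradiction. *)
  pose e := Num.min 1 ((hnorm (v - x) ^+ 2 - m) / (8 * c)).
  have e1 : e <= 1 by rewrite /e ge_min lexx.
  have e2 : e * (8 * c) <= hnorm (v - x) ^+ 2 - m.
    by rewrite -ler_pdivlMr ?mulr_gt0// /e ge_min lexx orbT.
  have e0 : 0 < e by rewrite /e lt_min ltr01 divr_gt0 ?subr_gt0 ?mulr_gt0.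
  have [N1 h1] := hx _ e0.
  have [N2 h2] := inv_nat_small e0.
  have := h1 _ (leq_maxl N1 N2); have := h2 _ (leq_maxr N1 N2).
  have [_] := hw (maxn N1 N2); move: (w _) => y.
  have := hnorm_tri v y x; have := hnorm_ge0 (v - y); have := hnorm_ge0 (v - x).
  have := hnorm_ge0 (y - x).
  move: e2; rewrite /c; clear -e0 e1; clearbody e m.
  move: (hnorm (v - x)) (hnorm (v - y)) (hnorm (y - x)) (_ %:R^-1) => a b k r.
  move=> a2 k0 a0 b0 tri b2 re ke.
  have [ka|ak] := leP k a; last by nra.
  have : (a - k) ^+ 2 <= b ^+ 2 by rewrite ler_sqr ?nnegrE; lra.
  nra.
exists x; split=> // u Wu.
apply: minimal_orth => c; apply: le_trans xm _.
have /mD : W (c *: u + x) by exact: WD.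
by have -> : v - (c *: u + x) = v - x - c *: u by rewrite opprD addrCA addrC.
Qed.

End projection.

(** * Bounded maps between Hilbert spaces, and density arguments *)

Section bounded_maps.
Context (R : realType).
Implicit Types (H : hilbert R).

Definition bounded_map H1 H2 (T : H1 -> H2) :=
  (forall (c : R[i]) x y, T (c *: x + y) = c *: T x + T y) /\
  exists c : R, forall x, hnorm (T x) <= c * hnorm x.

Section one_map.
Context (H1 H2 : hilbert R) (T : H1 -> H2).
Hypothesis hT : bounded_map T.

Lemma bmP c x y : T (c *: x + y) = c *: T x + T y.
Proof. exact: hT.1. Qed.
Lemma bmD x y : T (x + y) = T x + T y.
Proof. by rewrite -{1}[x]scale1r bmP scale1r. Qed.
Lemma bm0 : T 0 = 0.
Proof. by apply: (addrI (T 0)); rewrite -bmD !addr0. Qed.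
Lemma bmZ c x : T (c *: x) = c *: T x.
Proof. by rewrite -[c *: x]addr0 bmP bm0 addr0. Qed.
Lemma bmN x : T (- x) = - T x.
Proof. by rewrite -scaleN1r bmZ scaleN1r. Qed.
Lemma bmB x y : T (x - y) = T x - T y.
Proof. by rewrite bmD bmN. Qed.
Lemma bm_sum (I : Type) (r : seq I) (P : pred I) (F : I -> H1) :
  T (\sum_(i <- r | P i) F i) = \sum_(i <- r | P i) T (F i).
Proof. exact: (big_morph T bmD bm0). Qed.
Lemma bm_bound : exists2 c : R, 0 < c & forall x, hnorm (T x) <= c * hnorm x.
Proof.
have [_ [c hc]] := hT; exists (`|c| + 1) => [|x]; first by rewrite ltr_wpDl.
apply: le_trans (hc x) _; rewrite ler_wpM2r ?hnorm_ge0//.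
by have := ler_norm c; lra.
Qed.
Lemma bm_cvg u x : cvg_seq u x -> cvg_seq (T \o u) (T x).
Proof.
move=> h e e0; have [c c0 hc] := bm_bound.
have [N hN] := h _ (divr_gt0 e0 c0); exists N => n /hN.
rewrite ltr_pdivlMr// => lt; rewrite /= -bmB.
by apply: le_lt_trans (hc _) _; rewrite mulrC.
Qed.
End one_map.

Lemma bm_id H : bounded_map (fun x : H => x).
Proof. by split=> //; exists 1 => x; rewrite mul1r. Qed.

Lemma bm_comp H1 H2 H3 (S : H2 -> H3) (T : H1 -> H2) :
  bounded_map S -> bounded_map T -> bounded_map (fun x => S (T x)).
Proof.
move=> hS hT; split=> [c x y|]; first by rewrite (bmP hT) (bmP hS).
have [a a0 ha] := bm_bound hS; have [b b0 hb] := bm_bound hT.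
exists (a * b) => x; apply: le_trans (ha _) _.
by rewrite -mulrA ler_wpM2l// ltW.
Qed.

Lemma bm_comb H1 H2 (S T : H1 -> H2) c : bounded_map S -> bounded_map T ->
  bounded_map (fun x => c *: S x + T x).
Proof.
move=> hS hT; split=> [d x y|].
  rewrite (bmP hS) (bmP hT) !scalerDr !scalerA mulrC -!addrA; congr (_ + _).
  by rewrite addrCA.
have [a a0 ha] := bm_bound hS; have [b b0 hb] := bm_bound hT.
exists (normc c * a + b) => x; apply: le_trans (hnormD _ _) _.
rewrite hnormZ mulrDl -mulrA lerD// ler_wpM2l// normc_ge0//.
Qed.

Lemma bm_sub H1 H2 (S T : H1 -> H2) : bounded_map S -> bounded_map T ->
  bounded_map (fun x => S x - T x).
Proof.
move=> hS hT; have := bm_comb (-1) hT hS; congr bounded_map.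
by apply/funext => x; rewrite scaleN1r addrC.
Qed.

Lemma closed_kernel H1 H2 (T : H1 -> H2) : bounded_map T ->
  closed_subspace [set x | T x = 0].
Proof.
move=> hT; split=> /= [|c x y Tx Ty|x hx]; first exact: bm0.
  by rewrite (bmP hT) Tx Ty scaler0 addr0.
apply: hnorm_small => e e0; have [c c0 hc] := bm_bound hT.
have [y Ty] := hx _ (divr_gt0 e0 c0); rewrite ltr_pdivlMr// => lt.
rewrite -[T x]subr0 -Ty -(bmB hT); apply: le_trans (hc _) _.
by rewrite mulrC ltW.
Qed.

Lemma closed_functional H (f : H -> R[i]) (a : R) :
  (forall c x y, f (c *: x + y) = c * f x + f y) ->
  (forall x, normc (f x) <= a * hnorm x) ->
  closed_subspace [set x | f x = 0].
Proof.
move=> fl fa; have f0 : f 0 = 0.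
  by have := fl (-1) 0 0; rewrite scaler0 addr0 mulN1r addNr.
split=> //= [c x y fx fy|x hx]; first by rewrite fl fx fy mulr0 addr0.
apply/eq0_normc/eqP; rewrite eq_le normc_ge0 andbT; apply/ler_addgt0Pl => e e0.
have a0 : 0 < `|a| + 1 by rewrite ltr_wpDl.
have [y fy] := hx _ (divr_gt0 e0 a0); rewrite ltr_pdivlMr// => lt.
have -> : f x = f (x - y).
  by rewrite addrC -scaleN1r fl fy mulr0 add0r.
rewrite addr0; apply: le_trans (fa _) _; apply: le_trans (ltW lt); rewrite mulrC.
by rewrite ler_wpM2l ?hnorm_ge0//; have := ler_norm a; lra.
Qed.

(** The sums carry no coefficients: the sets in use consist of elementary tensors, which absorb
    scalars. *)
Definition spans H (D : set H) := forall x (e : R), 0 < e ->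
  exists2 s : seq H, (forall y, y \in s -> D y) & hnorm (x - \sum_(y <- s) y) < e.

Lemma spans_sub H (D W : set H) : spans D -> closed_subspace W ->
  D `<=` W -> forall x, W x.
Proof.
move=> hD [W0 WD Wc] DW x; apply: Wc => e e0; have [s sD hs] := hD x e e0.
exists (\sum_(y <- s) y) => //.
elim: s sD {hs} => [|y s IH] sD; first by rewrite big_nil.
rewrite big_cons -[y]scale1r; apply: WD.
  by apply/DW/sD; rewrite mem_head.
by apply: IH => z zs; apply: sD; rewrite inE zs orbT.
Qed.

Lemma spans_ext H1 H2 (D : set H1) (S T : H1 -> H2) : spans D ->
  bounded_map S -> bounded_map T -> (forall x, D x -> S x = T x) ->
  forall x, S x = T x.
Proof.
move=> hD hS hT h x; apply/subr0_eq.
apply: (spans_sub hD (closed_kernel (bm_sub hS hT))) => y Dy /=.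
by rewrite h ?subrr.
Qed.

Lemma spans_orth H (D : set H) x : spans D -> (forall y, D y -> '[x, y] = 0) ->
  x = 0.
Proof.
move=> hD h; apply: inner_eq0.
apply: (spans_sub hD (W := [set y | '[y, x] = 0])) => [|y Dy /=].
  apply: (@closed_functional _ (fun y => '[y, x]) (hnorm x)) => [c y z|y].
    by rewrite innerDl innerZl.
  by rewrite mulrC; exact: cauchy_schwarz.
by rewrite inner_conj h ?conjC0.
Qed.

Definition adjoint_maps H1 H2 (T : H1 -> H2) (S : H2 -> H1) :=
  forall x y, '[T x, y] = '[x, S y].

Lemma spans_adjoint H1 H2 (D1 : set H1) (D2 : set H2) (T : H1 -> H2) (S : H2 -> H1) :
  spans D1 -> spans D2 -> bounded_map T -> bounded_map S ->
  (forall x y, D1 x -> D2 y -> '[T x, y] = '[x, S y]) -> adjoint_maps T S.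
Proof.
(* Density is used in one variable at a time, with the other one fixed; the second variable is
   treated by the same statement with [T] and [S] exchanged by conjugation. *)
have key (K1 K2 : hilbert R) (U : K1 -> K2) (V : K2 -> K1) (D : set K1) y : spans D ->
    bounded_map U -> (forall x, D x -> '[U x, y] = '[x, V y]) ->
    forall x, '[U x, y] = '[x, V y].
  move=> hD hU h x; apply/subr0_eq.
  apply: (spans_sub hD (W := [set x | '[U x, y] - '[x, V y] = 0])) => [|z Dz /=].
    have [c c0 hc] := bm_bound hU.
    apply: (@closed_functional _ (fun x => '[U x, y] - '[x, V y])
      (c * hnorm y + hnorm (V y))) => [d z w|z].
      rewrite (bmP hU) !innerDl !innerZl; ring.
    apply: le_trans (le_normcD _ _) _; rewrite normcN mulrDl lerD//.
      apply: le_trans (cauchy_schwarz _ _) _.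
      by rewrite mulrAC ler_wpM2r ?hnorm_ge0.
    by rewrite mulrC; exact: cauchy_schwarz.
  by rewrite h ?subrr.
move=> h1 h2 hT hS h x y; apply: (key _ _ _ _ D1) => // {}x Dx.
rewrite [RHS]inner_conj [LHS]inner_conj; congr (_^*); apply/esym.
by apply: (key _ _ _ _ D2) => // z Dz; rewrite [LHS]inner_conj [RHS]inner_conj h.
Qed.

(** [P] is a type of formal sums with values [ka] in the source and [kb] in the target. No
    well-definedness has to be checked beforehand: the bound, applied to differences, makes [kb s]
    depend on [ka s] alone. *)
Lemma extension H1 H2 (P : Type) (ka : P -> H1) (kb : P -> H2) (C : R) :
  (forall c s t, exists u, ka u = c *: ka s + ka t /\ kb u = c *: kb s + kb t) ->
  (forall s, hnorm (kb s) <= C * hnorm (ka s)) ->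
  (forall x (e : R), 0 < e -> exists s, hnorm (x - ka s) < e) ->
  exists T, bounded_map T /\ forall s, T (ka s) = kb s.
Proof.
move=> comb bnd dense; pose B : R := `|C| + 1.
have B0 : 0 < B by rewrite ltr_wpDl.
have dist s t : hnorm (kb s - kb t) <= B * hnorm (ka s - ka t).
  have [u [ua ub]] := comb (-1) t s; move: ua ub.
  rewrite !scaleN1r ![- _ + _]addrC => <- <-; apply: le_trans (bnd u) _.
  by rewrite ler_wpM2r ?hnorm_ge0// /B; have := ler_norm C; lra.
(* The same limit serves every approximating sequence, so the map obtained by choice can later be
   tested on whichever sequence is convenient. *)
have lim x : exists y, forall p, cvg_seq (ka \o p) x -> cvg_seq (kb \o p) y.
  have /choice[s hs] := fun n => dense x _ (inv_nat_gt0 R n).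
  have sx : cvg_seq (ka \o s) x by apply: cvg_seq_inv => n; rewrite hnormBC /=.
  have [y hy] : exists y, cvg_seq (kb \o s) y.
    apply: cvg_seq_cauchy => e e0.
    have [N hN] := sx _ (divr_gt0 e0 (mulr_gt0 (ltr0Sn R 1) B0)).
    exists N => m n /hN hm /hN hn; apply: le_lt_trans (dist _ _) _.
    have := hnorm_tri (ka (s m)) x (ka (s n)); move: hm hn.
    rewrite !ltr_pdivlMr ?mulr_gt0//= (hnormBC (ka (s n)) x).
    move: (hnorm _) (hnorm _) (hnorm _) => a b c; nra.
  exists y => p px e e0.
  have e3 : 0 < e / 3 by lra.
  have [N1 h1] := hy _ e3; have [N2 h2] := sx _ (divr_gt0 e3 B0).
  have [N3 h3] := px _ (divr_gt0 e3 B0).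
  exists (maxn N1 (maxn N2 N3)) => n; rewrite !geq_max.
  move=> /andP[/h1 k1 /andP[/h2 k2 /h3 k3]].
  have := hnorm_tri (kb (p n)) (kb (s n)) y; have := dist (p n) (s n).
  have := hnorm_tri (ka (p n)) x (ka (s n)); move: k1 k2 k3.
  rewrite !ltr_pdivlMr//= (hnormBC (ka (s n)) x).
  move: (hnorm _) (hnorm _) (hnorm _) (hnorm _) (hnorm _) (hnorm _) => *; nra.
have /choice[T hT] := lim.
have app x : exists p, cvg_seq (ka \o p) x.
  have /choice[s hs] := fun n => dense x _ (inv_nat_gt0 R n).
  by exists s; apply: cvg_seq_inv => n; rewrite hnormBC /=.
exists T; split=> [|s].
  split=> [c x y|].
    have [p px] := app x; have [q qy] := app y.
    have /choice[r hr] := fun n => comb c (p n) (q n).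
    apply: (@cvg_seq_uniq _ _ (kb \o r)).
      apply: hT; have := cvg_seq_comb c px qy; congr cvg_seq.
      by apply/funext => n /=; case: (hr n) => ->.
    have := cvg_seq_comb c (hT _ _ px) (hT _ _ qy); congr cvg_seq.
    by apply/funext => n /=; case: (hr n) => _ ->.
  exists B => x; have [p px] := app x; apply/ler_addgt0Pl => e e0.
  have e2 : 0 < e / 2 by lra.
  have [N1 h1] := hT _ _ px _ e2; have [N2 h2] := px _ (divr_gt0 e2 B0).
  move: (h1 _ (leq_maxl N1 N2)) (h2 _ (leq_maxr N1 N2)); rewrite /=.
  move: (p _) => s; rewrite (ltr_pdivlMr _ _ B0) => k1 k2.
  have := hnorm_tri (T x) (kb s) 0; have := hnorm_tri (ka s) x 0.
  have := bnd s; have := ler_norm C; rewrite !subr0 (hnormBC (T x)).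
  move: k1 k2 (hnorm_ge0 x) (hnorm_ge0 (ka s - x)) (normr_ge0 C) (hnorm_ge0 (ka s)).
  rewrite /B; move: (hnorm (ka s - x)) (hnorm (ka s)) (hnorm (kb s)).
  move: (hnorm x) (hnorm (T x)) (hnorm _) (`|C|) => X Y k c a b d *.
  have : C * b <= c * b by rewrite ler_wpM2r.
  have : c * b <= c * (a + X) by rewrite ler_wpM2l.
  nra.
have ks : cvg_seq (ka \o (fun=> s)) (ka s).
  by move=> e e0; exists 0%N => n _ /=; rewrite subrr hnorm0.
apply: (cvg_seq_uniq (hT _ _ ks)) => e e0.
by exists 0%N => n _ /=; rewrite subrr hnorm0.
Qed.

End bounded_maps.

(** * Tracial algebras and maps of tensor squares *)

Section tracial_algebras.
Context (R : realType).

Lemma conj_real (x : R) : (x%:C%C)^* = x%:C%C.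
Proof. by apply/eqP; rewrite eq_complex /= oppr0 !eqxx. Qed.

Record tracial_algebra (H : hilbert R) (A : set (op H)) (tr : op H -> R[i]) : Prop :=
  TracialAlgebra {
  ta_usa : unital_star_algebra A;
  ta_lin : forall c S T, A S -> A T -> tr (c *: S + T) = c * tr S + tr T;
  ta_pos : forall T, A T -> op_pos T -> 0 <= tr T;
  ta_comm : forall S T, A S -> A T -> tr (S \o T) = tr (T \o S);
  ta_id : tr idfun = 1 }.

Definition psd_form (H : hilbert R) (A : set (op H)) (f : op H -> op H -> R[i]) :=
  [/\ forall c a b w, A a -> A b -> A w -> f (c *: a + b) w = c * f a w + f b w,
      forall a b, A a -> A b -> f b a = (f a b)^* &
      forall a, A a -> 0 <= f a a].

Section algebra.
Context (H : hilbert R) (A : set (op H)).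
Hypothesis hA : unital_star_algebra A.

Lemma A_adj T : A T -> A (adj T).
Proof. by move=> /(Defs.adjP hA)[]. Qed.
Lemma adj_is T : A T -> is_adjoint T (adj T).
Proof. by move=> /(Defs.adjP hA)[]. Qed.
Lemma A_id : A idfun. Proof. exact: usa_id hA. Qed.
Lemma A_o S T : A S -> A T -> A (S \o T). Proof. exact: usa_comp hA S T. Qed.
Lemma A_comb c S T : A S -> A T -> A (c *: S + T).
Proof. exact: usa_comb hA c S T. Qed.
Lemma A_0 : A 0. Proof. exact: Defs.A_0 hA. Qed.
Lemma A_Z c S : A S -> A (c *: S). Proof. exact: Defs.A_Z hA c S. Qed.
Lemma A_D S T : A S -> A T -> A (S + T). Proof. exact: Defs.A_D hA S T. Qed.
Lemma A_B S T : A S -> A T -> A (S - T).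
Proof. by move=> AS AT; rewrite -scaleN1r; apply: A_D => //; exact: A_Z. Qed.
Lemma A_bm T : A T -> bounded_map T.
Proof. exact: usa_bounded hA T. Qed.
Lemma comp_comb U c S T : A U ->
  (U \o (c *: S + T) : op H) = c *: (U \o S : op H) + (U \o T : op H).
Proof. by move=> AU; apply/funext => x; exact: (bmP (A_bm AU)). Qed.
Lemma adjK T : A T -> adj (adj T) = T.
Proof. exact: Defs.adjK hA T. Qed.
Lemma adj_o S T : A S -> A T -> adj (S \o T) = adj T \o adj S.
Proof. exact: Defs.adj_comp hA S T. Qed.
Lemma adj_eq T S : A T -> is_adjoint T S -> adj T = S.
Proof. exact: Defs.adj_uniq hA T S. Qed.
Lemma adj_id : adj (idfun : op H) = idfun.
Proof. by apply: adj_eq => //; exact: A_id. Qed.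
Lemma adj_comb c S T : A S -> A T -> adj (c *: S + T) = c^* *: adj S + adj T.
Proof.
move=> AS AT; apply: adj_eq; first exact: A_comb.
move=> x y; rewrite [(c *: S + T) x]/(c *: S x + T x).
rewrite [(_ + adj T) y]/(c^* *: adj S y + adj T y).
by rewrite innerDl innerDr innerZl innerZr conjCK (adj_is AS) (adj_is AT).
Qed.

(** Schur's product theorem for the Gram matrices of the two legs along [s]. *)
Lemma psd_prod f1 f2 (s : seq (op H * op H)) : psd_form A f1 -> psd_form A f2 ->
  (forall p, p \in s -> A p.1 /\ A p.2) ->
  0 <= \sum_(p <- s) \sum_(q <- s) f1 p.1 q.1 * f2 p.2 q.2.
Proof.
move=> [l1 h1 p1] [l2 h2 p2] sA.
pose al := \matrix_(i < size s, j < size s)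
  f1 (tnth (in_tuple s) i).1 (tnth (in_tuple s) j).1.
pose be := \matrix_(i < size s, j < size s)
  f2 (tnth (in_tuple s) i).2 (tnth (in_tuple s) j).2.
have -> : \sum_(p <- s) \sum_(q <- s) f1 p.1 q.1 * f2 p.2 q.2 =
    \sum_i \sum_j al i j * be i j.
  rewrite big_tnth; apply: eq_bigr => i _; rewrite big_tnth.
  by apply: eq_bigr => j _; rewrite !mxE.
have sA1 i : A (tnth (in_tuple s) i).1 by case: (sA _ (mem_tnth i (in_tuple s))).
have sA2 i : A (tnth (in_tuple s) i).2 by case: (sA _ (mem_tnth i (in_tuple s))).
apply: schur_psd => [i j|x|x]; first by rewrite !mxE h1.
  under eq_bigr do under eq_bigr do rewrite mxE.
  exact: (Defs.gram_psd hA (f := f1) (a := fun i => (tnth (in_tuple s) i).1)).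
under eq_bigr do under eq_bigr do rewrite mxE.
exact: (Defs.gram_psd hA (f := f2) (a := fun i => (tnth (in_tuple s) i).2)).
Qed.

Lemma psd_diff f1 f2 (C : R) : psd_form A f1 -> psd_form A f2 ->
  (forall a, A a -> f2 a a <= C%:C%C * f1 a a) ->
  psd_form A (fun a b => C%:C%C * f1 a b - f2 a b).
Proof.
move=> [l1 h1 p1] [l2 h2 p2] le12; split=> [c a b w Aa Ab Aw|a b Aa Ab|a Aa].
- rewrite l1// l2//; ring.
- by rewrite h1// h2// rmorphB rmorphM /= conj_real.
- by rewrite subr_ge0 le12.
Qed.

Lemma psd_scale f (C : R) : 0 <= C -> psd_form A f ->
  psd_form A (fun a b => C%:C%C * f a b).
Proof.
move=> C0 [l1 h1 p1]; split=> [c a b w Aa Ab Aw|a b Aa Ab|a Aa].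
- rewrite l1//; ring.
- by rewrite h1// rmorphM /= conj_real.
- by rewrite mulr_ge0 ?p1// lecE /= eqxx.
Qed.

End algebra.

Lemma psd_pull (H H' : hilbert R) (A : set (op H)) (A' : set (op H')) f (phi : op H -> op H') :
  (forall a, A a -> A' (phi a)) ->
  (forall c a b, A a -> A b -> phi (c *: a + b) = c *: phi a + phi b) ->
  psd_form A' f -> psd_form A (fun a b => f (phi a) (phi b)).
Proof.
move=> pA pl [l1 h1 p1]; split=> [c a b w Aa Ab Aw|a b Aa Ab|a Aa].
- by rewrite pl// l1//; exact: pA.
- by rewrite h1//; exact: pA.
- by apply: p1; exact: pA.
Qed.

Section traces.
Context (H : hilbert R) (A : set (op H)) (tr : op H -> R[i]).
Hypothesis hA : tracial_algebra A tr.
Let hU := ta_usa hA.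

Lemma trD S T : A S -> A T -> tr (S + T) = tr S + tr T.
Proof. by move=> AS AT; rewrite -{1}[S]scale1r (ta_lin hA)// mul1r. Qed.
Lemma tr_0 : tr 0 = 0.
Proof. by apply: (addrI (tr 0)); rewrite -trD ?addr0//; exact: A_0. Qed.
Lemma trZ c S : A S -> tr (c *: S) = c * tr S.
Proof. by move=> AS; rewrite -[c *: S]addr0 (ta_lin hA)// ?tr_0 ?addr0//; exact: A_0. Qed.
Lemma tr_sq_ge0 a : A a -> 0 <= tr (adj a \o a).
Proof. exact: Defs.g_ge0 hU (ta_pos hA) a. Qed.

Lemma psd_g : psd_form A (fun a c => tr (adj c \o a)).
Proof.
split.
- move=> c a b w; exact: (Defs.g_lin hU (ta_lin hA)).
- move=> a b; exact: (Defs.gH hU (ta_lin hA) (ta_pos hA)).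
- exact: tr_sq_ge0.
Qed.

Lemma psd_h : psd_form A (fun b d => tr (b \o adj d)).
Proof.
split.
- move=> c a b w; exact: (Defs.h_lin hU (ta_lin hA)).
- move=> a b; exact: (Defs.hH hU (ta_lin hA) (ta_pos hA)).
- move=> a; exact: (Defs.h_ge0 hU (ta_pos hA)).
Qed.

(** If [c] bounds the operator norm of x, then c^2 z^* z - (x z)^* (x z) is a positive operator, and
    the trace preserves this. *)
Lemma tr_bound_l x : A x -> exists2 C : R, 0 <= C & forall z, A z ->
  tr (adj (x \o z) \o (x \o z)) <= C%:C%C * tr (adj z \o z).
Proof.
move=> Ax; have [c c0 hc] := bm_bound (A_bm hU Ax).
exists (c ^+ 2) => [|z Az]; first exact: sqr_ge0.
have Axz : A (x \o z : op H) by exact: A_o.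
have A1 : A (adj z \o z : op H) by apply: A_o => //; exact: A_adj.
have A2 : A (adj (x \o z) \o (x \o z) : op H) by apply: A_o => //; exact: A_adj.
have A3 : A ((-1) *: (adj (x \o z) \o (x \o z) : op H)) by exact: A_Z.
have A4 : A ((c ^+ 2)%:C%C *: (adj z \o z : op H)) by exact: A_Z.
rewrite -subr_ge0 -trZ// addrC -mulN1r -(ta_lin hA)// scaleN1r addrC.
apply: (ta_pos hA); first by apply: A_B => //; exact: A_Z.
move=> v; rewrite -[(_ - _) v]/((c ^+ 2)%:C%C *: adj z (z v) - adj (x \o z) (x (z v))).
rewrite innerBl innerZl.
have h T : A T -> '[adj T (T v), v] = '[T v, T v].
  by move=> AT; rewrite inner_conj -(adj_is hU AT) -inner_conj.
rewrite (h z)// [X in _ - X](h (x \o z : op H))// subr_ge0 /= !inner_hnorm.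
rewrite -rmorphM lecR -exprMn ler_sqr ?nnegrE ?mulr_ge0 ?hnorm_ge0//; exact: ltW.
Qed.

(** Adjoints turn right multiplication by x into left multiplication by x^*. *)
Lemma tr_bound_r x : A x -> exists2 C : R, 0 <= C & forall z, A z ->
  tr ((z \o x) \o adj (z \o x)) <= C%:C%C * tr (z \o adj z).
Proof.
move=> Ax; have [C C0 hC] := tr_bound_l (A_adj hU Ax); exists C => // z Az.
have := hC _ (A_adj hU Az).
rewrite -(adj_o hU Az Ax) (adjK hU Az) (adjK hU)//; exact: A_o.
Qed.

End traces.

Section tensor_models.
Context (H : hilbert R) (A : set (op H)) (tr : op H -> R[i]).
Hypothesis hA : tracial_algebra A tr.
Let hU := ta_usa hA.
Variable K : tensor_model H.
Hypothesis hK : is_L2_tensor A tr K.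

Definition elementary : set (tm_space K) :=
  [set x | exists a b, [/\ A a, A b & x = tm_tens K a b]].

Lemma elementaryI a b : A a -> A b -> elementary (tm_tens K a b).
Proof. by exists a, b. Qed.

Lemma inner_tens a b c d : A a -> A b -> A c -> A d ->
  '[tm_tens K a b, tm_tens K c d] = tr (adj c \o a) * tr (b \o adj d).
Proof. exact: hK.1. Qed.

Lemma spans_elementary : spans elementary.
Proof.
move=> x e e0; have [s sA hs] := hK.2 x e e0.
exists [seq tm_tens K p.1 p.2 | p <- s]; last by rewrite big_map.
by move=> y /mapP[p /sA[h1 h2] ->]; exact: elementaryI.
Qed.

Lemma tens_orth x : (forall a b, A a -> A b -> '[x, tm_tens K a b] = 0) -> x = 0.
Proof.
by move=> h; apply: (spans_orth spans_elementary) => _ [a [b [Aa Ab ->]]]; exact: h.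
Qed.

(** Bilinearity is not part of [is_L2_tensor]. It follows because a vector is determined by its
    inner products with elementary tensors, and those are linear in each leg. *)
Lemma tens_combl c a a' b : A a -> A a' -> A b ->
  tm_tens K (c *: a + a') b = c *: tm_tens K a b + tm_tens K a' b.
Proof.
move=> Aa Aa' Ab; apply/subr0_eq/tens_orth => u v Au Av.
rewrite innerBl innerDl innerZl !inner_tens//; last exact: A_comb.
have [l _ _] := psd_g hA; rewrite l//; ring.
Qed.

Lemma tens_combr c a b b' : A a -> A b -> A b' ->
  tm_tens K a (c *: b + b') = c *: tm_tens K a b + tm_tens K a b'.
Proof.
move=> Aa Ab Ab'; apply/subr0_eq/tens_orth => u v Au Av.
rewrite innerBl innerDl innerZl !inner_tens//; last exact: A_comb.
have [l _ _] := psd_h hA; rewrite l//; ring.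
Qed.

Lemma tens0l b : A b -> tm_tens K 0 b = 0.
Proof.
move=> Ab; have A0 := A_0 hU; apply: (addrI (tm_tens K 0 b)).
by rewrite -{1}[tm_tens K 0 b]scale1r -tens_combl// scaler0 !addr0.
Qed.

Lemma tens_ext (H' : hilbert R) (S T : tm_space K -> H') :
  bounded_map S -> bounded_map T ->
  (forall a b, A a -> A b -> S (tm_tens K a b) = T (tm_tens K a b)) ->
  forall x, S x = T x.
Proof.
move=> hS hT h; apply: (spans_ext spans_elementary) => // _ [a [b [Aa Ab ->]]].
exact: h.
Qed.

End tensor_models.

Lemma tens_adjoint (H H' : hilbert R) (A : set (op H)) (A' : set (op H'))
    tr tr' (K : tensor_model H) (K' : tensor_model H')
    (hK : is_L2_tensor A tr K) (hK' : is_L2_tensor A' tr' K')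
    (T : tm_space K -> tm_space K') S :
  bounded_map T -> bounded_map S ->
  (forall a b c d, A a -> A b -> A' c -> A' d ->
     '[T (tm_tens K a b), tm_tens K' c d] = '[tm_tens K a b, S (tm_tens K' c d)]) ->
  adjoint_maps T S.
Proof.
move=> hT hS h; apply: (spans_adjoint (spans_elementary hK) (spans_elementary hK')) => //.
by move=> _ _ [a [b [Aa Ab ->]]] [c [d [Ac Ad ->]]]; exact: h.
Qed.

(* For the Gram forms [g], [h] of the first and second legs,
   [C C' g h - g' h' = (C g - g') (C' h) + g' (C' h - h')], and each summand is
   positive by Schur's product theorem. *)
Lemma tens_map (H H' : hilbert R) (A : set (op H)) (A' : set (op H'))
    tr tr' (hA : tracial_algebra A tr) (hA' : tracial_algebra A' tr')
    (K : tensor_model H) (K' : tensor_model H')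
    (hK : is_L2_tensor A tr K) (hK' : is_L2_tensor A' tr' K')
    (f g : op H -> op H') (C C' : R) :
  0 <= C -> 0 <= C' ->
  (forall a, A a -> A' (f a)) -> (forall a, A a -> A' (g a)) ->
  (forall c a b, A a -> A b -> f (c *: a + b) = c *: f a + f b) ->
  (forall c a b, A a -> A b -> g (c *: a + b) = c *: g a + g b) ->
  (forall a, A a -> tr' (adj (f a) \o f a) <= C%:C%C * tr (adj a \o a)) ->
  (forall a, A a -> tr' (g a \o adj (g a)) <= C'%:C%C * tr (a \o adj a)) ->
  exists T : tm_space K -> tm_space K', bounded_map T /\
    forall a b, A a -> A b -> T (tm_tens K a b) = tm_tens K' (f a) (g b).
Proof.
move=> C0 C'0 fA gA fl gl fC gC; have hU := ta_usa hA.
pose P := {s : seq (op H * op H) | forall p, p \in s -> A p.1 /\ A p.2}.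
pose ka (s : P) := \sum_(p <- sval s) tm_tens K p.1 p.2.
pose kb (s : P) := \sum_(p <- sval s) tm_tens K' (f p.1) (g p.2).
have [T [hT TE]] : exists T, bounded_map T /\ forall s, T (ka s) = kb s.
  apply: (@extension _ _ _ _ ka kb (Num.sqrt (C * C'))).
  - move=> c [s hs] [t ht].
    have hu p : p \in [seq (c *: p.1 : op H, p.2) | p <- s] ++ t -> A p.1 /\ A p.2.
      rewrite mem_cat => /orP[/mapP[q /hs[q1 q2] ->]|/ht//].
      by split=> //; exact: A_Z.
    exists (exist _ _ hu); rewrite /ka /kb /= !big_cat !big_map /= !scaler_sumr.
    split; congr (_ + _); rewrite [LHS]big_seq [RHS]big_seq; apply: eq_bigr => p /hs[p1 p2].
      by rewrite -[c *: p.1]addr0 (tens_combl hA hK)// ?(tens0l hA hK) ?addr0//; exact: A_0.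
    have A'0 : A' (f 0) by apply: fA; exact: A_0.
    have f0 : f 0 = 0.
      have A0 := A_0 hU; apply: (addrI (f 0)).
      by rewrite -{1}[f 0]scale1r -fl// scaler0 !addr0.
    rewrite -[c *: p.1]addr0 fl ?f0//; last exact: A_0.
    by rewrite (tens_combl hA' hK') ?(tens0l hA' hK') ?addr0//; [exact: gA|exact: fA| |exact: gA];
       rewrite -f0.
  - move=> [s hs]; rewrite /ka /kb /=.
    rewrite -ler_sqr ?nnegrE ?mulr_ge0 ?sqrtr_ge0 ?hnorm_ge0//.
    rewrite exprMn (sqr_sqrtr (mulr_ge0 C0 C'0)) -subr_ge0.
    set G := fun a c => tr (adj c \o a); set L := fun b d => tr (b \o adj d).
    set G' := fun a c => tr' (adj (f c) \o f a); set L' := fun b d => tr' (g b \o adj (g d)).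
    have pG : psd_form A G by exact: psd_g.
    have pL : psd_form A L by exact: psd_h.
    have pG' : psd_form A G' by exact: psd_pull (psd_g hA').
    have pL' : psd_form A L' by exact: psd_pull (psd_h hA').
    have e1 : '[\sum_(p <- s) tm_tens K p.1 p.2, \sum_(p <- s) tm_tens K p.1 p.2] =
        \sum_(p <- s) \sum_(q <- s) G p.1 q.1 * L p.2 q.2.
      rewrite inner_suml [LHS]big_seq [RHS]big_seq; apply: eq_bigr => p /hs[p1 p2].
      rewrite inner_sumr [LHS]big_seq [RHS]big_seq; apply: eq_bigr => q /hs[q1 q2].
      exact: (inner_tens hK).
    have e2 : '[\sum_(p <- s) tm_tens K' (f p.1) (g p.2),
                \sum_(p <- s) tm_tens K' (f p.1) (g p.2)] =
        \sum_(p <- s) \sum_(q <- s) G' p.1 q.1 * L' p.2 q.2.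
      rewrite inner_suml [LHS]big_seq [RHS]big_seq; apply: eq_bigr => p /hs[p1 p2].
      rewrite inner_sumr [LHS]big_seq [RHS]big_seq; apply: eq_bigr => q /hs[q1 q2].
      by apply: (inner_tens hK'); by [apply: fA|apply: gA].
    have h1 := psd_prod hU (psd_diff pG pG' fC) (psd_scale C'0 pL) hs.
    have h2 := psd_prod hU pG' (psd_diff pL pL' gC) hs.
    have := addr_ge0 h1 h2; rewrite -big_split /=.
    under eq_bigr do rewrite -big_split /=.
    have -> : \sum_(p <- s) \sum_(q <- s)
      ((C%:C%C * G p.1 q.1 - G' p.1 q.1) * (C'%:C%C * L p.2 q.2) +
        G' p.1 q.1 * (C'%:C%C * L p.2 q.2 - L' p.2 q.2)) =
      (C * C')%:C%C * '[\sum_(p <- s) tm_tens K p.1 p.2, \sum_(p <- s) tm_tens K p.1 p.2]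
      - '[\sum_(p <- s) tm_tens K' (f p.1) (g p.2), \sum_(p <- s) tm_tens K' (f p.1) (g p.2)].
      rewrite e1 e2 mulr_sumr -sumrB; apply: eq_bigr => p _.
      rewrite mulr_sumr -sumrB; apply: eq_bigr => q _; rewrite rmorphM; ring.
    move=> /complexRe_ge0; rewrite !inner_hnorm -rmorphM -rmorphB /=; exact.
  - move=> x e e0; have [s sA hs] := hK.2 x e e0; by exists (exist _ s sA).
exists T; split=> // a b Aa Ab.
have hs p : p \in [:: (a, b)] -> A p.1 /\ A p.2 by rewrite inE => /eqP ->.
by have := TE (exist _ _ hs); rewrite /ka /kb /= !big_seq1.
Qed.

End tracial_algebras.

(** * Finite Hilbert sums *)

Section hsum_theory.
Context (R : realType) (I : finType) (H : I -> hilbert R).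
Implicit Types (x y : hilbert_sum H).

Lemma inner_hsum x y : '[x, y] = \sum_i '[x i, y i].
Proof. by []. Qed.

Lemma hnorm_comp x i : hnorm (x i) <= hnorm x.
Proof.
rewrite -ler_sqr ?nnegrE ?hnorm_ge0// !hnorm_sqr inner_hsum complexRe_sum (bigD1 i)//=.
by rewrite lerDl sumr_ge0// => j _; exact/complexRe_ge0/inner_ge0.
Qed.

Lemma hsum_injE i (z : H i) : hsum_inj z i = z.
Proof. exact: dfwithin. Qed.

Lemma hsum_inj_neq i j (z : H i) : i != j -> hsum_inj z j = 0.
Proof. exact: dfwithout. Qed.

Lemma hsum_inj_comb i c (z z' : H i) :
  hsum_inj (c *: z + z') = c *: hsum_inj z + hsum_inj z'.
Proof.
apply: functional_extensionality_dep => j.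
rewrite -[RHS]/(c *: hsum_inj z j + hsum_inj z' j).
have [<-|ij] := eqVneq i j; first by rewrite !hsum_injE.
by rewrite !hsum_inj_neq// scaler0 addr0.
Qed.

Lemma inner_hsum_inj i (z : H i) y : '[hsum_inj z, y] = '[z, y i].
Proof.
rewrite inner_hsum (bigD1 i)//= hsum_injE big1 ?addr0// => j ji.
by rewrite hsum_inj_neq ?inner0l// eq_sym.
Qed.

Lemma hnorm_hsum_inj i (z : H i) : hnorm (hsum_inj z) = hnorm z.
Proof.
apply/(@pexpIrn _ 2) => //; rewrite ?nnegrE ?hnorm_ge0//.
by rewrite !hnorm_sqr inner_hsum_inj hsum_injE.
Qed.

Lemma hsum_decomp x : x = \sum_i hsum_inj (x i).
Proof.
apply: inner_ext => y; rewrite inner_suml inner_hsum.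
by apply: eq_bigr => i _; rewrite inner_hsum_inj.
Qed.

Lemma hnorm_hsum x : hnorm x <= \sum_i hnorm (x i).
Proof.
rewrite {1}[x]hsum_decomp; apply: le_trans (hnorm_sum _ _ _) _.
by apply: ler_sum => i _; rewrite hnorm_hsum_inj.
Qed.

Lemma bm_comp_proj i : bounded_map (fun x : hilbert_sum H => x i).
Proof. by split=> //; exists 1 => x; rewrite mul1r hnorm_comp. Qed.

Lemma bm_hsum_inj i : bounded_map (fun z : H i => hsum_inj z).
Proof.
by split=> [|]; [exact: hsum_inj_comb|exists 1 => z; rewrite mul1r hnorm_hsum_inj].
Qed.

End hsum_theory.

(** If [w] is the projection of a limit point v, then ||v - w||^2 = <v - w, v - u> for every u in W,
    so ||v - w|| <= ||v - u||, which can be made arbitrarily small. An explicit projection thus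
    replaces a limit argument. *)
Lemma closed_complemented (R : realType) (H : hilbert R) (W : set H) : W 0 ->
  (forall c x y, W x -> W y -> W (c *: x + y)) ->
  (forall v, exists2 w, W w & forall u, W u -> '[v - w, u] = 0) ->
  closed_subspace W.
Proof.
move=> W0 WD pW; split=> // v hv; have [w Ww hw] := pW v.
suff /subr0_eq -> : v - w = 0 by [].
apply: hnorm_small => r r0; have [u Wu hu] := hv r r0; apply: le_trans (ltW hu).
have [->|n0] := eqVneq (hnorm (v - w)) 0; first exact: hnorm_ge0.
have np : 0 < hnorm (v - w) by rewrite lt_neqAle eq_sym n0 hnorm_ge0.
rewrite -(ler_pM2l np) -expr2 hnorm_sqr.
have -> : '[v - w, v - w] = '[v - w, v - u].
  have Wd : W (w - u) by rewrite addrC -scaleN1r; exact: WD.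
  by rewrite -[RHS]subr0 -(hw _ Wd) -innerBr opprB addrA subrK.
by apply: le_trans (cauchy_schwarz _ _); apply: le_trans (normc_Re _); exact: ler_norm.
Qed.

Section orthogonal_projection.
Context (R : realType) (K : hilbert R) (I : finType).
Local Notation KI := (hilbert_sum (fun _ : I => K)).
Context (W : set KI) (hW : closed_subspace W).

Lemma orth_projP v : W (orth_proj W v) /\ forall u, W u -> '[v - orth_proj W v, u] = 0.
Proof.
exact: (@xgetPex _ 0 [set w | W w /\ forall u, W u -> '[v - w, u] = 0])
  (projection_exists hW v).
Qed.

Lemma orth_proj_uniq v w : W w -> (forall u, W u -> '[v - w, u] = 0) ->
  orth_proj W v = w.
Proof.
move=> Ww hw; have [Wp hp] := orth_projP v; set p := orth_proj W v in Wp hp *.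
have Wd : W (p - w) by exact: subspaceB.
have dE : p - w = (v - w) - (v - p).
  by rewrite opprB [RHS]addrC addrA subrK.
by apply/subr0_eq/inner_eq0; rewrite {1}dE innerBl hw// hp// subrr.
Qed.

Lemma orth_proj_id w : W w -> orth_proj W w = w.
Proof. by move=> Ww; apply: orth_proj_uniq => // u _; rewrite subrr inner0l. Qed.

Lemma bm_orth_proj : bounded_map (orth_proj W).
Proof.
split=> [c x y|].
  have [Wx hx] := orth_projP x; have [Wy hy] := orth_projP y.
  apply: orth_proj_uniq => [|u Wu]; first by case: hW => _ h _; exact: h.
  rewrite opprD addrACA -scalerBr innerDl innerZl hx// hy//; ring.
exists 1 => x; rewrite mul1r; have [Wx hx] := orth_projP x.
rewrite -ler_sqr ?nnegrE ?hnorm_ge0// !hnorm_sqr.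
have pythagoras (q p : KI) : '[q, p] = 0 -> '[q + p, q + p] = '[q, q] + '[p, p].
  move=> qp; rewrite innerDl !innerDr (inner_conj p q) qp conjC0; ring.
have := pythagoras _ _ (hx _ Wx); rewrite subrK => ->.
by rewrite [leRHS]raddfD lerDr; apply: complexRe_ge0; exact: inner_ge0.
Qed.

End orthogonal_projection.

(** * Right modules and von Neumann dimension *)

Section modules.
Context (R : realType) (H : hilbert R) (A : set (op H)) (tr : op H -> R[i]).
Hypothesis hA : tracial_algebra A tr.
Let hU := ta_usa hA.
Local Notation L2 := (tm_space (L2_tensor A tr)).
Local Notation "a (x) b" := (tm_tens (L2_tensor A tr) a b)
  (at level 40, left associativity).
Local Notation e := ((idfun : op H) (x) (idfun : op H)).
Local Notation lmul := (tens_mul (A := A) (tr := tr)).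

Lemma L2P : is_L2_tensor A tr (L2_tensor A tr).
Proof. exact: L2_tensorP hU (ta_lin hA) (ta_pos hA). Qed.

(** The [xget] in [tens_mul] does find a map: multiplication is bounded on each leg, by [tr_bound_l]
    on the first and [tr_bound_r] on the second. *)
Lemma lmulP x y : A x -> A y -> bounded_map (lmul x y) /\
  forall a b, A a -> A b -> lmul x y (a (x) b) = (x \o a) (x) (b \o y).
Proof.
move=> Ax Ay; have [C C0 hC] := tr_bound_l hA Ax; have [C' C'0 hC'] := tr_bound_r hA Ay.
apply: (@xgetPex _ 0 [set T : op L2 | bounded_operator T /\
    forall a b, A a -> A b -> T (a (x) b) = (x \o a) (x) (b \o y)]).
apply: (tens_map hA hA L2P L2P (f := fun a => x \o a) (g := fun b => b \o y) C0 C'0) => //.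
- by move=> a Aa; exact: A_o.
- by move=> a Aa; exact: A_o.
- by move=> c a b Aa Ab; exact: (comp_comb hU).
Qed.

(* Right multiplication by x (x) y^o; these maps generate the right action of
   (A (x) A^o)''.  By [rmulP] the default is never used. *)
Definition rmul (x y : op H) : L2 -> L2 :=
  xget (fun=> 0) [set T | bounded_map T /\
    forall a b, A a -> A b -> T (a (x) b) = (a \o x) (x) (y \o b)].

Lemma tr_sqC a : A a -> tr (adj a \o a) = tr (a \o adj a).
Proof. by move=> Aa; rewrite (ta_comm hA)//; exact: A_adj. Qed.

(** Here [x] and [y] act on the sides opposite to those of [lmul]. The trace property ([tr_sqC])
    exchanges a^* a and a a^*, after which the same two bounds apply with their roles swapped. *)
Lemma rmulP x y : A x -> A y -> bounded_map (rmul x y) /\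
  forall a b, A a -> A b -> rmul x y (a (x) b) = (a \o x) (x) (y \o b).
Proof.
move=> Ax Ay; have [C C0 hC] := tr_bound_r hA Ax; have [C' C'0 hC'] := tr_bound_l hA Ay.
apply: (@xgetPex _ (fun=> 0) [set T | bounded_map T /\
    forall a b, A a -> A b -> T (a (x) b) = (a \o x) (x) (y \o b)]).
apply: (tens_map hA hA L2P L2P (f := fun a => a \o x) (g := fun b => y \o b) C0 C'0) => //.
- by move=> a Aa; exact: A_o.
- by move=> a Aa; exact: A_o.
- by move=> c a b Aa Ab; exact: (comp_comb hU).
- by move=> a Aa; rewrite !tr_sqC ?hC//; exact: A_o.
- by move=> a Aa; rewrite -!tr_sqC ?hC'//; exact: A_o.
Qed.

Lemma bm_lmul x y : A x -> A y -> bounded_map (lmul x y).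
Proof. by move=> Ax Ay; case: (lmulP Ax Ay). Qed.
Lemma lmulE x y a b : A x -> A y -> A a -> A b ->
  lmul x y (a (x) b) = (x \o a) (x) (b \o y).
Proof. by move=> Ax Ay; case: (lmulP Ax Ay) => _; apply. Qed.
Lemma bm_rmul x y : A x -> A y -> bounded_map (rmul x y).
Proof. by move=> Ax Ay; case: (rmulP Ax Ay). Qed.
Lemma rmulE x y a b : A x -> A y -> A a -> A b ->
  rmul x y (a (x) b) = (a \o x) (x) (y \o b).
Proof. by move=> Ax Ay; case: (rmulP Ax Ay) => _; apply. Qed.

Lemma lmul_adj x y : A x -> A y -> adjoint_maps (lmul x y) (lmul (adj x) (adj y)).
Proof.
move=> Ax Ay; have Ax' := A_adj hU Ax; have Ay' := A_adj hU Ay.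
apply: (tens_adjoint L2P L2P); [exact: bm_lmul|exact: bm_lmul|].
move=> a b c d Aa Ab Ac Ad; have Axa := A_o hU Ax Aa; have Aby := A_o hU Ab Ay.
have Axc := A_o hU Ax' Ac; have Ady := A_o hU Ad Ay'.
rewrite !lmulE// !(inner_tens L2P)//.
by rewrite (adj_o hU Ax' Ac) (adj_o hU Ad Ay') !(adjK hU).
Qed.

(** In contrast with [lmul_adj], this rests on the trace property, which carries x across c^* a and
    y across b d^*. *)
Lemma rmul_adj x y : A x -> A y -> adjoint_maps (rmul x y) (rmul (adj x) (adj y)).
Proof.
move=> Ax Ay; have Ax' := A_adj hU Ax; have Ay' := A_adj hU Ay.
apply: (tens_adjoint L2P L2P); [exact: bm_rmul|exact: bm_rmul|].
move=> a b c d Aa Ab Ac Ad; have Ac' := A_adj hU Ac; have Ad' := A_adj hU Ad.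
have Aax := A_o hU Aa Ax; have Ayb := A_o hU Ay Ab.
have Acx := A_o hU Ac Ax'; have Ayd := A_o hU Ay' Ad.
have Aca := A_o hU Ac' Aa; have Abd := A_o hU Ab Ad'.
rewrite !rmulE// !(inner_tens L2P)//.
rewrite (adj_o hU Ac Ax') (adj_o hU Ay' Ad) !(adjK hU)//.
congr (_ * _).
  by rewrite -[LHS]/(tr ((adj c \o a) \o x)) (ta_comm hA Aca Ax).
by rewrite -[LHS]/(tr (y \o (b \o adj d))) (ta_comm hA Ay Abd).
Qed.

Lemma lmul_rmul x y u v z : A x -> A y -> A u -> A v ->
  lmul x y (rmul u v z) = rmul u v (lmul x y z).
Proof.
move=> Ax Ay Au Av; move: z; apply: (tens_ext L2P).
- by apply: bm_comp; [exact: bm_lmul|exact: bm_rmul].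
- by apply: bm_comp; [exact: bm_rmul|exact: bm_lmul].
- by move=> a b Aa Ab; rewrite !(lmulE, rmulE)//; exact: A_o.
Qed.

Lemma lmul_comp x y u v z : A x -> A y -> A u -> A v ->
  lmul x y (lmul u v z) = lmul (x \o u) (v \o y) z.
Proof.
move=> Ax Ay Au Av; move: z; apply: (tens_ext L2P).
- by apply: bm_comp; exact: bm_lmul.
- by apply: bm_lmul; exact: A_o.
- by move=> a b Aa Ab; rewrite !lmulE//; exact: A_o.
Qed.

Lemma lmul_compl x u z : A x -> A u ->
  lmul x idfun (lmul u idfun z) = lmul (x \o u) idfun z.
Proof. by move=> Ax Au; have A1 := A_id hU; exact: lmul_comp. Qed.
Lemma lmul_compr y v z : A y -> A v ->
  lmul idfun y (lmul idfun v z) = lmul idfun (v \o y) z.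
Proof. by move=> Ay Av; have A1 := A_id hU; exact: lmul_comp. Qed.
Lemma lmul_lr x y z : A x -> A y -> lmul x idfun (lmul idfun y z) = lmul x y z.
Proof. by move=> Ax Ay; have A1 := A_id hU; exact: lmul_comp. Qed.
Lemma lmul_rl x y z : A x -> A y -> lmul idfun y (lmul x idfun z) = lmul x y z.
Proof. by move=> Ax Ay; have A1 := A_id hU; exact: lmul_comp. Qed.

Lemma lmul_id z : lmul idfun idfun z = z.
Proof.
have A1 := A_id hU; move: z; apply: (tens_ext L2P); first exact: bm_lmul.
  exact: bm_id.
by move=> a b Aa Ab; rewrite lmulE.
Qed.

Lemma lmul_combl c x x' y z : A x -> A x' -> A y ->
  lmul (c *: x + x') y z = c *: lmul x y z + lmul x' y z.
Proof.
move=> Ax Ax' Ay; have Acx : A (c *: x + x') by exact: A_comb.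
move: z; apply: (tens_ext L2P); first exact: bm_lmul.
  by apply: bm_comb; exact: bm_lmul.
move=> a b Aa Ab; rewrite !lmulE//.
by rewrite -[(_ + _) \o a]/(c *: (x \o a : op H) + (x' \o a)) (tens_combl hA L2P)//; exact: A_o.
Qed.

Lemma lmul_combr c x y y' z : A x -> A y -> A y' ->
  lmul x (c *: y + y') z = c *: lmul x y z + lmul x y' z.
Proof.
move=> Ax Ay Ay'; have Acx : A (c *: y + y') by exact: A_comb.
move: z; apply: (tens_ext L2P); first exact: bm_lmul.
  by apply: bm_comb; exact: bm_lmul.
move=> a b Aa Ab; rewrite !lmulE//.
by rewrite (comp_comb hU)// (tens_combr hA L2P)//; exact: A_o.
Qed.

Lemma lmul0l y z : A y -> lmul 0 y z = 0.
Proof.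
move=> Ay; have A0 := A_0 hU; apply: (addrI (lmul 0 y z)).
by rewrite -{1}[lmul 0 y z]scale1r -lmul_combl// scaler0 !addr0.
Qed.

Lemma lmul0r x z : A x -> lmul x 0 z = 0.
Proof.
move=> Ax; have A0 := A_0 hU; apply: (addrI (lmul x 0 z)).
by rewrite -{1}[lmul x 0 z]scale1r -lmul_combr// scaler0 !addr0.
Qed.

Lemma lmul_suml (I : finType) (x : I -> op H) y z : (forall i, A (x i)) -> A y ->
  lmul (\sum_i x i) y z = \sum_i lmul (x i) y z.
Proof.
move=> Ax Ay; suff [] : A (\sum_i x i) /\ lmul (\sum_i x i) y z = \sum_i lmul (x i) y z by [].
apply: (big_rec2 (fun u v => A u /\ lmul u y z = v)) => [|i u v _ [Au <-]].
  by split; [exact: A_0|exact: lmul0l].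
split; first exact: A_D.
by rewrite -[x i]scale1r lmul_combl// !scale1r.
Qed.

Lemma lmul_sumr (I : finType) x (y : I -> op H) z : A x -> (forall i, A (y i)) ->
  lmul x (\sum_i y i) z = \sum_i lmul x (y i) z.
Proof.
move=> Ax Ay; suff [] : A (\sum_i y i) /\ lmul x (\sum_i y i) z = \sum_i lmul x (y i) z by [].
apply: (big_rec2 (fun u v => A u /\ lmul x u z = v)) => [|i u v _ [Au <-]].
  by split; [exact: A_0|exact: lmul0r].
split; first exact: A_D.
by rewrite -[y i]scale1r lmul_combr// !scale1r.
Qed.

Lemma lmul_e a b : A a -> A b -> lmul a b e = a (x) b.
Proof. by move=> Aa Ab; have A1 := A_id hU; rewrite lmulE. Qed.

Lemma rmul_e a b : A a -> A b -> rmul a b e = a (x) b.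
Proof. by move=> Aa Ab; have A1 := A_id hU; rewrite rmulE. Qed.

Lemma hnorm_tens1 a : A a -> hnorm (a (x) idfun) = Num.sqrt (complex.Re (tr (adj a \o a))).
Proof.
move=> Aa; have A1 := A_id hU; rewrite /hnorm /dot_norm [X in complex.Re X](inner_tens L2P)//.
by rewrite (adj_id hU) (ta_id hA) mulr1.
Qed.

Lemma hnorm_1tens a : A a -> hnorm (idfun (x) (adj a)) = hnorm (a (x) idfun).
Proof.
move=> Aa; have A1 := A_id hU; rewrite hnorm_tens1//; have Aa' := A_adj hU Aa.
rewrite /hnorm /dot_norm [X in complex.Re X](inner_tens L2P)//.
by rewrite (adj_id hU) (ta_id hA) mul1r (adjK hU).
Qed.

(** A substitute for the commutant of the right action of (A (x) A^o)'': only right multiplications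
    by tensors of elements of [A] are tested. *)
Definition right_map (T : L2 -> L2) :=
  bounded_map T /\ forall u v z, A u -> A v -> T (rmul u v z) = rmul u v (T z).

(* [t] stands for the right multiplication by an element of A (x) A^o close to
   [T e]; then [<S T e, e>] is close to [<S e, t'>] with [t'] the adjoint of [t], and
   this is symmetric in [S] and [T] because the trace is. *)
Lemma right_map_trace S T : right_map S -> right_map T ->
  '[S (T e), e] = '[T (S e), e].
Proof.
move=> [bS cS] [bT cT]; have A1 := A_id hU.
pose ok (s : seq (op H * op H)) := forall p, p \in s -> A p.1 /\ A p.2.
pose ts (s : seq (op H * op H)) : L2 := \sum_(p <- s) p.1 (x) p.2.
pose st (s : seq (op H * op H)) : L2 := \sum_(p <- s) (adj p.1) (x) (adj p.2).
have st_norm s : ok s -> hnorm (st s) = hnorm (ts s).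
  move=> sA; apply/(@pexpIrn _ 2) => //; rewrite ?nnegrE ?hnorm_ge0//.
  rewrite !hnorm_sqr !inner_suml; congr complex.Re.
  under eq_bigr do rewrite inner_sumr.
  under [RHS]eq_bigr do rewrite inner_sumr.
  rewrite exchange_big [LHS]big_seq [RHS]big_seq; apply: eq_bigr => p /sA[p1 p2].
  rewrite [LHS]big_seq [RHS]big_seq; apply: eq_bigr => q /sA[q1 q2].
  have [p1' p2' q1' q2'] := And4 (A_adj hU p1) (A_adj hU p2) (A_adj hU q1) (A_adj hU q2).
  rewrite !(inner_tens L2P)// !(adjK hU)//; congr (_ * _); exact: (ta_comm hA).
have sym s t : ok s -> ok t -> '[ts s, st t] = '[ts t, st s].
  move=> sA tA; rewrite !inner_suml.
  under eq_bigr do rewrite inner_sumr.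
  under [RHS]eq_bigr do rewrite inner_sumr.
  rewrite exchange_big [LHS]big_seq [RHS]big_seq; apply: eq_bigr => p /tA[p1 p2].
  rewrite [LHS]big_seq [RHS]big_seq; apply: eq_bigr => q /sA[q1 q2].
  have [p1' p2' q1' q2'] := And4 (A_adj hU p1) (A_adj hU p2) (A_adj hU q1) (A_adj hU q2).
  rewrite !(inner_tens L2P)// !(adjK hU)//; congr (_ * _); exact: (ta_comm hA).
have val U t : right_map U -> ok t -> '[U (ts t), e] = '[U e, st t].
  move=> [bU cU] tA; rewrite (bm_sum bU) inner_suml inner_sumr.
  rewrite [LHS]big_seq [RHS]big_seq; apply: eq_bigr => p /tA[p1 p2].
  rewrite -rmul_e// cU// rmul_adj// rmul_e//; exact: A_adj.
have [cs cs0 hS] := bm_bound bS; have [ct ct0 hT] := bm_bound bT.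
(* [M] is the sum of the two error coefficients that [step] gives for S applied to T e and for T
   applied to S e. *)
pose M : R := (cs + ct) * hnorm e + hnorm (T e) + hnorm (S e) + 2.
have M0 : 0 < M.
  rewrite ltr_wpDl// !addr_ge0 ?hnorm_ge0// mulr_ge0 ?hnorm_ge0//.
  by rewrite addr_ge0// ltW.
have step U V s t r cu : right_map U -> ok s -> ok t -> 0 < r -> r <= 1 ->
    (forall z, hnorm (U z) <= cu * hnorm z) -> 0 < cu ->
    hnorm (V - ts t) < r -> hnorm (U e - ts s) < r ->
    normc ('[U V, e] - '[ts s, st t]) <= r * (cu * hnorm e + hnorm V + 1).
  move=> hU' sA tA r0 r1 hu cu0 h1 h2.
  have -> : '[U V, e] - '[ts s, st t] = '[U (V - ts t), e] + '[U e - ts s, st t].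
    rewrite (bmB hU'.1) !innerBl val//; ring.
  apply: le_trans (le_normcD _ _) _; rewrite -addrA [leRHS]mulrDr; apply: lerD.
    apply: le_trans (cauchy_schwarz _ _) _.
    rewrite mulrA ler_wpM2r ?hnorm_ge0//; apply: le_trans (hu _) _.
    by rewrite mulrC ler_wpM2r// ltW.
  apply: le_trans (cauchy_schwarz _ _) _; apply: ler_pM; rewrite ?hnorm_ge0 ?(ltW h2)//.
  rewrite st_norm//; have := hnorm_tri (ts t) V 0; rewrite !subr0 (hnormBC _ V); lra.
apply/subr0_eq/eq0_normc/eqP; rewrite eq_le normc_ge0 andbT; apply/ler_addgt0Pl => r' r'0.
rewrite addr0; pose r := Num.min 1 (r' / M).
have r0 : 0 < r by rewrite /r lt_min ltr01 divr_gt0.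
have r1 : r <= 1 by rewrite /r ge_min lexx.
have rM : r * M <= r' by rewrite -ler_pdivlMr// /r ge_min lexx orbT.
have [t tA ht] := L2P.2 (T e) r r0; have [s sA hs] := L2P.2 (S e) r r0.
have -> : '[S (T e), e] - '[T (S e), e] =
   ('[S (T e), e] - '[ts s, st t]) - ('[T (S e), e] - '[ts t, st s]).
  rewrite (sym s t)//; ring.
apply: le_trans (le_normcD _ _) _; rewrite normcN.
have h1 := step S (T e) s t r cs (conj bS cS) sA tA r0 r1 hS cs0 ht hs.
have h2 := step T (S e) t s r ct (conj bT cT) tA sA r0 r1 hT ct0 hs ht.
apply: le_trans (lerD h1 h2) _; apply: le_trans rM; rewrite /M -mulrDr.
by rewrite ler_wpM2l ?(ltW r0)// le_eqVlt; apply/orP; left; apply/eqP; ring.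
Qed.

Lemma inner_tens_e a b : A a -> A b -> '[a (x) b, e] = tr a * tr b.
Proof.
by move=> Aa Ab; have A1 := A_id hU; rewrite (inner_tens L2P)// !(adj_id hU).
Qed.

(** * Matrices of right module maps and their trace *)

Section matrices.
Implicit Types (I J : finType).
Local Notation "'KK' I" := (hilbert_sum (fun _ : I => L2)) (at level 10).

Definition rmul_vec I (u v : op H) (x : KK I) : KK I := fun i => rmul u v (x i).

Definition right_matrix I J (T : KK I -> KK J) :=
  bounded_map T /\
  forall u v x, A u -> A v -> T (rmul_vec u v x) = rmul_vec u v (T x).

Definition closed_submodule I (W : set (KK I)) :=
  closed_subspace W /\ forall u v x, A u -> A v -> W x -> W (rmul_vec u v x).

Lemma rmul_hsum_inj I (i : I) u v (z : L2) : A u -> A v ->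
  hsum_inj (H := fun _ : I => L2) (i := i) (rmul u v z) =
    rmul_vec u v (hsum_inj (H := fun _ : I => L2) (i := i) z).
Proof.
move=> Au Av; apply/funext => j; rewrite /rmul_vec.
have [<-|ij] := eqVneq i j; first by rewrite !hsum_injE.
by rewrite !hsum_inj_neq// (bm0 (bm_rmul Au Av)).
Qed.

Lemma right_matrix_comp (I J L : finType) (S : KK J -> KK L) (T : KK I -> KK J) :
  right_matrix S -> right_matrix T -> right_matrix (fun x => S (T x)).
Proof.
move=> [bS cS] [bT cT]; split; first exact: bm_comp.
by move=> u v x Au Av; rewrite cT// cS.
Qed.

Lemma right_matrix_entry I J (T : KK I -> KK J) i j : right_matrix T ->
  right_map (fun z => T (hsum_inj (H := fun _ : I => L2) (i := i) z) j).
Proof.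
move=> [bT cT]; split; last by move=> u v z Au Av; rewrite rmul_hsum_inj// cT.
exact: (bm_comp (bm_comp_proj (fun _ : J => L2) j)
  (bm_comp bT (bm_hsum_inj (fun _ : I => L2) i))).
Qed.

Definition mtrace I (T : KK I -> KK I) : R[i] :=
  \sum_i '[T (hsum_inj (H := fun _ => L2) (i := i) e) i, e].

(** The trace of S T is the double sum of the <S_ij T_ji e, e>, and [right_map_trace] swaps the two
    entries in each term. *)
Lemma mtraceC I J (S : KK J -> KK I) (T : KK I -> KK J) :
  right_matrix S -> right_matrix T ->
  mtrace (fun x => S (T x)) = mtrace (fun x => T (S x)).
Proof.
have key (I' J' : finType) (S' : KK J' -> KK I') (T' : KK I' -> KK J') : right_matrix S' ->
    mtrace (fun x => S' (T' x)) =
    \sum_i \sum_j '[S' (hsum_inj (H := fun _ => L2) (i := j)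
      (T' (hsum_inj (H := fun _ => L2) (i := i) e) j)) i, e].
  move=> [bS _]; apply: eq_bigr => i _.
  rewrite {1}[T' _]hsum_decomp (bm_sum bS) (bm_sum (bm_comp_proj _ i)).
  by rewrite inner_suml.
move=> hS hT; rewrite key// key// exchange_big; apply: eq_bigr => j _.
apply: eq_bigr => i _.
exact: (right_map_trace (right_matrix_entry j i hS) (right_matrix_entry i j hT)).
Qed.

Lemma vn_dim_mtrace I (W : set (KK I)) : vn_dim e W = complex.Re (mtrace (orth_proj W)).
Proof. by []. Qed.

(** As [A] is closed under adjoints, [rmul_adj] makes the orthogonal complement of a submodule
    invariant too, so projecting commutes with the action. *)
Lemma right_orth_proj I (W : set (KK I)) : closed_submodule W ->
  right_matrix (orth_proj W).
Proof.
move=> [hW rW]; split; first exact: bm_orth_proj.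
move=> u v x Au Av; have [Wx hx] := orth_projP hW x.
apply: orth_proj_uniq => //; first exact: rW.
move=> w Ww; rewrite -[X in '[X, _]]/(rmul_vec u v x - rmul_vec u v (orth_proj W x)).
have -> : rmul_vec u v x - rmul_vec u v (orth_proj W x) =
    rmul_vec u v (x - orth_proj W x).
  by apply/funext => i; rewrite /rmul_vec; exact/esym/(bmB (bm_rmul Au Av)).
have Au' := A_adj hU Au; have Av' := A_adj hU Av.
rewrite -(hx _ (rW _ _ _ Au' Av' Ww)); apply: eq_bigr => i _.
exact: rmul_adj.
Qed.

(** * Bounded correspondences between right submodules *)

Section correspondence.
(** [G] is a relation rather than a map because the vectors that it is to relate are two images of
    one derivation, neither of them given as a function of the other. *)
Variables (I J : finType) (G : KK I -> KK J -> Prop) (C : R).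
Hypothesis Glin : forall c x y x' y', G x y -> G x' y' -> G (c *: x + x') (c *: y + y').
Hypothesis Gr : forall u v x y, A u -> A v -> G x y -> G (rmul_vec u v x) (rmul_vec u v y).
Hypothesis GC : forall x y, G x y -> hnorm y <= C * hnorm x.
Variables (V : set (KK I)) (U : set (KK J)).
Hypothesis hV : closed_subspace V.
Hypothesis GV : forall x y, G x y -> V x /\ U y.
Hypothesis Gex : forall x, V x -> exists y, G x y.

Lemma corr_submodule : closed_submodule V.
Proof.
split=> // u v x Au Av /Gex[y xy].
by case: (GV (Gr Au Av xy)).
Qed.

Lemma corr_uniq x y y' : G x y -> G x y' -> y = y'.
Proof.
move=> h h'; have := GC (Glin (-1) h' h).
rewrite !scaleN1r ![- _ + _]addrC subrr hnorm0 mulr0 => n0.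
by apply/subr0_eq/hnorm_eq0/eqP; rewrite eq_le n0 hnorm_ge0.
Qed.

(** Precomposing with the projection onto [V] turns the partial map into a bounded map of the whole
    space, as [mtraceC] requires. *)
Lemma corr_map : exists2 T : KK I -> KK J, right_matrix T &
  forall x, V x -> G x (T x).
Proof.
pose T0 x : KK J := xget 0 [set y | G x y].
have T0P x : V x -> G x (T0 x) by move=> /Gex; exact: (@xgetPex _ 0 [set y | G x y]).
have VP x : V (orth_proj V x) by case: (orth_projP hV x).
have [bP cP] := right_orth_proj corr_submodule.
exists (T0 \o orth_proj V) => [|x Vx]; last by rewrite /= orth_proj_id//; exact: T0P.
split=> [|u v x Au Av /=].
  split=> [c x y /=|].
    apply: (@corr_uniq (orth_proj V (c *: x + y))); first exact: T0P.
    by rewrite (bmP bP); apply: Glin; exact: T0P.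
  have [p p0 hp] := bm_bound bP; exists (`|C| * p) => x /=.
  apply: le_trans (GC (T0P _ (VP x))) _; rewrite -mulrA.
  apply: (@le_trans _ _ (`|C| * hnorm (orth_proj V x))).
    by rewrite ler_wpM2r ?hnorm_ge0// ler_norm.
  by rewrite ler_wpM2l.
apply: (@corr_uniq (orth_proj V (rmul_vec u v x))); first exact: T0P.
by rewrite cP//; apply: Gr => //; exact: T0P.
Qed.

End correspondence.

(* If [T : V -> U] is invertible with inverse [S], then
   [P_V = (S P_U) (T P_V)] and [P_U = (T P_V) (S P_U)], so the traces agree: no
   polar decomposition is needed. *)
Lemma vn_dim_eq I J (G : KK I -> KK J -> Prop) (C : R)
    (V : set (KK I)) (U : set (KK J)) :
  (forall c x y x' y', G x y -> G x' y' -> G (c *: x + x') (c *: y + y')) ->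
  (forall u v x y, A u -> A v -> G x y -> G (rmul_vec u v x) (rmul_vec u v y)) ->
  (forall x y, G x y -> hnorm y <= C * hnorm x /\ hnorm x <= C * hnorm y) ->
  closed_subspace V -> closed_subspace U ->
  (forall x y, G x y -> V x /\ U y) ->
  (forall x, V x -> exists y, G x y) -> (forall y, U y -> exists x, G x y) ->
  vn_dim e V = vn_dim e U.
Proof.
move=> Gl Gr GC hV hU' GVU GV GU.
have GC1 x y : G x y -> hnorm y <= C * hnorm x by move=> /GC[].
have GC2 y x : G x y -> hnorm x <= C * hnorm y by move=> /GC[].
have Gl' c y x y' x' : G x y -> G x' y' -> G (c *: x + x') (c *: y + y') by exact: Gl.
have Gr' u v y x : A u -> A v -> G x y -> G (rmul_vec u v x) (rmul_vec u v y) by exact: Gr.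
have GUV y x : G x y -> U y /\ V x by move=> /GVU[].
have [T rT TG] := corr_map Gl Gr GC1 hV GVU GV.
have [S rS SG] := corr_map (G := fun y x => G x y) Gl' Gr' GC2 hU' GUV GU.
have rPV := right_orth_proj (corr_submodule Gr hV GVU GV).
have rPU := right_orth_proj (corr_submodule (G := fun y x => G x y) Gr' hU' GUV GU).
have ST x : V x -> S (T x) = x.
  move=> Vx; have h := TG x Vx; have [_ Uy] := GVU _ _ h.
  exact: (corr_uniq (G := fun y x => G x y) Gl' GC2 (SG _ Uy) h).
have TS y : U y -> T (S y) = y.
  move=> Uy; have h := SG y Uy; have [Vx _] := GVU _ _ h.
  exact: (corr_uniq Gl GC1 (TG _ Vx) h).
have VP x : V (orth_proj V x) by case: (orth_projP hV x).
have UP y : U (orth_proj U y) by case: (orth_projP hU' y).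
rewrite !vn_dim_mtrace; congr complex.Re.
pose S' y := S (orth_proj U y); pose T' x := T (orth_proj V x).
have -> : orth_proj V = (fun x => S' (T' x)).
  apply/funext => x; rewrite /S' /T' (orth_proj_id hU') ?ST//.
  by case: (GVU _ _ (TG _ (VP x))).
have -> : orth_proj U = (fun y => T' (S' y)).
  apply/funext => y; rewrite /S' /T' (orth_proj_id hV) ?TS//.
  by case: (GVU _ _ (SG _ (UP y))).
by apply: mtraceC; exact: right_matrix_comp.
Qed.

End matrices.
End modules.

(** * Derivations *)

Section derivation_theory.
Context (R : realType) (H : hilbert R) (A : set (op H)) (tr : op H -> R[i]).
Hypothesis hA : tracial_algebra A tr.
Let hU := ta_usa hA.
Local Notation L2 := (tm_space (L2_tensor A tr)).
Local Notation "a (x) b" := (tm_tens (L2_tensor A tr) a b)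
  (at level 40, left associativity).
Local Notation e := ((idfun : op H) (x) (idfun : op H)).
Local Notation lmul := (tens_mul (A := A) (tr := tr)).
Local Notation rmul := (rmul (A := A) (tr := tr)).
Local Notation der := (derivation (@scalars R H) (A := A) (tr := tr)).
Implicit Types (d : op H -> L2) (a b : op H).

Lemma der_comb d c a b : der d -> A a -> A b -> d (c *: a + b) = c *: d a + d b.
Proof. by case=> h _ _; exact: h. Qed.
Lemma der_leibniz d a b : der d -> A a -> A b ->
  d (a \o b) = lmul a idfun (d b) + lmul idfun b (d a).
Proof. by case=> _ h _; exact: h. Qed.
Lemma der_scalar d c : der d -> d (c *: (idfun : op H)) = 0.
Proof. by case=> _ _; apply; exists c. Qed.
Lemma der_id d : der d -> d idfun = 0.
Proof. by move=> /(der_scalar 1); rewrite scale1r. Qed.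
Lemma der_0 d : der d -> d 0 = 0.
Proof. by move=> /(der_scalar 0); rewrite scale0r. Qed.

Lemma derivation_comb c d d' : der d -> der d' -> der (fun a => c *: d a + d' a).
Proof.
have A1 := A_id hU.
move=> hd hd'; split=> [k x y Ax Ay|x y Ax Ay|x [k _ <-]].
- rewrite !der_comb// !scalerDr !scalerA mulrC -!addrA; congr (_ + _).
  by rewrite addrCA.
- rewrite (der_leibniz hd Ax Ay) (der_leibniz hd' Ax Ay).
  rewrite (bmP (bm_lmul hA Ax A1)) (bmP (bm_lmul hA A1 Ay)) scalerDr -!addrA; congr (_ + _).
  by rewrite addrCA.
- by rewrite !der_scalar// scaler0 addr0.
Qed.

Lemma derivation_sub d d' : der d -> der d' -> der (fun a => d a - d' a).
Proof.
move=> hd hd'; have := derivation_comb (-1) hd' hd; congr (derivation _ _).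
by apply/funext => a; rewrite scaleN1r addrC.
Qed.

Lemma derivation_rmul u v d : A u -> A v -> der d -> der (fun a => rmul u v (d a)).
Proof.
have A1 := A_id hU; move=> Au Av hd; have bR := bm_rmul hA Au Av.
split=> [k x y Ax Ay|x y Ax Ay|x [k _ <-]].
- by rewrite der_comb// (bmP bR).
- by rewrite (der_leibniz hd Ax Ay) (bmD bR) !(lmul_rmul hA).
- by rewrite der_scalar// (bm0 bR).
Qed.

Definition inner_der (z : L2) : op H -> L2 :=
  fun a => lmul a idfun z - lmul idfun a z.

Lemma derivation_inner z : der (inner_der z).
Proof.
have A1 := A_id hU; rewrite /inner_der; split=> [k x y Ax Ay|x y Ax Ay|x [k _ <-]].
- rewrite (lmul_combl hA)// (lmul_combr hA)// scalerBr opprD addrACA //.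
- have Axy : A (x \o y) by exact: A_o.
  rewrite (bmB (bm_lmul hA Ax A1)) (bmB (bm_lmul hA A1 Ay)).
  rewrite (lmul_compl hA z Ax Ay) (lmul_lr hA z Ax Ay) (lmul_rl hA z Ax Ay).
  by rewrite (lmul_compr hA z Ay Ax) addrA subrK.
- have A0 := A_0 hU; rewrite -[k *: _]addr0 (lmul_combl hA)// (lmul_combr hA)//.
  by rewrite (lmul0l hA)// (lmul0r hA)// subrr.
Qed.

Section generation.
Variable X : {fset op H}.
Hypothesis hX : generates (@scalars R H) A X.

Lemma generators_sub x : x \in X -> A x.
Proof.
move=> xX; have [_ ->] := hX; move=> W [_ sW]; apply: sW; right; exact: xX.
Qed.

Lemma generated_sub (P : set (op H)) : unital_star_algebra P ->
  @scalars R H `|` [set` X] `<=` P -> A `<=` P.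
Proof. by move=> hP sP a Aa; move: (Aa); rewrite {1}hX.2; apply. Qed.

(** The elements at which all derivations are controlled by [q] are closed under sums, and under
    products by the Leibniz rule and the boundedness of multiplication. Keeping [q] arbitrary lets
    one argument serve both the norm of [phi] and the norm of the blocks. *)
Lemma generation_bound (q : (op H -> L2) -> R) :
  (forall x, x \in X -> exists C, forall d, der d -> hnorm (d x) <= C * q d) ->
  forall a, A a -> exists C, forall d, der d -> hnorm (d a) <= C * q d.
Proof.
move=> qX; have A1 := A_id hU.
pose bnd a := exists C, forall d, der d -> hnorm (d a) <= C * q d.
have bnd_scalar c : bnd (c *: (idfun : op H)).
  by exists 0 => d hd; rewrite der_scalar// hnorm0 mul0r.
have bnd_comb c a b : A a -> A b -> bnd a -> bnd b -> bnd (c *: a + b).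
  move=> Aa Ab [C hC] [C' hC']; exists (normc c * C + C') => d hd.
  rewrite der_comb// mulrDl; apply: le_trans (hnormD _ _) _; rewrite hnormZ.
  by apply: lerD; [rewrite -mulrA ler_wpM2l ?normc_ge0// hC|exact: hC'].
have bnd_comp a b : A a -> A b -> bnd a -> bnd b -> bnd (a \o b).
  move=> Aa Ab [C hC] [C' hC'].
  have [m m0 hm] := bm_bound (bm_lmul hA Aa A1).
  have [n n0 hn] := bm_bound (bm_lmul hA A1 Ab).
  exists (m * C' + n * C) => d hd; rewrite (der_leibniz hd Aa Ab) mulrDl.
  apply: le_trans (hnormD _ _) _; apply: lerD.
    by apply: le_trans (hm _) _; rewrite -mulrA ler_pM2l// hC'.
  by apply: le_trans (hn _) _; rewrite -mulrA ler_pM2l// hC.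
(* A bound at [a] gives none at its adjoint, since a derivation need not respect adjoints. Both
   bounds are carried along, and they hold at the start because the set of generators is stable
   under adjoints. *)
pose P := [set a | [/\ A a, bnd a & bnd (adj a)]].
have adj_scalar c : adj (c *: (idfun : op H)) = c^* *: (idfun : op H).
  rewrite -[c *: _]addr0 (adj_comb hU)//; last exact: A_0.
  have A0 := A_0 hU; rewrite (adj_id hU) -[X in adj X](scale0r (0 : op H)).
  rewrite -[0 *: _]addr0 (adj_comb hU)// conjC0 scale0r add0r.
  by rewrite (_ : adj 0 = 0) ?addr0//; apply: (adj_eq hU) => // x y;
    rewrite -[LHS]/('[0, y]) -[RHS]/('[x, 0]) inner0l inner0r.
have hP : unital_star_algebra P.
  split.
  - by move=> a [/(usa_bounded hU)].
  - rewrite /P /= (adj_id hU); have := bnd_scalar 1; rewrite scale1r; by split.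
  - move=> c a b [Aa ba ba'] [Ab bb bb']; split; first exact: A_comb.
      exact: bnd_comb.
    by rewrite (adj_comb hU)//; apply: bnd_comb => //; exact: A_adj.
  - move=> a b [Aa ba ba'] [Ab bb bb']; split; first exact: A_o.
      exact: bnd_comp.
    by rewrite (adj_o hU Aa Ab); apply: bnd_comp => //; exact: A_adj.
  - move=> a [Aa ba ba']; exists (adj a); last exact: (adj_is hU).
    by split; rewrite ?(adjK hU)//; exact: A_adj.
move=> a Aa; suff : P a by case.
apply: (generated_sub hP) Aa => x [[c _ <-]|xX].
  split; rewrite ?adj_scalar//; exact: A_Z.
have Ax := generators_sub xX; split=> //; first exact: qX.
have [S SX hS] := hX.1 x xX; rewrite (adj_eq hU Ax hS); exact: qX.
Qed.

End generation.

(** Writing the 2-norm of a as the norm of a (x) 1 makes the bounds on left and right multiplication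
    in L2 available for it. *)
Lemma dom_adjointP d z : dom_adjoint d z <->
  exists c : R, forall a, A a -> normc '[d a, z] <= c * hnorm (a (x) idfun).
Proof.
split=> -[c hc]; exists c => a Aa; have := hc a Aa.
  by rewrite norm_normc lecR (hnorm_tens1 hA).
by rewrite norm_normc lecR (hnorm_tens1 hA).
Qed.

(** Moving [a] across leaves the inner product of z with a^* (x) 1, which has the norm of a (x) 1 by
    the trace property. *)
Lemma inner_lmul_e a z : A a ->
  normc '[lmul a idfun z, e] <= hnorm z * hnorm (a (x) idfun).
Proof.
move=> Aa; have A1 := A_id hU; have Aa' := A_adj hU Aa.
rewrite (lmul_adj hA)// (adj_id hU) (lmul_e hA)//.
apply: le_trans (cauchy_schwarz _ _) _; rewrite ler_wpM2l ?hnorm_ge0//.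
by rewrite !(hnorm_tens1 hA)// (adjK hU)// (tr_sqC hA).
Qed.

Lemma inner_rmul_e a z : A a ->
  normc '[lmul idfun a z, e] <= hnorm z * hnorm (a (x) idfun).
Proof.
move=> Aa; have A1 := A_id hU; have Aa' := A_adj hU Aa.
rewrite (lmul_adj hA)// (adj_id hU) (lmul_e hA)//.
apply: le_trans (cauchy_schwarz _ _) _; rewrite ler_wpM2l ?hnorm_ge0//.
by rewrite (hnorm_1tens hA).
Qed.

Lemma hnorm_tens1_mul u v : A u -> A v -> exists2 c : R, 0 < c & forall a, A a ->
  hnorm ((u \o a \o v) (x) idfun) <= c * hnorm (a (x) idfun).
Proof.
move=> Au Av; have A1 := A_id hU.
have [c c0 hc] := bm_bound (bm_comp (bm_lmul hA Au A1) (bm_rmul hA Av A1)).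
exists c => // a Aa; apply: le_trans (hc _); rewrite (rmulE hA)// (lmulE hA)//.
exact: A_o.
Qed.

(* [<d a, c (x) f>] is [<c' . d a . f', 1 (x) 1>] for the adjoints [c'], [f'], and
   by the Leibniz rule [c' . d a . f'] is [d (c' a f')] up to terms controlled by
   the 2-norm of [a]. *)
Lemma dom_adjoint_tens d c f : der d -> dom_adjoint d e -> A c -> A f ->
  dom_adjoint d (c (x) f).
Proof.
move=> hd /dom_adjointP[k hk] Ac Af; have A1 := A_id hU.
have Ac' := A_adj hU Ac; have Af' := A_adj hU Af.
have [k1 k10 hk1] := hnorm_tens1_mul Ac' Af'.
have [k2 k20 hk2] := hnorm_tens1_mul Ac' A1.
have [k3 k30 hk3] := hnorm_tens1_mul A1 Af'.
apply/dom_adjointP.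
exists (`|k| * k1 + hnorm (d (adj f)) * k2 + hnorm (d (adj c)) * k3) => a Aa.
have Aca : A (adj c \o a) by exact: A_o.
have Aaf : A (a \o adj f) by exact: A_o.
have Acaf : A (adj c \o a \o adj f) by exact: A_o.
have -> : '[d a, c (x) f] = '[d (adj c \o a \o adj f), e]
    - '[lmul (adj c \o a) idfun (d (adj f)), e] - '[lmul idfun (a \o adj f) (d (adj c)), e].
  have <- : '[lmul (adj c) (adj f) (d a), e] = '[d a, c (x) f].
    by rewrite (lmul_adj hA Ac' Af') !(adjK hU)// (lmul_e hA).
  rewrite -!innerBl; congr '[_, _].
  rewrite -[adj c \o a \o adj f]/(adj c \o (a \o adj f)).
  rewrite (der_leibniz hd Ac' Aaf) (der_leibniz hd Aa Af').
  rewrite (bmD (bm_lmul hA Ac' A1)) (lmul_compl hA _ Ac' Aa) (lmul_lr hA _ Ac' Af').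
  by rewrite addrAC addrK addrC addKr.
apply: le_trans (le_normcD _ _) _; rewrite normcN 2!mulrDl; apply: lerD.
  apply: le_trans (le_normcD _ _) _; rewrite normcN; apply: lerD.
    apply: le_trans (hk _ Acaf) _; rewrite -mulrA.
    apply: (@le_trans _ _ (`|k| * hnorm ((adj c \o a \o adj f) (x) idfun))).
      by rewrite ler_wpM2r ?hnorm_ge0// ler_norm.
    by rewrite ler_wpM2l//; exact: hk1.
  apply: le_trans (inner_lmul_e _ Aca) _.
  by rewrite -mulrA ler_wpM2l ?hnorm_ge0//; exact: hk2.
apply: le_trans (inner_rmul_e _ Aaf) _.
by rewrite -mulrA ler_wpM2l ?hnorm_ge0//; exact: hk3.
Qed.

Local Notation Der := (Der11 (@scalars R H) (A := A) (tr := tr)).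

Lemma Der11_comb c d d' : Der d -> Der d' -> Der (fun a => c *: d a + d' a).
Proof.
move=> [hd /dom_adjointP[k hk]] [hd' /dom_adjointP[k' hk']].
split; first exact: derivation_comb.
apply/dom_adjointP; exists (normc c * k + k') => a Aa.
rewrite innerDl innerZl; apply: le_trans (le_normcD _ _) _.
rewrite normcM mulrDl; apply: lerD; last exact: hk'.
by rewrite -mulrA ler_wpM2l ?normc_ge0// hk.
Qed.

(** Pairing with 1 (x) 1 after the right action is pairing with u^* (x) v^* before it, a vector that
    [dom_adjoint_tens] places in the domain of the adjoint. *)
Lemma Der11_rmul u v d : A u -> A v -> Der d -> Der (fun a => rmul u v (d a)).
Proof.
move=> Au Av [hd hk]; split; first exact: derivation_rmul.
have Au' := A_adj hU Au; have Av' := A_adj hU Av.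
have /dom_adjointP[c hc] := dom_adjoint_tens hd hk Au' Av'.
apply/dom_adjointP; exists c => a /hc.
by rewrite (rmul_adj hA)// (rmul_e hA).
Qed.

Lemma Der11_inner z : Der (inner_der z).
Proof.
split; first exact: derivation_inner.
apply/dom_adjointP; exists (hnorm z + hnorm z) => a Aa.
rewrite innerBl mulrDl; apply: le_trans (le_normcD _ _) _; rewrite normcN.
by apply: lerD; [exact: inner_lmul_e|exact: inner_rmul_e].
Qed.

Lemma Der11_0 : Der (fun=> 0).
Proof.
have A1 := A_id hU; split.
- split=> [c x y Ax Ay|x y Ax Ay|//]; first by rewrite scaler0 addr0.
  by rewrite (bm0 (bm_lmul hA Ax A1)) (bm0 (bm_lmul hA A1 Ay)) addr0.
- by apply/dom_adjointP; exists 0 => a Aa; rewrite inner0l normc0 mul0r.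
Qed.

(** * The closure of [Der11] in the norm given by generators *)

Section closure.
Variable X : {fset op H}.
Hypothesis hX : generates (@scalars R H) A X.
Local Notation cl := (closure_Der11 (@scalars R H) (A := A) (tr := tr) X).
Local Notation ph := (phi (A := A) (tr := tr) (X := X)).

Lemma phi_le d x : x \in X -> hnorm (d x) <= hnorm (ph d).
Proof. by move=> xX; exact: (hnorm_comp (ph d) [` xX]%fset). Qed.

Lemma phi_bound a : A a -> exists C, forall d, der d -> hnorm (d a) <= C * hnorm (ph d).
Proof.
apply: (generation_bound hX (q := fun d => hnorm (ph d))) => x xX.
by exists 1 => d _; rewrite mul1r phi_le.
Qed.

Lemma closure_der d : cl d -> der d. Proof. by case. Qed.

Lemma closure_Der d : Der d -> cl d.
Proof.
by move=> hd; split=> [|r r0]; [case: hd|exists d => //; rewrite subrr hnorm0].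
Qed.

Lemma closure_comb c d d' : cl d -> cl d' -> cl (fun a => c *: d a + d' a).
Proof.
move=> [hd hk] [hd' hk']; split=> [|r r0]; first exact: derivation_comb.
have c0 : 0 < normc c + 1 by have := normc_ge0 c; lra.
have r2 : 0 < r / 2 by lra.
have [f Df hf] := hk _ (divr_gt0 r2 c0); have [f' Df' hf'] := hk' _ r2.
exists (fun a => c *: f a + f' a); first exact: Der11_comb.
rewrite (_ : _ - _ = c *: (ph d - ph f) + (ph d' - ph f')); last first.
  apply/funext => x; rewrite -[LHS]/((c *: d (val x) + d' (val x)) - (c *: f (val x) + f' (val x))).
  rewrite -[RHS]/(c *: (d (val x) - f (val x)) + (d' (val x) - f' (val x))).
  by rewrite opprD addrACA scalerBr.
apply: le_lt_trans (hnormD _ _) _; rewrite hnormZ.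
move: hf; rewrite (ltr_pdivlMr _ _ c0); have := hnorm_ge0 (ph d - ph f).
have := normc_ge0 c; move: (normc c) (hnorm (_ - _)) (hnorm (_ - _)) hf' => x y z *; nra.
Qed.

Lemma bm_rmul_vec (I : finType) u v : A u -> A v ->
  bounded_map (rmul_vec (A := A) (tr := tr) (I := I) u v).
Proof.
move=> Au Av; have bR := bm_rmul hA Au Av; split=> [c x y|].
  by apply/funext => i; exact: (bmP bR).
have [c c0 hc] := bm_bound bR; exists (c * #|I|%:R) => x.
apply: le_trans (hnorm_hsum _) _.
apply: (@le_trans _ _ (\sum_(i : I) c * hnorm x)).
  apply: ler_sum => i _; apply: le_trans (hc _) _.
  by rewrite ler_pM2l// hnorm_comp.
by rewrite sumr_const -[leLHS]mulr_natr mulrAC.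
Qed.

Lemma closure_rmul u v d : A u -> A v -> cl d -> cl (fun a => rmul u v (d a)).
Proof.
move=> Au Av [hd hk]; split=> [|r r0]; first exact: derivation_rmul.
have bR := @bm_rmul_vec X u v Au Av.
have [c c0 hc] := bm_bound bR; have [f Df] := hk _ (divr_gt0 r0 c0).
rewrite ltr_pdivlMr// => lt; exists (fun a => rmul u v (f a)); first exact: Der11_rmul.
rewrite -[X in hnorm X]/(rmul_vec u v (ph d) - rmul_vec u v (ph f)) -(bmB bR).
by apply: le_lt_trans (hc _) _; rewrite mulrC.
Qed.

(** Approximation on the generators gives approximation on any finite family in [A]. This is what
    allows a closure to be transported between algebras whose generating sets are unrelated. *)
Lemma closure_approx d (I : finType) (a : I -> op H) r : cl d ->
  (forall i, A (a i)) -> 0 < r -> exists2 d', Der d' & forall i, hnorm (d (a i) - d' (a i)) < r.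
Proof.
move=> [hd hk] Aa r0; have /choice[C hC] := fun i => phi_bound (Aa i).
pose B : R := \sum_i `|C i| + 1.
have B0 : 0 < B by rewrite ltr_wpDl// sumr_ge0.
have CB i : C i <= B.
  apply: le_trans (ler_norm _) _; rewrite /B (bigD1 i)//= -addrA lerDl.
  by rewrite addr_ge0// sumr_ge0.
have [d' Dd'] := hk _ (divr_gt0 r0 B0); rewrite ltr_pdivlMr// => lt.
exists d' => // i; apply: le_lt_trans lt; rewrite mulrC.
have hd' : der d' by case: Dd'.
have := hC i _ (derivation_sub hd hd') => /le_trans; apply.
by rewrite ler_wpM2r ?hnorm_ge0.
Qed.

Lemma closure_intro d : der d -> (forall r, 0 < r -> exists2 d', Der d' &
  forall x, x \in X -> hnorm (d x - d' x) < r) -> cl d.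
Proof.
(* Dividing by the cardinal plus one keeps the inequality strict and covers an empty [X]. *)
move=> hd h; split=> // r r0; have X0 : 0 < (#|{: X}|.+1)%:R :> R by [].
have [d' Dd' hd'] := h _ (divr_gt0 r0 X0); exists d' => //.
apply: le_lt_trans (hnorm_hsum _) _.
apply: (@le_lt_trans _ _ (\sum_(x : X) r / (#|{: X}|.+1)%:R)).
  by apply: ler_sum => x _; apply: ltW; apply: hd'; exact: valP.
rewrite sumr_const -[ltLHS]mulr_natr mulrAC ltr_pdivrMr// ltr_pM2l// ltr_nat.
exact: ltnSn.
Qed.

(* The norm of [d a] is controlled by the values on the generators, so the
   convergence of [phi] forces pointwise convergence on A. *)
Lemma closed_phi : closed_subspace (ph @` cl).
Proof.
have A1 := A_id hU; split.
- by exists (fun=> 0) => //; exact/closure_Der/Der11_0.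
- move=> c _ _ [d hd <-] [d' hd' <-]; exists (fun a => c *: d a + d' a) => //.
  exact: closure_comb.
move=> v hv.
have /choice[d hd] : forall n : nat, exists d, cl d /\ hnorm (v - ph d) < n.+1%:R^-1.
  by move=> n; have [_ [d hd <-] lt] := hv _ (inv_nat_gt0 R n); exists d.
have dv : cvg_seq (fun n => ph (d n)) v.
  by apply: cvg_seq_inv => n; rewrite hnormBC; case: (hd n).
have hder n : der (d n) by apply: closure_der; case: (hd n).
(* Derivations are functions on all operators but constrained on [A] only; elsewhere any value of
   the limit will do. *)
have /choice[f hf] : forall a, exists y, A a -> cvg_seq (fun n => d n a) y.
  move=> a; have [Aa|na] := pselect (A a); last by exists 0.
  suff [y hy] : exists y, cvg_seq (fun n => d n a) y by exists y.
  apply: cvg_seq_cauchy => r r0; have [C hC] := phi_bound Aa.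
  pose B : R := `|C| + 1; have B0 : 0 < B by rewrite ltr_wpDl.
  have r2 : 0 < r / 2 by lra.
  have [N hN] := dv _ (divr_gt0 r2 B0); exists N => m n /hN hm /hN hn.
  have := hC _ (derivation_sub (hder m) (hder n)).
  rewrite -[X in _ * hnorm X]/(ph (d m) - ph (d n)).
  have := hnorm_tri (ph (d m)) v (ph (d n)); rewrite (hnormBC v).
  move: hm hn; rewrite !(ltr_pdivlMr _ _ B0) /B.
  have := hnorm_ge0 (ph (d m) - ph (d n)); have := ler_norm C; have := normr_ge0 C.
  move: (hnorm (ph (d m) - v)) (hnorm (ph (d n) - v)) (hnorm (ph (d m) - ph (d n))).
  move: (hnorm _) (`|C| : R) => x c y z w c0 h1 h2 h3 h4 h5 h6; apply: (le_lt_trans h6).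
  have : C * w <= c * w by rewrite ler_wpM2r.
  have : c * w <= c * (y + z) by rewrite ler_wpM2l.
  nra.
exists f; last first.
  apply/funext => x; have Ax : A (val x) by apply: (generators_sub hX); exact: valP.
  apply: (cvg_seq_uniq (hf _ Ax)) => r /dv[N hN]; exists N => n /hN.
  by apply: le_lt_trans; exact: (hnorm_comp (ph (d n) - v) x).
have phf : ph f = v.
  apply/funext => x; have Ax : A (val x) by apply: (generators_sub hX); exact: valP.
  apply: (cvg_seq_uniq (hf _ Ax)) => r /dv[N hN]; exists N => n /hN.
  by apply: le_lt_trans; exact: (hnorm_comp (ph (d n) - v) x).
split=> [|r r0].
  split=> [c x y Ax Ay|x y Ax Ay|x Bx].
  - have h := cvg_seq_comb c (hf x Ax) (hf y Ay).
    apply: (cvg_seq_uniq (hf _ (A_comb hU c Ax Ay))).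
    by move: h; congr cvg_seq; apply/funext => n; rewrite der_comb.
  - have h1 := bm_cvg (bm_lmul hA Ax A1) (hf y Ay).
    have h2 := bm_cvg (bm_lmul hA A1 Ay) (hf x Ax).
    have := cvg_seq_comb 1 h1 h2; rewrite scale1r => h.
    apply: (cvg_seq_uniq (hf _ (A_o hU Ax Ay))).
    by move: h; congr cvg_seq; apply/funext => n; rewrite scale1r /= (der_leibniz (hder n) Ax Ay).
  - have Ax : A x by case: Bx => c _ <-; exact: A_Z.
    apply: (cvg_seq_uniq (hf _ Ax)) => r r0; exists 0%N => n _.
    by case: (hder n) => _ _ ->//; rewrite subrr hnorm0.
have r2 : 0 < r / 2 by lra.
have [N hN] := inv_nat_small r2.
have [[_ /(_ _ r2)[g Dg hg]] hv'] := hd N; exists g => //; rewrite phf.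
apply: le_lt_trans (hnorm_tri v (ph (d N)) _) _.
have := hN N (leqnn N); move: hv' hg; move: (hnorm _) (hnorm _) (_^-1) => *; lra.
Qed.

End closure.
End derivation_theory.

(** * Direct sums *)

Section direct_sum_algebra.
Context (R : realType) (n : nat) (H : 'I_n -> hilbert R).
Local Notation HS := (hilbert_sum H).
Implicit Types (i j : 'I_n).

Definition op_inj i (T : op (H i)) : op HS :=
  op_sum (@dfwith _ (fun j => op (H j)) (fun=> 0) i T).

Definition op_comp i (T : op HS) : op (H i) := fun x => T (hsum_inj x) i.
Arguments op_comp : clear implicits.

Lemma op_comp_sum (T : forall i, op (H i)) i : op_comp i (op_sum T) = T i.
Proof. by apply/funext => x; rewrite /op_comp /op_sum hsum_injE. Qed.

Lemma op_comp_inj i (T : op (H i)) : op_comp i (op_inj T) = T.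
Proof. by rewrite op_comp_sum dfwithin. Qed.

Lemma op_comp_inj_neq i j (T : op (H i)) : i != j -> op_comp j (op_inj T) = 0.
Proof. by move=> ij; rewrite op_comp_sum dfwithout. Qed.

Lemma op_comp_comb i c (S T : op HS) :
  op_comp i (c *: S + T) = c *: op_comp i S + op_comp i T.
Proof. by []. Qed.

Lemma op_comp_id i : op_comp i idfun = idfun.
Proof. by apply/funext => x; rewrite /op_comp /= hsum_injE. Qed.

(** The central projection p_i. *)
Definition cproj i : op HS := op_inj (idfun : op (H i)).

Variable A : forall i, set (op (H i)).
Arguments A : clear implicits.
Local Notation DA := (direct_sum A).

Lemma op_compK (T : op HS) : DA T -> T = op_sum (fun i => op_comp i T).
Proof.
move=> [t _ <-]; congr op_sum; apply: functional_extensionality_dep => i.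
by rewrite op_comp_sum.
Qed.

Lemma op_comp_ext (S T : op HS) : DA S -> DA T ->
  (forall i, op_comp i S = op_comp i T) -> S = T.
Proof.
move=> /op_compK -> /op_compK -> h; congr op_sum.
apply: functional_extensionality_dep => i; have := h i.
by rewrite !op_comp_sum.
Qed.

Lemma A_op_comp i (T : op HS) : DA T -> A i (op_comp i T).
Proof. by move=> [t tA <-]; rewrite op_comp_sum. Qed.

Lemma op_comp_o i (S T : op HS) : DA S -> DA T ->
  op_comp i (S \o T) = op_comp i S \o op_comp i T.
Proof.
move=> [s _ <-] [t _ <-]; rewrite -[op_sum s \o op_sum t]/(op_sum (fun i => s i \o t i)).
by rewrite !op_comp_sum.
Qed.

Hypothesis hA : forall i, unital_star_algebra (A i).

Lemma A_op_inj i (T : op (H i)) : A i T -> DA (op_inj T).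
Proof.
move=> AT; exists (@dfwith _ (fun j => op (H j)) (fun=> 0) i T) => //= j.
have [<-|ij] := eqVneq i j; first by rewrite dfwithin.
by rewrite dfwithout//; exact: A_0.
Qed.

Lemma A_cproj i : DA (cproj i).
Proof. exact: A_op_inj (A_id (hA i)). Qed.

Lemma op_sum_adjoint (S T : forall i, op (H i)) :
  (forall i, is_adjoint (S i) (T i)) -> is_adjoint (op_sum S) (op_sum T).
Proof. by move=> h x y; rewrite !inner_hsum; apply: eq_bigr => i _; exact: h. Qed.

Lemma bm_op_sum (T : forall i, op (H i)) : (forall i, bounded_map (T i)) ->
  bounded_map (op_sum T).
Proof.
move=> bT; split=> [c x y|].
  by apply: functional_extensionality_dep => i; exact: (bmP (bT i)).
have /choice[c hc] : forall i, exists c : R, 0 < c /\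
    forall x, hnorm (T i x) <= c * hnorm x.
  by move=> i; have [c] := bm_bound (bT i); exists c.
exists (\sum_i c i) => x; apply: le_trans (hnorm_hsum _) _.
rewrite mulr_suml; apply: ler_sum => i _; have [c0 h] := hc i.
by apply: le_trans (h _) _; rewrite ler_pM2l// hnorm_comp.
Qed.

Lemma direct_sum_usa : unital_star_algebra DA.
Proof.
split.
- by move=> _ [t tA <-]; apply: bm_op_sum => i; exact: (A_bm (hA i)).
- by exists (fun i => idfun) => // i; exact: A_id.
- move=> c _ _ [s sA <-] [t tA <-]; exists (fun i => c *: s i + t i) => //= i.
  exact: A_comb.
- by move=> _ _ [s sA <-] [t tA <-]; exists (fun i => s i \o t i) => //= i; exact: A_o.
- move=> _ [t tA <-]; exists (op_sum (fun i => adj (t i))).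
    by exists (fun i => adj (t i)) => //= i; exact: A_adj.
  by apply: op_sum_adjoint => i; exact: (adj_is (hA i)).
Qed.
Let hU := direct_sum_usa.

Lemma op_inj_comb i c (S T : op (H i)) : A i S -> A i T ->
  op_inj (c *: S + T) = c *: op_inj S + op_inj T.
Proof.
move=> AS AT; apply: op_comp_ext.
- exact: A_op_inj (A_comb (hA i) c AS AT).
- by apply: (A_comb hU); exact: A_op_inj.
move=> j; rewrite op_comp_comb; have [<-|ij] := eqVneq i j; first by rewrite !op_comp_inj.
by rewrite !op_comp_inj_neq// scaler0 addr0.
Qed.

Lemma op_inj_o i (S T : op (H i)) : A i S -> A i T ->
  op_inj (S \o T) = op_inj S \o op_inj T.
Proof.
move=> AS AT; have DS := A_op_inj AS; have DT := A_op_inj AT.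
apply: op_comp_ext; [exact: A_op_inj (A_o (hA i) AS AT)|exact: (A_o hU)|].
move=> j; rewrite op_comp_o//; have [<-|ij] := eqVneq i j; first by rewrite !op_comp_inj.
by rewrite !op_comp_inj_neq.
Qed.

Lemma op_inj_is_adjoint i (S T : op (H i)) : is_adjoint S T ->
  is_adjoint (op_inj S) (op_inj T).
Proof.
move=> h; apply: op_sum_adjoint => j.
have [<-|ij] := eqVneq i j; first by rewrite !dfwithin.
by rewrite !dfwithout// => x y; rewrite -[LHS]/('[0, y]) -[RHS]/('[x, 0]) inner0l inner0r.
Qed.

Lemma op_inj_adj i (T : op (H i)) : A i T -> adj (op_inj T) = op_inj (adj T).
Proof.
move=> AT; apply: (adj_eq hU); first exact: A_op_inj.
exact: op_inj_is_adjoint (adj_is (hA i) AT).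
Qed.

Lemma op_comp_adj i (T : op HS) : DA T -> op_comp i (adj T) = adj (op_comp i T).
Proof.
move=> DT; have DT' := A_adj hU DT; apply/esym.
apply: (adj_eq (hA i)); first exact: A_op_comp.
move=> x y; rewrite /op_comp -inner_hsum_inj inner_conj -(inner_hsum_inj y) -inner_conj.
by rewrite (adj_is hU DT) inner_conj.
Qed.

Lemma cproj_adj i : adj (cproj i) = cproj i.
Proof. by rewrite op_inj_adj ?(adj_id (hA i))//; exact: A_id. Qed.

Lemma cproj_l i (T : op HS) : DA T -> cproj i \o T = op_inj (op_comp i T).
Proof.
move=> DT; have Dp := A_cproj i.
apply: op_comp_ext; [exact: (A_o hU)|exact: A_op_inj (A_op_comp i DT)|].
move=> j; rewrite op_comp_o// /cproj; have [<-|ij] := eqVneq i j; first by rewrite !op_comp_inj.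
by rewrite !op_comp_inj_neq.
Qed.

Lemma cproj_r i (T : op HS) : DA T -> T \o cproj i = op_inj (op_comp i T).
Proof.
move=> DT; have Dp := A_cproj i.
apply: op_comp_ext; [exact: (A_o hU)|exact: A_op_inj (A_op_comp i DT)|].
move=> j; rewrite op_comp_o// /cproj; have [<-|ij] := eqVneq i j; first by rewrite !op_comp_inj.
rewrite !op_comp_inj_neq//.
apply/funext => x; exact: (bm0 (A_bm (hA j) (A_op_comp j DT))).
Qed.

Lemma cproj_inj_l i (T : op (H i)) : A i T -> cproj i \o op_inj T = op_inj T.
Proof. by move=> AT; rewrite cproj_l ?op_comp_inj//; exact: A_op_inj. Qed.
Lemma cproj_inj_r i (T : op (H i)) : A i T -> op_inj T \o cproj i = op_inj T.
Proof. by move=> AT; rewrite cproj_r ?op_comp_inj//; exact: A_op_inj. Qed.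

Lemma op_inj0 i : op_inj (0 : op (H i)) = 0.
Proof.
apply: op_comp_ext; [exact: A_op_inj (A_0 (hA i))|exact: (A_0 hU)|move=> j].
have [<-|ij] := eqVneq i j; first by rewrite op_comp_inj.
by rewrite op_comp_inj_neq.
Qed.

Lemma cproj_o i j : cproj i \o cproj j = if i == j then cproj i else 0.
Proof.
rewrite cproj_l; last exact: A_cproj.
have [<-|ij] := eqVneq i j; first by rewrite op_comp_inj.
by rewrite op_comp_inj_neq ?op_inj0// eq_sym.
Qed.

Lemma A_sum (I : finType) (T : I -> op HS) : (forall k, DA (T k)) -> DA (\sum_k T k).
Proof.
move=> DT; apply: (big_ind DA) => [|S S' ? ?|i _]; last exact: DT.
  exact: (A_0 hU).
exact: (A_D hU).
Qed.

Lemma op_sum_inj (T : op HS) : DA T -> T = \sum_i op_inj (op_comp i T).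
Proof.
move=> DT; have Di i : DA (op_inj (op_comp i T)) by exact: A_op_inj (A_op_comp i DT).
apply: op_comp_ext => // [|j]; first exact: A_sum.
have opD : {morph op_comp j : S S' / S + S' >-> S + S'} by [].
have op0 : op_comp j 0 = 0 by [].
rewrite (big_morph (op_comp j) opD op0) (bigD1 j)//= op_comp_inj.
by rewrite big1 ?addr0// => i ij; rewrite op_comp_inj_neq.
Qed.

Lemma cproj_sum1 : \sum_i cproj i = idfun.
Proof.
rewrite [RHS](op_sum_inj (A_id hU)); apply: eq_bigr => i _.
by rewrite op_comp_id.
Qed.

(** * Generators of a direct sum *)

Section generators.
Variable X : forall i, {fset op (H i)}.
Arguments X : clear implicits.
Hypothesis hX : forall i, generates (@scalars R (H i)) (A i) (X i).

(** The projections p_i are added to the embedded generators because embedding a summand does not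
    preserve the unit. The explicit form of the generators serves again in [phi_bound_blocks]. *)
Lemma direct_sum_fg : exists Y : {fset op HS}, generates (@scalars R HS) DA Y /\
  forall y, y \in Y -> (exists i, y = cproj i) \/
    exists i x, x \in X i /\ y = op_inj x.
Proof.
pose s := [seq cproj i | i <- enum 'I_n] ++
  flatten [seq [seq op_inj x | x <- enum_fset (X i)] | i <- enum 'I_n].
pose Y := [fset y in s]%fset.
have memY y : y \in Y <-> (exists i, y = cproj i) \/
    exists i x, x \in X i /\ y = op_inj x.
  rewrite /Y in_fset /= /s mem_cat; split.
    case/orP => [/mapP[i _ ->]|/flattenP[_ /mapP[i _ ->] /mapP[x xX ->]]].
      by left; exists i.
    by right; exists i, x.
  case=> [[i ->]|[i [x [xX ->]]]]; apply/orP; [left|right].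
    by apply: map_f; rewrite mem_enum.
  apply/flattenP; exists [seq op_inj x | x <- enum_fset (X i)].
    by apply: (map_f (fun i => [seq op_inj x | x <- enum_fset (X i)])); rewrite mem_enum.
  exact: map_f.
exists Y; split=> [|y /memY//]; split.
  move=> y /= /memY[[i ->]|[i [x [xX ->]]]].
    exists (cproj i); first by apply/memY; left; exists i.
    by apply: op_inj_is_adjoint.
  have [x' x'X h] := (hX i).1 x xX; exists (op_inj x').
    by apply/memY; right; exists i, x'.
  exact: op_inj_is_adjoint.
apply/seteqP; split; last first.
  apply: smallest_sub => //.
  move=> y [[c _ <-]|/memY[[i ->]|[i [x [xX ->]]]]].
  - exact (A_Z hU c (A_id hU)).
  - exact: A_cproj.
  - exact: A_op_inj (generators_sub (hX i) xX).
move=> T DT C [hC sC].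
have Cp i : C (cproj i) by apply: sC; right; apply/memY; left; exists i.
rewrite (op_sum_inj DT).
apply: (big_ind C) => [|S S' CS CS'|i _]; [exact: (A_0 hC)|exact: (A_D hC)|].
have := A_op_comp i DT; move: (op_comp i T) => t At.
(* The elements of the summand that embed into [C] form a unital star-algebra, with unit supplied by
   p_i, which belongs to [C]. *)
suff: [set t | A i t /\ C (op_inj t)] t by case.
apply: (generated_sub (hX i)) At; last first.
  move=> x [[c _ <-]|xX].
    split; first by apply: (A_Z (hA i)); exact: A_id.
    have A1 := A_id (hA i); have A0 := A_0 (hA i).
    by rewrite -[c *: _]addr0 op_inj_comb// op_inj0 addr0; exact (A_Z hC c (Cp i)).
  split; first exact: (generators_sub (hX i)).
  by apply: sC; right; apply/memY; right; exists i, x.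
split.
- by move=> a [/(usa_bounded (hA i))].
- by split; [exact: A_id|exact: Cp].
- move=> c a b [Aa Ca] [Ab Cb]; split; first exact: A_comb.
  by rewrite op_inj_comb//; exact: (A_comb hC).
- move=> a b [Aa Ca] [Ab Cb]; split; first exact: A_o.
  by rewrite op_inj_o//; exact: (A_o hC).
- move=> a [Aa Ca]; exists (adj a); last exact: (adj_is (hA i)).
  split; first exact: A_adj.
  by rewrite -op_inj_adj//; exact: (A_adj hC).
Qed.

End generators.

Variables (tr : forall i, op (H i) -> R[i]) (alpha : 'I_n -> R).
Arguments tr : clear implicits.
Hypothesis htr : forall i, tracial_algebra (A i) (tr i).
Hypothesis alpha_gt0 : forall i, 0 < alpha i.
Hypothesis alpha_sum : \sum_i alpha i = 1.
Local Notation dtr := (weighted_trace alpha tr).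

Lemma dtrE T : dtr T = \sum_i (alpha i)%:C%C * tr i (op_comp i T).
Proof. by []. Qed.

Lemma real_ge0 (x : R) : 0 <= x -> 0 <= x%:C%C.
Proof. by move=> x0; rewrite lecE /= eqxx. Qed.

Lemma direct_sum_tracial : tracial_algebra DA dtr.
Proof.
split; first exact: hU.
- move=> c S T DS DT; rewrite !dtrE mulr_sumr -big_split /=; apply: eq_bigr => i _.
  rewrite op_comp_comb (ta_lin (htr i)); [ring|exact: A_op_comp|exact: A_op_comp].
- move=> T DT pT; rewrite dtrE; apply: sumr_ge0 => i _.
  apply: mulr_ge0; first exact/real_ge0/ltW.
  apply: (ta_pos (htr i)); first exact: A_op_comp.
  move=> x; rewrite /op_comp inner_conj -(inner_hsum_inj x) -inner_conj; exact: pT.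
- move=> S T DS DT; rewrite !dtrE; apply: eq_bigr => i _; congr (_ * _).
  by rewrite (op_comp_o i DS DT) (op_comp_o i DT DS) (ta_comm (htr i))//; exact: A_op_comp.
- rewrite dtrE; under eq_bigr do rewrite op_comp_id (ta_id (htr _)) mulr1.
  by rewrite -rmorph_sum alpha_sum.
Qed.
Let hD := direct_sum_tracial.

Lemma dtr_inj i (T : op (H i)) : A i T -> dtr (op_inj T) = (alpha i)%:C%C * tr i T.
Proof.
move=> AT; rewrite dtrE (bigD1 i)//= op_comp_inj big1 ?addr0// => j ji.
by rewrite op_comp_inj_neq ?(tr_0 (htr j)) ?mulr0// eq_sym.
Qed.

Lemma dtr_cproj i : dtr (cproj i) = (alpha i)%:C%C.
Proof. by rewrite dtr_inj ?(ta_id (htr i)) ?mulr1//; exact: A_id. Qed.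

(** The i-th term of the weighted trace of T^* T carries the factor alpha_i and the other terms are
    nonnegative. This makes the compression to a corner bounded. *)
Lemma dtr_ge i (T : op HS) : DA T ->
  tr i (adj (op_comp i T) \o op_comp i T) <= ((alpha i)^-1)%:C%C * dtr (adj T \o T).
Proof.
move=> DT; have DT' := A_adj hU DT.
rewrite dtrE (bigD1 i)//= mulrDr mulrA -rmorphM mulVf ?gt_eqF// mul1r.
rewrite (op_comp_o i DT' DT) (op_comp_adj i DT) lerDl mulr_ge0//.
  by apply/real_ge0/ltW; rewrite invr_gt0.
apply: sumr_ge0 => j _; rewrite mulr_ge0//; first exact/real_ge0/ltW.
by rewrite (op_comp_o j DT' DT) (op_comp_adj j DT); apply: (tr_sq_ge0 (htr j)); exact: A_op_comp.
Qed.

Local Notation L2 := (tm_space (L2_tensor DA dtr)).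
Local Notation "a (x) b" := (tm_tens (L2_tensor DA dtr) a b)
  (at level 40, left associativity).
Local Notation L2_ i := (tm_space (L2_tensor (A i) (tr i))).
Local Notation tens_ i := (tm_tens (L2_tensor (A i) (tr i))).
Local Notation lmul := (tens_mul (A := DA) (tr := dtr)).
Local Notation lmul_ i := (tens_mul (A := A i) (tr := tr i)).

(* [iota i] embeds L2(A_i (x) A_i^o) onto the corner p_i L2 p_i, multiplying inner
   products by alpha_i^2; [kappa i] is the compression to that corner. *)
Lemma iota_exists i : exists T : L2_ i -> L2, bounded_map T /\
  forall a b, A i a -> A i b -> T (tens_ i a b) = op_inj a (x) op_inj b.
Proof.
have a0 : 0 <= alpha i by exact: ltW.
apply: (tens_map (htr i) hD (L2P (htr i)) (L2P hD) (f := @op_inj i) (g := @op_inj i) a0 a0).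
- by move=> a; exact: A_op_inj.
- by move=> a; exact: A_op_inj.
- by move=> c a b; exact: op_inj_comb.
- by move=> c a b; exact: op_inj_comb.
- move=> a Aa; have Aa' := A_adj (hA i) Aa.
  by rewrite op_inj_adj// -op_inj_o// dtr_inj//; exact: A_o.
- move=> a Aa; have Aa' := A_adj (hA i) Aa.
  by rewrite op_inj_adj// -op_inj_o// dtr_inj//; exact: A_o.
Qed.

Definition iota i : L2_ i -> L2 := sval (cid (iota_exists i)).
Lemma bm_iota i : bounded_map (iota (i := i)).
Proof. by rewrite /iota; case: cid => T []. Qed.
Lemma iotaE i a b : A i a -> A i b -> iota (tens_ i a b) = op_inj a (x) op_inj b.
Proof. by rewrite /iota; case: cid => T [_ h] /=; exact: h. Qed.

Lemma kappa_exists i : exists T : L2 -> L2_ i, bounded_map T /\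
  forall a b, DA a -> DA b -> T (a (x) b) = tens_ i (op_comp i a) (op_comp i b).
Proof.
have a0 : 0 <= (alpha i)^-1 by apply/ltW; rewrite invr_gt0.
apply: (tens_map hD (htr i) (L2P hD) (L2P (htr i)) (f := op_comp i) (g := op_comp i) a0 a0).
- by move=> a; exact: A_op_comp.
- by move=> a; exact: A_op_comp.
- by [].
- by [].
- by move=> a Da; exact: dtr_ge.
- move=> a Da; rewrite -(tr_sqC (htr i)); last exact: A_op_comp.
  by rewrite -(tr_sqC hD)//; exact: dtr_ge.
Qed.

Definition kappa i : L2 -> L2_ i := sval (cid (kappa_exists i)).
Lemma bm_kappa i : bounded_map (kappa i).
Proof. by rewrite /kappa; case: cid => T []. Qed.
Lemma kappaE i a b : DA a -> DA b ->
  kappa i (a (x) b) = tens_ i (op_comp i a) (op_comp i b).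
Proof. by rewrite /kappa; case: cid => T [_ h] /=; exact: h. Qed.

Lemma iotaK i z : kappa i (iota z) = z.
Proof.
move: z; apply: (tens_ext (L2P (htr i))).
- exact: bm_comp (bm_kappa i) (bm_iota i).
- exact: bm_id.
- move=> a b Aa Ab; rewrite iotaE// kappaE ?op_comp_inj//; exact: A_op_inj.
Qed.

Lemma kappaK i z : iota (kappa i z) = lmul (cproj i) (cproj i) z.
Proof.
have Dp := A_cproj i; move: z; apply: (tens_ext (L2P hD)).
- exact: bm_comp (bm_iota i) (bm_kappa i).
- exact: (bm_lmul hD).
move=> a b Da Db; rewrite kappaE// iotaE ?(lmulE hD) ?cproj_l ?cproj_r//; exact: A_op_comp.
Qed.

(** Each leg of the tensor contributes one factor alpha_i, through [dtr_inj]; hence the coefficient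
    alpha_i^2 of the final formula. *)
Lemma iota_adj i y z : '[iota y, z] = (alpha i ^+ 2)%:C%C * '[y, kappa i z].
Proof.
rewrite -[_%:C%C]conj_real -innerZr; move: y z.
apply: (tens_adjoint (L2P (htr i)) (L2P hD)); first exact: bm_iota.
  (* Boundedness of the multiple of [kappa] comes from [bm_comb] with a second term that vanishes
     identically. *)
  have := bm_comb (alpha i ^+ 2)%:C%C (bm_kappa i) (bm_sub (bm_kappa i) (bm_kappa i)).
  by congr bounded_map; apply/funext => z; rewrite subrr addr0.
move=> a b c f Aa Ab Dc Df; rewrite iotaE// kappaE// innerZr conj_real.
have Da := A_op_inj Aa; have Db := A_op_inj Ab.
have Dc' := A_adj hU Dc; have Df' := A_adj hU Df.
have Ac := A_op_comp i Dc; have Af := A_op_comp i Df.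
have Ac' := A_adj (hA i) Ac; have Af' := A_adj (hA i) Af.
have Aca := A_o (hA i) Ac' Aa; have Abf := A_o (hA i) Ab Af'.
rewrite (inner_tens (L2P hD))// (inner_tens (L2P (htr i)))//.
(* Inserting p_i beside the embedded elements cuts c^* and f^* down to their i-th components. *)
rewrite -(cproj_inj_l Aa) -(cproj_inj_r Ab).
rewrite -[adj c \o (cproj i \o op_inj a)]/((adj c \o cproj i) \o op_inj a).
rewrite -[(op_inj b \o cproj i) \o adj f]/(op_inj b \o (cproj i \o adj f)).
rewrite (cproj_r i Dc') (cproj_l i Df') (op_comp_adj i Dc) (op_comp_adj i Df).
rewrite -(op_inj_o Ac' Aa) -(op_inj_o Ab Af') (dtr_inj Aca) (dtr_inj Abf).
rewrite expr2 rmorphM; ring.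
Qed.

Lemma kappa_lmul i x y z : DA x -> DA y ->
  kappa i (lmul x y z) = lmul_ i (op_comp i x) (op_comp i y) (kappa i z).
Proof.
move=> Dx Dy; have Ax := A_op_comp i Dx; have Ay := A_op_comp i Dy.
move: z; apply: (tens_ext (L2P hD)).
- exact: bm_comp (bm_kappa i) (bm_lmul hD Dx Dy).
- exact: bm_comp (bm_lmul (htr i) Ax Ay) (bm_kappa i).
move=> a b Da Db; have Dxa := A_o hU Dx Da; have Dby := A_o hU Db Dy.
have Aa := A_op_comp i Da; have Ab := A_op_comp i Db.
by rewrite (lmulE hD)// !kappaE// (lmulE (htr i))// (op_comp_o i Dx Da) (op_comp_o i Db Dy).
Qed.

Lemma iota_lmul i x y z : DA x -> DA y ->
  lmul x y (iota z) = iota (lmul_ i (op_comp i x) (op_comp i y) z).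
Proof.
move=> Dx Dy; have Ax := A_op_comp i Dx; have Ay := A_op_comp i Dy.
move: z; apply: (tens_ext (L2P (htr i))).
- exact: bm_comp (bm_lmul hD Dx Dy) (bm_iota i).
- exact: bm_comp (bm_iota i) (bm_lmul (htr i) Ax Ay).
move=> a b Aa Ab; have Da := A_op_inj Aa; have Db := A_op_inj Ab.
have Axa := A_o (hA i) Ax Aa; have Aby := A_o (hA i) Ab Ay.
rewrite iotaE// (lmulE hD)// (lmulE (htr i))// iotaE//.
rewrite (op_inj_o Ax Aa) (op_inj_o Ab Ay); congr tm_tens.
  by rewrite -cproj_r// -[RHS]/(x \o (cproj i \o op_inj a)) cproj_inj_l.
by rewrite -cproj_l// -[RHS]/((op_inj b \o cproj i) \o y) cproj_inj_r.
Qed.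

Lemma kappa_e i : kappa i (idfun (x) idfun) = tens_ i idfun idfun.
Proof. by have D1 := A_id hU; rewrite kappaE// op_comp_id. Qed.

Lemma iota_e i : iota (tens_ i idfun idfun) = cproj i (x) cproj i.
Proof. by have A1 := A_id (hA i); rewrite iotaE. Qed.

(** The predicate is abstract so that the statement covers both [derivation] and [Der11]. *)
Lemma pointwise_sum (P : (op HS -> L2) -> Prop) (I : finType) (f : I -> op HS -> L2) :
  P (fun=> 0) -> (forall c d d', P d -> P d' -> P (fun a => c *: d a + d' a)) ->
  (forall k, P (f k)) -> P (fun a => \sum_k f k a).
Proof.
move=> P0 PD Pf; elim: (index_enum I) => [|k s IH].
  by move: P0; congr P; apply/funext => a; rewrite big_nil.
have := PD 1 _ _ (Pf k) IH; congr P; apply/funext => a.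
by rewrite big_cons scale1r.
Qed.

(** * Derivations of a direct sum and their blocks *)

Section derivations.
Variable X : forall i, {fset op (H i)}.
Arguments X : clear implicits.
Hypothesis hX : forall i, generates (@scalars R (H i)) (A i) (X i).
Variable Y : {fset op HS}.
Hypothesis hY : generates (@scalars R HS) DA Y.
Local Notation der := (derivation (@scalars R HS) (A := DA) (tr := dtr)).
Local Notation der_ i := (derivation (@scalars R (H i)) (A := A i) (tr := tr i)).
Local Notation Der := (Der11 (@scalars R HS) (A := DA) (tr := dtr)).
Local Notation Der_ i := (Der11 (@scalars R (H i)) (A := A i) (tr := tr i)).
Local Notation cl := (closure_Der11 (@scalars R HS) (A := DA) (tr := dtr) Y).
Local Notation cl_ i := (closure_Der11 (@scalars R (H i)) (A := A i) (tr := tr i) (X i)).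
Local Notation e := ((idfun : op HS) (x) (idfun : op HS)).
Implicit Types (d : op HS -> L2).

Definition compress i d : op (H i) -> L2_ i := fun a => kappa i (d (op_inj a)).
Arguments compress : clear implicits.

Lemma derivation_compress i d : der d -> der_ i (compress i d).
Proof.
move=> hd; have A1 := A_id (hA i); have A0 := A_0 (hA i); have D1 := A_id hU.
have lin c x y : A i x -> A i y ->
    compress i d (c *: x + y) = c *: compress i d x + compress i d y.
  move=> Ax Ay; rewrite /compress op_inj_comb// (der_comb c hd) ?(bmP (bm_kappa i))//.
    exact: A_op_inj.
  exact: A_op_inj.
have leib x y : A i x -> A i y -> compress i d (x \o y) =
    lmul_ i x idfun (compress i d y) + lmul_ i idfun y (compress i d x).
  move=> Ax Ay; have Dx := A_op_inj Ax; have Dy := A_op_inj Ay.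
  rewrite /compress op_inj_o// (der_leibniz hd Dx Dy) (bmD (bm_kappa i)).
  by rewrite !kappa_lmul// !op_comp_inj op_comp_id.
split=> // x [c _ <-]; rewrite -[c *: _]addr0 lin//.
have -> : compress i d 0 = 0 by rewrite /compress op_inj0 (der_0 hd) (bm0 (bm_kappa i)).
(* The unit of the summand embeds as p_i, at which [d] need not vanish. Its compression does: the
   Leibniz rule for 1 = 1 1 reads x = x + x. *)
suff -> : compress i d idfun = 0 by rewrite scaler0 addr0.
apply: (addrI (compress i d idfun)); rewrite addr0.
by have := leib _ _ A1 A1; rewrite (lmul_id (htr i)) => /esym.
Qed.

(** Up to alpha_i^2, pairing the compression with the unit tensor of the summand is pairing [d] with
    the tensor of p_i and p_i, which [dom_adjoint_tens] allows. *)
Lemma Der11_compress i d : Der d -> Der_ i (compress i d).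
Proof.
move=> [hd hk]; have A1 := A_id (hA i); have D1 := A_id hU; have Dp := A_cproj i.
split; first exact: derivation_compress.
have /(dom_adjointP hD)[c hc] := dom_adjoint_tens hD hd hk Dp Dp.
have a0 : 0 < alpha i by []; have a2 : 0 < alpha i ^+ 2 by rewrite exprn_gt0.
apply/(dom_adjointP (htr i)).
(* The square root of alpha_i is the ratio of the 2-norm of the embedded [a] to that of [a] in its
   summand. *)
exists ((alpha i ^+ 2)^-1 * (c * Num.sqrt (alpha i))) => a Aa; have Da := A_op_inj Aa.
rewrite -mulrA ler_pdivlMl// -mulrA.
have -> : alpha i ^+ 2 * normc '[compress i d a, tens_ i idfun idfun] =
    normc '[d (op_inj a), cproj i (x) cproj i].
  rewrite -iota_e -[RHS]normc_conj -inner_conj iota_adj normcM normc_real.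
  by rewrite -[RHS]mulrC inner_conj normc_conj ger0_norm ?(ltW a2)// mulrC.
apply: le_trans (hc _ Da) _; rewrite (hnorm_tens1 hD)// (hnorm_tens1 (htr i))//.
have Aa' := A_adj (hA i) Aa.
rewrite op_inj_adj// -(op_inj_o Aa' Aa) dtr_inj; last exact: A_o.
set t := tr i _; have -> : complex.Re ((alpha i)%:C%C * t) = alpha i * complex.Re t.
  by case: t => u v /=; rewrite mul0r subr0.
by rewrite sqrtrM ?(ltW a0).
Qed.

Lemma closure_compress i d : cl d -> cl_ i (compress i d).
Proof.
move=> hd; have dd : der d by case: hd.
apply: closure_intro => [|r r0]; first exact: derivation_compress.
have [m m0 hm] := bm_bound (bm_kappa i).
have DX (x : X i) : DA (op_inj (val x)).
  by apply: A_op_inj; apply: (generators_sub (hX i)); exact: valP.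
have [d' Dd' hd'] := closure_approx hD hY hd DX (divr_gt0 r0 m0).
exists (compress i d'); first exact: Der11_compress.
move=> x xX; rewrite /compress -(bmB (bm_kappa i)); apply: le_lt_trans (hm _) _.
by have := hd' [` xX]%fset; rewrite ltr_pdivlMr// mulrC.
Qed.

(** A right inverse of the block decomposition when [z] is off-diagonal: since [inner_der z] takes
    p_i to p_i z - z p_i, its (i, j) block for i <> j is p_i z p_j. *)
Definition assemble (f : forall i, op (H i) -> L2_ i) (z : L2) : op HS -> L2 :=
  fun a => \sum_i iota (f i (op_comp i a)) + inner_der z a.

Lemma derivation_iota i (f : op (H i) -> L2_ i) : der_ i f ->
  der (fun a => iota (f (op_comp i a))).
Proof.
move=> hf; have A1 := A_id (hA i); have D1 := A_id hU; split=> [c x y Dx Dy|x y Dx Dy|x [c _ <-]].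
- rewrite op_comp_comb (der_comb c hf) ?(bmP (bm_iota i))//; exact: A_op_comp.
- have Ax := A_op_comp i Dx; have Ay := A_op_comp i Dy.
  rewrite (op_comp_o i Dx Dy) (der_leibniz hf Ax Ay) (bmD (bm_iota i)).
  by rewrite !iota_lmul// op_comp_id.
- have -> : op_comp i (c *: idfun) = c *: (idfun : op (H i)).
    by rewrite -[LHS]/(c *: op_comp i idfun) op_comp_id.
  by rewrite (der_scalar c hf) (bm0 (bm_iota i)).
Qed.

Lemma derivation_assemble f z : (forall i, der_ i (f i)) -> der (assemble f z).
Proof.
move=> hf; have D0 : der (fun=> 0) by case: (Der11_0 hD).
have h := pointwise_sum D0 (derivation_comb hD) (fun i => derivation_iota (hf i)).
have := derivation_comb hD 1 h (derivation_inner hD z); congr (derivation _ _).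
by apply/funext => a; rewrite scale1r.
Qed.

(** By [iota_adj] the pairing with 1 (x) 1 is alpha_i^2 times the one for [f], and [kappa] bounds
    the 2-norm of a component by that of the whole element. *)
Lemma Der11_iota i (f : op (H i) -> L2_ i) : Der_ i f ->
  Der (fun a => iota (f (op_comp i a))).
Proof.
move=> [hf /(dom_adjointP (htr i))[c hc]]; have A1 := A_id (hA i); have D1 := A_id hU.
split; first exact: derivation_iota.
have a2 : 0 < alpha i ^+ 2 by rewrite exprn_gt0.
have [m m0 hm] := bm_bound (bm_kappa i).
apply/(dom_adjointP hD); exists (alpha i ^+ 2 * (`|c| * m)) => a Da.
have Aa := A_op_comp i Da.
rewrite iota_adj normcM normc_real (gtr0_norm a2) -mulrA ler_pM2l// kappa_e.
apply: le_trans (hc _ Aa) _; apply: le_trans (ler_wpM2r (hnorm_ge0 _) (ler_norm c)) _.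
rewrite -mulrA ler_wpM2l//; apply: le_trans (hm _).
by rewrite kappaE// op_comp_id.
Qed.

Lemma Der11_assemble f z : (forall i, Der_ i (f i)) -> Der (assemble f z).
Proof.
move=> hf.
have h := pointwise_sum (Der11_0 hD) (Der11_comb hD) (fun i => Der11_iota (hf i)).
have := Der11_comb hD 1 h (Der11_inner hD z); congr (Der11 _ _).
by apply/funext => a; rewrite scale1r.
Qed.

(** Only the [f i] need approximating, at the i-th components of the elements of [Y]; the inner part
    already lies in [Der11] and cancels in the difference. *)
Lemma closure_assemble f z : (forall i, cl_ i (f i)) -> cl (assemble f z).
Proof.
move=> hf; have df i : der_ i (f i) by case: (hf i).
apply: closure_intro => [|r r0]; first exact: derivation_assemble.
have /choice[m hm] : forall i, exists m : R, 0 < m /\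
    forall z : L2_ i, hnorm (iota z) <= m * hnorm z.
  by move=> i; have [m] := bm_bound (bm_iota i); exists m.
pose B : R := \sum_i m i + 1.
have S0 : 0 <= \sum_i m i by apply: sumr_ge0 => i _; case: (hm i) => /ltW.
have B0 : 0 < B by rewrite ltr_wpDl.
have rB : 0 < r / B by exact: divr_gt0.
have ex i : exists f', Der_ i f' /\
    forall x : Y, hnorm (f i (op_comp i (val x)) - f' (op_comp i (val x))) < r / B.
  have AX (x : Y) : A i (op_comp i (val x)).
    by apply: A_op_comp; apply: (generators_sub hY); exact: valP.
  by have [f'] := closure_approx (htr i) (hX i) (hf i) AX rB; exists f'.
pose f' i := sval (cid (ex i)).
have f'P i : Der_ i (f' i) /\
    forall x : Y, hnorm (f i (op_comp i (val x)) - f' i (op_comp i (val x))) < r / B.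
  exact: (svalP (cid (ex i))).
exists (assemble f' z) => [|x xY]; first by apply: Der11_assemble => i; case: (f'P i).
rewrite /assemble opprD addrACA subrr addr0 -sumrB.
apply: le_lt_trans (hnorm_sum _ _ _) _.
apply: (@le_lt_trans _ _ (\sum_i m i * (r / B))).
  apply: ler_sum => i _; rewrite -(bmB (bm_iota i)); have [m0 h] := hm i.
  apply: le_trans (h _) _; rewrite ler_pM2l//; apply: ltW.
  by case: (f'P i) => _ /(_ [` xY]%fset).
rewrite -mulr_suml mulrA ltr_pdivrMr// mulrC ltr_pM2l//.
by rewrite /B ltrDl.
Qed.

(** The pairs (i, i) are kept for uniformity; their block is zero by [der_cproj_flip]. *)
Let idx : finType := ({i : 'I_n & X i} + 'I_n * 'I_n)%type.
Local Notation KY := (hilbert_sum (fun _ : idx => L2)).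
Local Notation W i := (phi (X := X i) @` cl_ i).
Local Notation ph := (phi (A := DA) (tr := dtr) (X := Y)).

(** Every block is kept in a copy of the full L2 rather than in its corner, so that [phi] and
    [blocks] take values in modules over one algebra, as [vn_dim_eq] requires. *)
Definition blocks d : KY := fun y =>
  match y with
  | inl t => lmul (cproj (tag t)) (cproj (tag t)) (d (op_inj (val (tagged t))))
  | inr ij => lmul (cproj ij.1) (cproj ij.2) (d (cproj ij.1))
  end.

Lemma blocks_bound : exists C, forall d, der d -> hnorm (blocks d) <= C * hnorm (ph d).
Proof.
have /choice[C hC] : forall y : idx, exists C, forall d, der d ->
    hnorm (blocks d y) <= C * hnorm (ph d).
  have key i j a : DA a -> exists C, forall d, der d ->
      hnorm (lmul (cproj i) (cproj j) (d a)) <= C * hnorm (ph d).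
    move=> Da; have [C hC] := phi_bound hD hY Da.
    have [m m0 hm] := bm_bound (bm_lmul hD (A_cproj i) (A_cproj j)).
    exists (m * C) => d hd; apply: le_trans (hm _) _; rewrite -mulrA ler_pM2l//.
    exact: hC.
  case=> [[i x]|[i j]] /=; apply: key; last exact: A_cproj.
  by apply: A_op_inj; apply: (generators_sub (hX i)); exact: valP.
exists (\sum_y C y) => d hd; apply: le_trans (hnorm_hsum _) _.
by rewrite mulr_suml; apply: ler_sum => y _; exact: hC.
Qed.

Lemma lmul_decomp_l i z : lmul (cproj i) idfun z = \sum_j lmul (cproj i) (cproj j) z.
Proof.
by rewrite -(lmul_sumr hD) ?cproj_sum1//; [exact: A_cproj|move=> j; exact: A_cproj].
Qed.

Lemma lmul_decomp_r i z : lmul idfun (cproj i) z = \sum_j lmul (cproj j) (cproj i) z.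
Proof.
by rewrite -(lmul_suml hD) ?cproj_sum1//; [move=> j; exact: A_cproj|exact: A_cproj].
Qed.

(* [d (p_j p_i) = 0] gives [p_j . d p_i . p_i = - p_j . d p_j . p_i]. *)
Lemma der_cproj_flip d i j : der d ->
  lmul (cproj j) (cproj i) (d (cproj i)) =
  if j == i then 0 else - lmul (cproj j) (cproj i) (d (cproj j)).
Proof.
move=> hd; have Di := A_cproj i; have Dj := A_cproj j; have D1 := A_id hU.
have bL := bm_lmul hD Dj Di.
have := congr1 (lmul (cproj j) (cproj i)) (der_leibniz hd Dj Di).
have Dii := A_o hU Di Di; have Djj := A_o hU Dj Dj.
rewrite (bmD bL) (lmul_comp hD _ Dj Di Dj D1) (lmul_comp hD _ Dj Di D1 Di).
rewrite -[idfun \o cproj i]/(cproj i) -[cproj j \o idfun]/(cproj j).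
have [->|ji] := eqVneq j i.
  rewrite !cproj_o !eqxx => h; apply: (addrI (lmul (cproj i) (cproj i) (d (cproj i)))).
  by rewrite addr0 -h.
rewrite !cproj_o !eqxx (negPf ji) (der_0 hd) (bm0 bL) => /esym/eqP.
by rewrite addr_eq0 => /eqP.
Qed.

(** The Leibniz rule for p_i = p_i p_i splits d(p_i) into n terms p_i . d(p_i) . p_j, which are
    blocks, and n terms p_j . d(p_i) . p_i, which [der_cproj_flip] turns into blocks up to sign. *)
Lemma hnorm_der_cproj i d : der d -> hnorm (d (cproj i)) <= n%:R * 2 * hnorm (blocks d).
Proof.
move=> hd; have Di := A_cproj i.
have hb j k : hnorm (lmul (cproj j) (cproj k) (d (cproj j))) <= hnorm (blocks d).
  exact: (hnorm_comp (blocks d) (inr (j, k))).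
have := der_leibniz hd Di Di; rewrite cproj_o eqxx lmul_decomp_l lmul_decomp_r => {1}->.
have sumb (F : 'I_n -> L2) : (forall j, hnorm (F j) <= hnorm (blocks d)) ->
    hnorm (\sum_j F j) <= n%:R * hnorm (blocks d).
  move=> hF; apply: le_trans (hnorm_sum _ _ _) _.
  apply: (@le_trans _ _ (\sum_(j < n) hnorm (blocks d))); first exact: ler_sum.
  by rewrite sumr_const card_ord mulr_natl.
apply: le_trans (hnormD _ _) _.
have -> : n%:R * 2 * hnorm (blocks d) = n%:R * hnorm (blocks d) + n%:R * hnorm (blocks d).
  by ring.
apply: lerD; apply: sumb => j //.
rewrite der_cproj_flip//; case: eqP => _; first by rewrite hnorm0 hnorm_ge0.
by rewrite hnormN.
Qed.

(** The estimate is made at the special generators of [direct_sum_fg]; [generation_bound] then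
    extends it to all elements, in particular to those of [Y]. *)
Lemma phi_bound_blocks : exists C, forall d, der d -> hnorm (ph d) <= C * hnorm (blocks d).
Proof.
have D1 := A_id hU; have [Z [hZ memZ]] := direct_sum_fg hX.
have key : forall a, DA a -> exists C, forall d, der d -> hnorm (d a) <= C * hnorm (blocks d).
  apply: (generation_bound hD hZ (q := fun d => hnorm (blocks d))) => y.
  case/memZ => [[i ->]|[i [x [xX ->]]]].
    by exists (n%:R * 2) => d; exact: hnorm_der_cproj.
  have Ax := generators_sub (hX i) xX; have Dx := A_op_inj Ax; have Di := A_cproj i.
  have [m m0 hm] := bm_bound (bm_lmul hD Dx D1).
  have [m' m'0 hm'] := bm_bound (bm_lmul hD D1 Dx).
  exists (1 + m * (n%:R * 2) + m' * (n%:R * 2)) => d hd.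
  have hp := hnorm_der_cproj i hd.
  (* The Leibniz rule for x = p_i x, combined with that for x = x p_i: beyond the corner of d(x),
     only d(p_i) is involved. *)
  have -> : d (op_inj x) = lmul (cproj i) (cproj i) (d (op_inj x)) +
      lmul (op_inj x) idfun (d (cproj i)) + lmul idfun (op_inj x) (d (cproj i)).
    have h1 := der_leibniz hd Di Dx; have h2 := der_leibniz hd Dx Di.
    rewrite cproj_inj_l// in h1; rewrite cproj_inj_r// in h2.
    rewrite {1}h1 {1}h2 (bmD (bm_lmul hD Di D1)) (lmul_compl hD _ Di Dx).
    by rewrite (lmul_lr hD _ Di Di) cproj_inj_l// [X in X + _ = _]addrC.
  rewrite 2!mulrDl mul1r -!mulrA.
  apply: le_trans (hnormD _ _) _; apply: lerD; last first.
    by apply: le_trans (hm' _) _; rewrite ler_pM2l// mulrA.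
  apply: le_trans (hnormD _ _) _; apply: lerD; last first.
    by apply: le_trans (hm _) _; rewrite ler_pM2l// mulrA.
  exact: (hnorm_comp (blocks d) (inl (Tagged (fun i => X i) [` xX]%fset))).
have /choice[C hC] : forall x : Y, exists C, forall d, der d ->
    hnorm (d (val x)) <= C * hnorm (blocks d).
  by move=> x; apply: key; apply: (generators_sub hY); exact: valP.
exists (\sum_x C x) => d hd; apply: le_trans (hnorm_hsum _) _.
by rewrite mulr_suml; apply: ler_sum => x _; exact: hC.
Qed.

Definition mk_blocks (w : forall i, hilbert_sum (fun _ : X i => L2_ i))
    (k : 'I_n * 'I_n -> L2) : KY := fun y =>
  match y with
  | inl t => iota (w (tag t) (tagged t))
  | inr ij => if ij.1 == ij.2 then 0 else lmul (cproj ij.1) (cproj ij.2) (k ij)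
  end.

Lemma blocks_compress d : der d ->
  blocks d = mk_blocks (fun i => phi (X := X i) (compress i d)) (fun ij => d (cproj ij.1)).
Proof.
move=> hd; apply/funext => -[[i x]|[i j]] /=; first by rewrite -kappaK.
have [<-|//] := eqVneq i j.
by have := der_cproj_flip i i hd; rewrite eqxx.
Qed.

Definition off_diag (k : 'I_n * 'I_n -> L2) : L2 :=
  \sum_(ij : 'I_n * 'I_n) if ij.1 == ij.2 then 0 else lmul (cproj ij.1) (cproj ij.2) (k ij).

Lemma lmul_cproj i j l m z : lmul (cproj i) (cproj j) (lmul (cproj l) (cproj m) z) =
  if (i == l) && (j == m) then lmul (cproj i) (cproj j) z else 0.
Proof.
have Di := A_cproj i; have Dj := A_cproj j; have Dl := A_cproj l; have Dm := A_cproj m.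
rewrite (lmul_comp hD)// !cproj_o.
have [_|il] /= := eqVneq i l; last first.
  by rewrite (lmul0l hD)//; case: ifP => _ //; exact: (A_0 hU).
rewrite (eq_sym m); have [->|jm] /= := eqVneq j m; first by rewrite ?eqxx.
by rewrite ?eqxx /= (lmul0r hD).
Qed.

Lemma lmul_off_diag i j k : lmul (cproj i) (cproj j) (off_diag k) =
  if i == j then 0 else lmul (cproj i) (cproj j) (k (i, j)).
Proof.
have Di := A_cproj i; have Dj := A_cproj j; have bL := bm_lmul hD Di Dj.
rewrite /off_diag (bm_sum bL) (bigD1 (i, j))//= big1 ?addr0 => [|[l m] /=].
  by case: ifP => _; [rewrite (bm0 bL)|rewrite lmul_cproj !eqxx].
rewrite xpair_eqE => ne; case: ifP => _; first exact: bm0 bL.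
by rewrite lmul_cproj; case: ifP => // /andP[/eqP il /eqP jm]; rewrite il jm !eqxx in ne.
Qed.

(** The two parts do not interfere. In a corner the inner part is a commutator with p_i z p_i = 0;
    in the blocks of d(p_i) each [f l] is evaluated at 1 or 0, where it vanishes. *)
Lemma blocks_assemble f k : (forall i, der_ i (f i)) ->
  blocks (assemble f (off_diag k)) = mk_blocks (fun i => phi (X := X i) (f i)) k.
Proof.
move=> hf; have D1 := A_id hU.
have fsum i (g : forall l, L2_ l) : (forall l, l != i -> g l = 0) ->
    \sum_l iota (g l) = iota (g i).
  by move=> h; rewrite (bigD1 i)//= big1 ?addr0// => l li; rewrite h// (bm0 (bm_iota l)).
apply/funext => -[[i x]|[i j]] /=.
  have Ax : A i (val x) by apply: (generators_sub (hX i)); exact: valP.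
  have Di := A_cproj i; have Dx := A_op_inj Ax.
  rewrite /assemble (fsum i (fun l => f l (op_comp l (op_inj (val x))))); last first.
    by move=> l li; rewrite op_comp_inj_neq 1?eq_sym// (der_0 (hf l)).
  rewrite (bmD (bm_lmul hD Di Di)) op_comp_inj iota_lmul// op_comp_inj.
  rewrite (lmul_id (htr i)) /inner_der (bmB (bm_lmul hD Di Di)).
  rewrite (lmul_comp hD _ Di Di Dx D1) (lmul_comp hD _ Di Di D1 Dx).
  rewrite -[idfun \o cproj i]/(cproj i) -[cproj i \o idfun]/(cproj i).
  rewrite cproj_inj_l// cproj_inj_r// -{1}(cproj_inj_r Ax) -{2}(cproj_inj_l Ax).
  rewrite -[X in lmul _ X _](_ : cproj i \o idfun = _)//.
  have -> : lmul (op_inj (val x) \o cproj i) (cproj i \o idfun) (off_diag k) =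
      lmul (op_inj (val x)) idfun (lmul (cproj i) (cproj i) (off_diag k)).
    by rewrite (lmul_comp hD).
  have -> : lmul (cproj i) (cproj i \o op_inj (val x)) (off_diag k) =
      lmul idfun (op_inj (val x)) (lmul (cproj i) (cproj i) (off_diag k)).
    by rewrite (lmul_comp hD).
  by rewrite lmul_off_diag eqxx (bm0 (bm_lmul hD Dx D1)) (bm0 (bm_lmul hD D1 Dx)) subrr addr0.
have Di := A_cproj i; have Dj := A_cproj j.
rewrite /assemble (bmD (bm_lmul hD Di Dj)) big1 ?(bm0 (bm_lmul hD Di Dj)) ?add0r; last first.
  move=> l _; have [<-|il] := eqVneq i l.
    by rewrite op_comp_inj (der_id (hf i)) (bm0 (bm_iota i)).
  by rewrite op_comp_inj_neq// (der_0 (hf l)) (bm0 (bm_iota l)).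
rewrite /inner_der (bmB (bm_lmul hD Di Dj)).
rewrite (lmul_comp hD _ Di Dj Di D1) (lmul_comp hD _ Di Dj D1 Di).
rewrite -[idfun \o cproj j]/(cproj j) -[cproj i \o idfun]/(cproj i) !cproj_o eqxx.
have [<-|ij] := eqVneq i j; first by rewrite subrr.
by rewrite (lmul0r hD)// subr0 lmul_off_diag (negPf ij).
Qed.

(** The blocks are independent of one another: any choice of them is realized by [assemble] with
    [off_diag k] as the inner part. *)
Lemma image_blocks : blocks @` cl =
  [set u | exists w k, (forall i, W i (w i)) /\ u = mk_blocks w k].
Proof.
apply/seteqP; split=> [_ [d hd <-]|_ [w [k [hw ->]]]].
  exists (fun i => phi (X := X i) (compress i d)), (fun ij => d (cproj ij.1)).
  split; last by apply: blocks_compress; case: hd.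
  by move=> i; exists (compress i d) => //; exact: closure_compress.
pose f i := sval (cid2 (hw i)).
have fcl i : cl_ i (f i) by exact: s2valP (cid2 (hw i)).
have fw i : phi (X := X i) (f i) = w i by exact: s2valP' (cid2 (hw i)).
exists (assemble f (off_diag k)); first exact: closure_assemble.
rewrite blocks_assemble => [|i]; last by case: (fcl i).
by congr mk_blocks; apply: functional_extensionality_dep.
Qed.

(** No alpha_i appears, because [iota] after [kappa] is already the projection onto the corner
    ([kappaK]). *)
Definition proj_blocks (v : KY) : KY :=
  mk_blocks (fun i => orth_proj (W i) (fun x => kappa i (v (inl (Tagged (fun i => X i) x)))))
    (fun ij => v (inr ij)).

Lemma closed_W i : closed_subspace (W i).
Proof. exact: (closed_phi (htr i) (hX i)). Qed.

Lemma proj_blocksP v : (blocks @` cl) (proj_blocks v) /\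
  forall u, (blocks @` cl) u -> '[v - proj_blocks v, u] = 0.
Proof.
rewrite image_blocks; split.
  eexists; eexists; split; last reflexivity.
  move=> i.
  by case: (orth_projP (closed_W i) (fun x => kappa i (v (inl (Tagged (fun i => X i) x))))).
move=> _ [w [k [hw ->]]]; rewrite inner_hsum big_sumType /=.
rewrite [X in _ + X]big1 ?addr0; last first.
  move=> [i j] _ /=; rewrite -[X in '[X, _]]/(v (inr (i, j)) - proj_blocks v (inr (i, j))) /=.
  have Di := A_cproj i; have Dj := A_cproj j.
  case: ifP => ij; first by rewrite inner0r.
  have adjE := lmul_adj hD Di Dj; rewrite !cproj_adj in adjE.
  rewrite -adjE (bmB (bm_lmul hD Di Dj)) lmul_cproj !eqxx subrr inner0l//.
pose kv i : hilbert_sum (fun _ : X i => L2_ i) :=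
  fun x => kappa i (v (inl (Tagged (fun i => X i) x))).
transitivity (\sum_i \sum_(x : X i) '[v (inl (Tagged (fun i => X i) x)) -
    iota (orth_proj (W i) (kv i) x), iota (w i x)]).
  rewrite sig_big_dep; apply: eq_bigr => -[i x] _ //.
apply: big1 => i _; have [_ h] := orth_projP (closed_W i) (kv i).
(* The embedding of a summand scales all inner products by the same factor, so orthogonality in the
   summand suffices. *)
transitivity ((alpha i ^+ 2)%:C%C * '[kv i - orth_proj (W i) (kv i), w i]).
  rewrite inner_hsum mulr_sumr; apply: eq_bigr => x _.
  rewrite inner_conj iota_adj rmorphM /= conj_real -inner_conj (bmB (bm_kappa i)) iotaK //.
by rewrite h// mulr0.
Qed.

Lemma closed_blocks : closed_subspace (blocks @` cl).
Proof.
apply: closed_complemented.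
- exists (fun=> 0); first exact/(closure_Der _ _)/(Der11_0 hD).
  by apply/funext => -[[i x]|[i j]] /=; apply: bm0; apply: (bm_lmul hD); exact: A_cproj.
- move=> c _ _ [d hd <-] [d' hd' <-]; exists (fun a => c *: d a + d' a).
    exact: closure_comb.
  by apply/funext => -[[i x]|[i j]] /=; apply: bmP; apply: (bm_lmul hD); exact: A_cproj.
- by move=> v; exists (proj_blocks v); case: (proj_blocksP v).
Qed.

(** The correspondence pairs [phi] and [blocks] of the same derivation; the two bounds make it
    bicontinuous, and right multiplication commutes with the cutting by projections. *)
Lemma vn_dim_blocks : vn_dim e (ph @` cl) = vn_dim e (blocks @` cl).
Proof.
have [C hC] := blocks_bound; have [C' hC'] := phi_bound_blocks.
pose B : R := `|C| + `|C'|.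
have CB x : 0 <= x -> C * x <= B * x.
  move=> x0; rewrite ler_wpM2r//; have := ler_norm C; have := normr_ge0 C'.
  rewrite /B; lra.
have CB' x : 0 <= x -> C' * x <= B * x.
  move=> x0; rewrite ler_wpM2r//; have := ler_norm C'; have := normr_ge0 C.
  rewrite /B; lra.
apply: (@vn_dim_eq _ _ _ _ hD _ _
  (fun x y => exists d, [/\ cl d, x = ph d & y = blocks d]) B).
- move=> c _ _ _ _ [d [hd -> ->]] [d' [hd' -> ->]].
  exists (fun a => c *: d a + d' a); split=> //; first exact: closure_comb.
  by apply/funext => -[[i x]|[i j]] /=; apply/esym/bmP; apply: (bm_lmul hD); exact: A_cproj.
- move=> u v _ _ Du Dv [d [hd -> ->]].
  exists (fun a => rmul u v (d a)); split=> //; first exact: closure_rmul.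
  by apply/funext => -[[i x]|[i j]] /=; rewrite /rmul_vec /= (lmul_rmul hD)//; exact: A_cproj.
- move=> _ _ [d [[hd _] -> ->]]; split.
    by apply: le_trans (hC _ hd) _; exact/CB/hnorm_ge0.
  by apply: le_trans (hC' _ hd) _; exact/CB'/hnorm_ge0.
- exact: closed_phi.
- exact: closed_blocks.
- by move=> _ _ [d [hd -> ->]]; split; exists d.
- by move=> _ [d hd <-]; exists (blocks d), d.
- by move=> _ [d hd <-]; exists (ph d), d.
Qed.

Lemma vn_dim_direct_sum : vn_dim e (ph @` cl) =
  \sum_i (alpha i ^+ 2 * vn_dim (tens_ i idfun idfun) (W i) + alpha i * (1 - alpha i)).
Proof.
have D1 := A_id hU; rewrite vn_dim_blocks.
have projE v : orth_proj (blocks @` cl) v = proj_blocks v.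
  have [h1 h2] := proj_blocksP v; exact: (orth_proj_uniq closed_blocks h1 h2).
pose el i (x : X i) : idx := inl (Tagged (fun i => X i) x).
(* The projection acts on [kappa e], the unit tensor of the summand, and [iota_adj] moves the outer
   [iota] onto the second [e], releasing alpha_i^2. *)
have hinl i (x : X i) :
    '[orth_proj (blocks @` cl) (hsum_inj (H := fun _ : idx => L2) (i := el i x) e) (el i x), e] =
    (alpha i ^+ 2)%:C%C * '[orth_proj (W i)
      (hsum_inj (H := fun _ : X i => L2_ i) (i := x) (tens_ i idfun idfun)) x, tens_ i idfun idfun].
  rewrite projE -[X in '[X, _]]/(iota _) iota_adj kappa_e; congr (_ * '[orth_proj _ _ x, _]).
  apply/funext => x'; have [<-|xx'] := eqVneq x x'; first by rewrite !hsum_injE kappa_e.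
  rewrite !hsum_inj_neq ?(bm0 (bm_kappa i))//.
  by apply: contra_neq xx' => -[] /eqP; rewrite eq_Tagged => /eqP.
have hinr ij : '[orth_proj (blocks @` cl)
      (hsum_inj (H := fun _ : idx => L2) (i := inr ij) e) (inr ij), e] =
    (if ij.1 == ij.2 then 0 else alpha ij.1 * alpha ij.2)%:C%C.
  case: ij => i j; have Di := A_cproj i; have Dj := A_cproj j.
  rewrite projE /= hsum_injE; case: ifP => _; first by rewrite inner0l.
  by rewrite (lmul_e hD)// (inner_tens_e hD)// !dtr_cproj -rmorphM.
rewrite /vn_dim; transitivity (complex.Re (
    \sum_i \sum_(x : X i) (alpha i ^+ 2)%:C%C * '[orth_proj (W i)
      (hsum_inj (H := fun _ : X i => L2_ i) (i := x) (tens_ i idfun idfun)) x,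
      tens_ i idfun idfun] +
    \sum_i \sum_j (if i == j then 0 else alpha i * alpha j)%:C%C)).
  congr complex.Re; rewrite big_sumType; congr (_ + _).
    by rewrite sig_big_dep; apply: eq_bigr => -[i x] _; exact: hinl.
  by rewrite pair_big; apply: eq_bigr => ij _; exact: hinr.
rewrite -big_split /= complexRe_sum; apply: eq_bigr => i _.
rewrite [LHS]raddfD /= -mulr_sumr; congr (_ + _).
  by case: (\sum_x _) => u v /=; rewrite mul0r subr0.
(* Writing 1 as the sum of the weights turns 1 - alpha_i into the sum over j <> i. *)
rewrite -rmorph_sum /= (bigD1 i)//= eqxx add0r -alpha_sum [in RHS](bigD1 i)//=.
rewrite [alpha i + _]addrC addrK mulr_sumr; apply: eq_bigr => j ji.
by rewrite eq_sym (negPf ji).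
Qed.

End derivations.
End direct_sum_algebra.

(** * Application to subalgebras of tracial von Neumann algebras *)

Lemma tracial_subalgebra (R : realType) (M : tracial_von_neumann R)
    (A : set (op (tvn_space M))) :
  unital_star_algebra A -> A `<=` tvn_alg M -> tracial_algebra A (tvn_tr M).
Proof.
move=> hA AM; have hM := tvn_trP M; split=> //.
- by move=> c S T /AM MS /AM MT; exact: (tr_linear hM).
- by move=> T /AM; exact: (tr_pos hM).
- by move=> S T /AM MS /AM MT; exact: (tr_tracial hM).
- exact: (tr_id hM).
Qed.

Lemma generates_xget (R : realType) (H : hilbert R) (B A : set (op H)) :
  finitely_generated_over B A -> generates B A (xget fset0 [set X | generates B A X]).
Proof. by move=> [X hX]; exact: (@xgetPex _ fset0 [set X | generates B A X]) (ex_intro _ X hX). Qed.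

Theorem theorem2p4 (R : realType) (d : nat)
    (M : 'I_d -> tracial_von_neumann R)
    (A : forall i : 'I_d, set (op (tvn_space (M i))))
    (hA : forall i, unital_star_algebra (A i))
    (hAM : forall i, A i `<=` tvn_alg (M i))
    (hfg : forall i, finitely_generated (A i))
    (alpha : 'I_d -> R) (halpha : forall i, 0 < alpha i)
    (halpha1 : \sum_i alpha i = 1) :
  free_stein_dim (direct_sum A) (weighted_trace alpha (fun i => tvn_tr (M i))) =
  \sum_i (alpha i ^+ 2 * free_stein_dim (A i) (tvn_tr (M i))
          + alpha i * (1 - alpha i)).
Proof.
have htr i := tracial_subalgebra (hA i) (hAM i).
have hX i := generates_xget (hfg i).
(* [Y] only witnesses that the direct sum is finitely generated; the set picked inside
   [free_stein_dim] may be another one. *)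
have [Y [hY _]] := direct_sum_fg hA hX.
exact: (vn_dim_direct_sum hA htr halpha halpha1 hX (generates_xget (ex_intro _ Y hY))).
Qed.
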